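(* Let $n\ge2$ and $m\ge0$. The map $P_{\mathsf{dec}}$ defines a $\mathfrak q_n$-crystal quasi-isomorphism $\mathbb B_n^{\otimes m}\to\bigsqcup_{\lambda}\textsf{DecTab}_n(\lambda)$ and a $\mathfrak q^+_n$-crystal quasi-isomorphism $(\mathbb B^+_n)^{\otimes m}\to\bigsqcup_{\lambda}\textsf{DecTab}^+_n(\lambda)$, where both disjoint unions range over strict partitions $\lambda$ of $m$ with at most $n$ parts. Moreover, the full $\mathfrak q_n$-subcrystals of $\mathbb B_n^{\otimes m}$ and the full $\mathfrak q^+_n$-subcrystals of $(\mathbb B^+_n)^{\otimes m}$ are exactly the subsets on which $Q_{\mathsf{dec}}$ is constant.
   Context: Primed numbers: $i':=i-\tfrac12$, ordered $1'<1<2'<2<\cdots$; adding/subtracting 1 keeps prime status; $\lceil\cdot\rceil$ removes a prime. For a word $w=w_1\cdots w_m$ in $\{1'<1<\dots<n'<n\}$: $\mathsf{wt}(w)_i$ = number of letters in $\{i',i\}$. For $i\in[n-1]$, mark letters in $\{i',i\}$ by '')'' and letters in $\{(i+1)',i+1\}$ by ''(''; $i$-unpaired letters are those not matched in the usual parenthesis matching; $e_i(w)=0$ if no $i$-unpaired letter is in $\{(i+1)',i+1\}$, else subtract 1 from the first such letter; $f_i(w)=0$ if no $i$-unpaired letter is in $\{i',i\}$, else add 1 to the last such letter. $e_0(w)=0$ if $w$ has no $1'$ or a $1$ occurs before the first $1'$, else change the first $1'$ to $1$; $f_0(w)=0$ if $w$ has no $1$ or a $1'$ occurs before the first $1$,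 else change the first $1$ to $1'$. $e_{\overline1}$: let $j,k$ be minimal with $w_j\in\{2',2\}$, $w_k\in\{1',1\}$; if $j$ does not exist or $j>k$ then $0$; if $j$ exists and $k$ does not, subtract 1 from $w_j$; otherwise replace $w_j$ by $w_k$ and $w_k$ by $w_j-1$. $f_{\overline1}$: let $j<k$ be the two smallest indices with $w_j,w_k\in\{1',1\}$; if $j$ does not exist or a letter before position $j$ lies in $\{2',2\}$ then $0$; if $j$ exists and $k$ does not, add 1 to $w_j$; otherwise replace $w_j$ by $w_k+1$ and $w_k$ by $w_j$. All operators send $0$ to $0$. $(\mathbb B^+_n)^{\otimes m}$ is the set of such words of length $m$ with $\mathsf{wt}$ and all $e_i,f_i$ ($i\in\{\overline1,0,1,\dots,n-1\}$), a $\mathfrak q^+_n$-crystal; $\mathbb B^{\otimes m}_n$ is its subset of unprimed words with $\mathsf{wt}$ and $e_i,f_i$ for $i\in\{\overline1,1,\dots,n-1\}$, a $\mathfrak q_n$-crystal. Decomposition tableaux. For strict $\lambda=(\lambda_1>\dots>\lambda_\ell>0)$ the shifted diagram is $\{(i,i+j-1):i\in[\ell],j\in[\lambda_i]\}$; row $i$ = boxes $(i,\cdot)$. A hook word is a sequence of positive integers $w_1\cdots w_k$ with $w_1\ge\dots\ge w_p<w_{p+1}<\dots<w_k$ for some $p\in[k]$; $w_1\cdots w_p$ is its weakly decreasing part, $w_{p+1}\cdots w_k$ its increasing part, $w_p$ its middle element. A decomposition tableau of shape $\lambda$ assigns positive integers to the shifted diagram so that each row $\rho_i$ (read left to right) is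 a hook word and $\rho_i$ is a hook subword of maximal length in $\rho_{i+1}\rho_i$; a primed decomposition tableau adds primes to the middle elements of some subset of rows. $\textsf{DecTab}_n(\lambda)$, $\textsf{DecTab}^+_n(\lambda)$: decomposition / primed decomposition tableaux of shape $\lambda$ with entries in $\{1'<\dots<n'<n\}$. $\mathsf{revrow}(T)$ reads row 1 right to left, then row 2 right to left, etc. The crystal structure on $\textsf{DecTab}^+_n(\lambda)$: $\mathsf{wt}(T)_i$ = number of entries in $\{i',i\}$; $e_i(T)$ is $0$ if $e_i(\mathsf{revrow}(T))=0$ and otherwise the tableau of shape $\lambda$ with reverse row reading word $e_i(\mathsf{revrow}(T))$, similarly $f_i$ (these lie in $\textsf{DecTab}^+_n(\lambda)\sqcup\{0\}$); $\textsf{DecTab}_n(\lambda)$ carries the restricted operators with $i\neq0$. Decomposition insertion. For a primed decomposition tableau $T$ and primed number $x$, $x\xrightarrow{\mathsf{dec}}T$ is computed as follows. At step $i$ a primed number $a_i$ is inserted into row $i$ (row $i$ may be empty), starting with $a_1=x$. Put $a=\lceil a_i\rceil$ and remove any prime from the middle element $m_i$ of row $i$ (if the row is nonempty), remembering whether $m_i$ was primed. If appending $a$ to the end of the (now unprimed) row gives a hook word, append it; otherwise $a$ replaces the leftmost entry $b$ of the increasing part with $b\ge a$, and then $b$ replaces the leftmost entry $c$ of the weakly decreasing part with $c<b$. Then: (1) if row $i$ was initially empty or the position of the middle element of the row changed: if $a_i$ is primed, prime the new middle element; if a box was appended, halt, and the insertion is even if row $i$ was initially empty or $m_i$ was unprimed,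 odd otherwise; else set $a_{i+1}=c$ if $m_i$ was unprimed and $a_{i+1}=c'$ if $m_i$ was primed. (2) If the position of the middle element did not change: if $m_i$ was primed, prime the middle element; if a box was appended, halt, and the insertion is even if $a_i$ is unprimed and odd if $a_i$ is primed; else set $a_{i+1}=c$ if $a_i$ is unprimed and $a_{i+1}=c'$ if $a_i$ is primed. For a primed word $w=w_m\cdots w_2w_1$ (so $w_1$ is its last letter), $P_{\mathsf{dec}}(w):=w_m\xrightarrow{\mathsf{dec}}(\cdots(w_2\xrightarrow{\mathsf{dec}}(w_1\xrightarrow{\mathsf{dec}}\emptyset))\cdots)$, and $Q_{\mathsf{dec}}(w)$ is the tableau of the same shape with entry $i$ (resp. $i'$) in the box added when inserting $w_i$, if that insertion is even (resp. odd). Crystal terms. The crystal graph has edges $b\to f_i(b)$ for all indices $i$ of the type; a full subcrystal is a connected component with restricted maps. An isomorphism is a weight-preserving bijection commuting with all $e_i,f_i$. A map $\phi:\mathcal B\to\mathcal C$ is a quasi-isomorphism if for each full subcrystal $\mathcal B'\subseteq\mathcal B$ there is a full subcrystal $\mathcal C'\subseteq\mathcal C$ such that $\phi|_{\mathcal B'}:\mathcal B'\to\mathcal C'$ is an isomorphism. *)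

(* Defs.v *)
From mathcomp Require Import all_boot.
From Stdlib Require Import Relation_Operators.

Set Implicit Arguments.
Unset Strict Implicit.
Unset Printing Implicit Defensive.

(* The primed number i' is (i, true) and the number i is (i, false), so x.1 is
   the ceiling of x, and adding 1 to x gives (x.1.+1, x.2). *)
Definition letter := (nat * bool)%type.
Definition word := seq letter.

Definition in_alphabet (n : nat) (x : letter) : bool := 0 < x.1 <= n.
Definition unprimed (x : letter) : bool := ~~ x.2.

Definition letter0 : letter := (0, false).
Definition letter_at (w : word) (k : nat) : letter := nth letter0 w k.
Definition set_letter (w : word) (k : nat) (x : letter) : word :=
  set_nth letter0 w k x.
Definition succ_letter (x : letter) : letter := (x.1.+1, x.2).
Definition pred_letter (x : letter) : letter := (x.1.-1, x.2).

(* In the crystal operators, [None] plays the role of 0. *)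
Inductive crystal_index := Bar1 | Idx of nat.

Definition q_index (n : nat) (i : crystal_index) : bool :=
  if i is Idx k then 0 < k < n else true.

Definition q_plus_index (n : nat) (i : crystal_index) : bool :=
  if i is Idx k then k < n else true.

(* Left-to-right scan of the parenthesis word, where letters in {i', i} are
   closing and letters in {(i+1)', i+1} are opening.  [k] is the position of the
   head of [w] in the full word, [cl] lists the unmatched closing positions met
   so far and [op] is the stack of currently unmatched opening positions, the
   most recent first in both cases. *)
Fixpoint unpaired_scan (i : nat) (w : word) (k : nat) (cl op : seq nat) :
    seq nat * seq nat :=
  if w is x :: w' then
    if x.1 == i.+1 then unpaired_scan i w' k.+1 cl (k :: op)
    else if x.1 == i then
      if op is _ :: op' then unpaired_scan i w' k.+1 cl op'
      else unpaired_scan i w' k.+1 (k :: cl) [::]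
    else unpaired_scan i w' k.+1 cl op
  else (rev cl, rev op).

Definition unpaired_low (i : nat) (w : word) : seq nat :=
  (unpaired_scan i w 0 [::] [::]).1.
Definition unpaired_high (i : nat) (w : word) : seq nat :=
  (unpaired_scan i w 0 [::] [::]).2.

Definition e_pos (i : nat) (w : word) : option word :=
  if unpaired_high i w is k :: _
  then Some (set_letter w k (pred_letter (letter_at w k)))
  else None.

Definition f_pos (i : nat) (w : word) : option word :=
  if unpaired_low i w is k :: s
  then let l := last k s in
       Some (set_letter w l (succ_letter (letter_at w l)))
  else None.

(* [index x w] is [size w] when x does not occur in w; likewise for [find]. *)
Definition e_zero (w : word) : option word :=
  let j := index (1, true) w in
  if (j == size w) || (index (1, false) w < j) then None
  else Some (set_letter w j (1, false)).

Definition f_zero (w : word) : option word :=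
  let j := index (1, false) w in
  if (j == size w) || (index (1, true) w < j) then None
  else Some (set_letter w j (1, true)).

Definition e_bar1 (w : word) : option word :=
  let j := find (fun x : letter => x.1 == 2) w in
  let k := find (fun x : letter => x.1 == 1) w in
  let wj := letter_at w j in
  let wk := letter_at w k in
  if (j == size w) || (k < j) then None
  else if k == size w then Some (set_letter w j (pred_letter wj))
  else Some (set_letter (set_letter w j wk) k (pred_letter wj)).

Definition f_bar1 (w : word) : option word :=
  let j := find (fun x : letter => x.1 == 1) w in
  let k := j.+1 + find (fun x : letter => x.1 == 1) (drop j.+1 w) in
  let wj := letter_at w j in
  let wk := letter_at w k in
  if (j == size w) || has (fun x : letter => x.1 == 2) (take j w) then None
  else if size w <= k then Some (set_letter w j (succ_letter wj))
  else Some (set_letter (set_letter w j (succ_letter wk)) k wj).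

Definition word_e (i : crystal_index) : word -> option word :=
  match i with
  | Bar1 => e_bar1
  | Idx 0 => e_zero
  | Idx k => e_pos k
  end.

Definition word_f (i : crystal_index) : word -> option word :=
  match i with
  | Bar1 => f_bar1
  | Idx 0 => f_zero
  | Idx k => f_pos k
  end.

(* The ordinal i of 'I_n stands for the number i + 1 of [n]. *)
Definition word_wt (n : nat) (w : word) : {ffun 'I_n -> nat} :=
  [ffun i : 'I_n => count (fun x : letter => x.1 == i.+1) w].

(* [hook_at q w]: w is a hook word with middle element at the 0-based position
   q, that is w_0 >= ... >= w_q < w_(q+1) < ...; such a q is unique. *)
Definition hook_at (w : seq nat) (q : nat) : bool :=
  sorted geq (take q.+1 w) && sorted ltn (drop q w).

Definition hook_word (w : seq nat) : bool :=
  has (hook_at w) (iota 0 (size w)).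

Definition middle (w : seq nat) : nat :=
  find (hook_at w) (iota 0 (size w)).

(* A filling of a shifted diagram is the list of its rows; the k-th entry of
   row i is the one in box (i, i + k - 1), and the row lengths are the shape. *)
Definition tableau := seq (seq letter).

Definition ceil_row (r : seq letter) : seq nat := [seq x.1 | x <- r].

Definition strict_partition (la : seq nat) : bool :=
  sorted gtn la && all (ltn 0) la.

Definition decomposition_tableau (T : seq (seq nat)) : Prop :=
  [/\ all (all (ltn 0)) T,
      all hook_word T
    & forall i, i.+1 < size T ->
      forall s, subseq s (nth [::] T i.+1 ++ nth [::] T i) ->
        hook_word s -> size s <= size (nth [::] T i)].

Definition primes_in_middle (r : seq letter) : Prop :=
  forall k, (letter_at r k).2 -> k = middle (ceil_row r).

Definition primed_decomposition_tableau (T : tableau) : Prop :=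
  decomposition_tableau [seq ceil_row r | r <- T] /\
  forall r, r \in T -> primes_in_middle r.

Definition DecTabPlus (n : nat) (la : seq nat) (T : tableau) : Prop :=
  [/\ shape T = la, primed_decomposition_tableau T
    & all (all (in_alphabet n)) T].

Definition DecTab (n : nat) (la : seq nat) (T : tableau) : Prop :=
  DecTabPlus n la T /\ all (all unprimed) T.

Definition revrow (T : tableau) : word := flatten [seq rev r | r <- T].

Definition tableau_of_revrow (la : seq nat) (w : word) : tableau :=
  [seq rev r | r <- reshape la w].

Definition tab_e (i : crystal_index) (T : tableau) : option tableau :=
  omap (tableau_of_revrow (shape T)) (word_e i (revrow T)).
Definition tab_f (i : crystal_index) (T : tableau) : option tableau :=
  omap (tableau_of_revrow (shape T)) (word_f i (revrow T)).
Definition tab_wt (n : nat) (T : tableau) : {ffun 'I_n -> nat} :=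
  word_wt n (flatten T).

Definition prime_middle (r : seq nat) (p : bool) : seq letter :=
  [seq (nth 0 r k, p && (k == middle r)) | k <- iota 0 (size r)].

(* Insertion of x into one row.  The result is the new row, [None] if a box was
   appended and [Some c] if c was bumped, and a boolean q: when a box was
   appended, q tells whether the insertion is odd; when c was bumped, q tells
   whether it is passed on to the next row as c'. *)
Definition row_insert (x : letter) (row : seq letter) :
    seq letter * option nat * bool :=
  let a := x.1 in
  let r := ceil_row row in
  let mid := middle r in
  let mid_primed := (letter_at row mid).2 in
  let: (r', bumped) :=
    if hook_word (rcons r a) then (rcons r a, None)
    else
      let kb := mid.+1 + find (leq a) (drop mid.+1 r) in
      let b := nth 0 r kb in
      let kc := find (gtn b) (take mid.+1 r) in
      let c := nth 0 r kc in
      (set_nth 0 (set_nth 0 r kb a) kc b, Some c) in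
  if nilp r || (middle r' != mid)
  then (prime_middle r' x.2, bumped, mid_primed)
  else (prime_middle r' mid_primed, bumped, x.2).

(* The result is the new tableau, the 0-based row of the added box, and whether
   the insertion is odd.  Inserting into an empty row always appends a box. *)
Fixpoint dec_insert (x : letter) (T : tableau) : tableau * nat * bool :=
  if T is row :: T' then
    match row_insert x row with
    | (row', None, q) => (row' :: T', 0, q)
    | (row', Some c, q) =>
        let: (T'', k, odd) := dec_insert (c, q) T' in (row' :: T'', k.+1, odd)
    end
  else let: (row', _, q) := row_insert x [::] in ([:: row'], 0, q).

Definition add_box (T : tableau) (k : nat) (x : letter) : tableau :=
  set_nth [::] T k (rcons (nth [::] T k) x).

(* Letters are inserted starting from the last letter of the word. *)
Fixpoint PQdec (w : word) : tableau * tableau :=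
  if w is x :: s then
    let: (P, Q) := PQdec s in
    let: (P', k, odd) := dec_insert x P in
    (P', add_box Q k ((size s).+1, odd))
  else ([::], [::]).

Definition Pdec (w : word) : tableau := (PQdec w).1.
Definition Qdec (w : word) : tableau := (PQdec w).2.

(* The underlying set consists of the b : carrier satisfying [elt], and only the
   operators with index in I belong to the crystal. *)
Record crystal (n : nat) (I : pred crystal_index) := Crystal {
  carrier : Type;
  elt : carrier -> Prop;
  wt : carrier -> {ffun 'I_n -> nat};
  crystal_e : crystal_index -> carrier -> option carrier;
  crystal_f : crystal_index -> carrier -> option carrier
}.
Arguments Crystal {n I carrier}.

Definition crystal_edge n I (B : crystal n I) (b c : carrier B) : Prop :=
  [/\ elt b, elt c & exists2 i, I i & crystal_f i b = Some c].

Definition full_subcrystal n I (B : crystal n I) (S : carrier B -> Prop) : Prop :=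
  exists2 b, elt b &
    forall c, S c <-> clos_refl_sym_trans _ (@crystal_edge n I B) b c.

Definition crystal_isomorphism n I (B C : crystal n I) (phi : carrier B -> carrier C)
    (S : carrier B -> Prop) (S' : carrier C -> Prop) : Prop :=
  [/\ forall b, S b -> S' (phi b),
      forall b c, S b -> S c -> phi b = phi c -> b = c,
      forall c, S' c -> exists2 b, S b & phi b = c,
      forall b, S b -> wt (phi b) = wt b
    & forall i b, I i -> S b ->
        crystal_e i (phi b) = omap phi (crystal_e i b) /\
        crystal_f i (phi b) = omap phi (crystal_f i b)].

Definition quasi_isomorphism n I (B C : crystal n I) (phi : carrier B -> carrier C) :
    Prop :=
  (forall b, elt b -> elt (phi b)) /\
  forall S, full_subcrystal S ->
    exists2 S', full_subcrystal S' & crystal_isomorphism phi S S'.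
Arguments full_subcrystal {n I} B S.
Arguments quasi_isomorphism {n I} B C phi.

Definition words (n m : nat) (w : word) : Prop :=
  size w = m /\ all (in_alphabet n) w.

Definition word_crystal (n m : nat) : crystal n (q_index n) :=
  Crystal (fun w => words n m w /\ all unprimed w) (word_wt n) word_e word_f.

Definition word_crystal_plus (n m : nat) : crystal n (q_plus_index n) :=
  Crystal (words n m) (word_wt n) word_e word_f.

(* The sets DecTab n la for distinct la are disjoint, since la is the shape. *)
Definition union_over_shapes (n m : nat) (D : seq nat -> tableau -> Prop)
    (T : tableau) : Prop :=
  exists la, [/\ strict_partition la, sumn la = m, size la <= n & D la T].

Definition DecTab_crystal (n m : nat) : crystal n (q_index n) :=
  Crystal (union_over_shapes n m (DecTab n)) (tab_wt n) tab_e tab_f.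

Definition DecTab_crystal_plus (n m : nat) : crystal n (q_plus_index n) :=
  Crystal (union_over_shapes n m (DecTabPlus n)) (tab_wt n) tab_e tab_f.

(* S is one of the nonempty fibres of q on the underlying set of B. *)
Definition level_set n I (B : crystal n I) (T : Type) (q : carrier B -> T)
    (S : carrier B -> Prop) : Prop :=
  exists2 b, elt b & forall c, S c <-> elt c /\ q c = q b.
Arguments level_set {n I} B {T} q S.

(* Main.v *)
(** Reading rows from right to left, one insertion step x -> row turns the word
    x :: row into row' or row' followed by the bumped letter.  On unprimed words
    such a step is a composition of Knuth-type moves, each of which commutes with
    the operators e_i and f_i, i > 0; together with an analysis of e_0, e_bar1 and
    the primes, this makes every row step a bisimulation for the crystal operators.
    Bisimulations compose, so w and revrow (Pdec w) are bisimilar with the same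
    sequence of added boxes and parities: Pdec commutes with the operators and Qdec
    is constant on components.  Row steps are reversible, so (Pdec, Qdec) is
    injective.

    Conversely, words with the same Qdec are connected.  A word of [n] that
    maximizes the sum of the squares of its weight in its component, with the
    weight sorted, satisfies #i < #(i+1) in every prefix containing an i.  Since row j
    of Pdec w only has letters <= n - j + 1, the tableau of such a word must have
    its j-th row constant equal to n - j + 1; in particular the shape is strict,
    and the maximality condition on adjacent rows holds there, hence everywhere on
    the component, because the length of a longest hook subword is invariant under
    the operators.  The primes of this extremal tableau are removed one at a time by
    lowering a middle letter to 1, applying e_0, and raising it back. *)

Require Import Defs.
From mathcomp Require Import all_boot.
From mathcomp Require Import zify.
From Stdlib Require Import Classical Relation_Operators.

Set Implicit Arguments.
Unset Strict Implicit.
Unset Printing Implicit Defensive.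

(** * Signatures of unprimed words *)

(** For i > 0 an operator keeps the positions of the strict descents of a word, and the branch taken
    by a row step (box appended or not, middle moved or not) can be read off from descents of its
    input and output. Domains of moves are therefore stated as descent patterns, which are stable
    under e_i. The operators of index bar 1 do change descents: a 2 next to a middle 1 can become a
    1, and then the middle shifts. There the two parity rules of the insertion may trade places, and
    the exchange of primes built into these operators is what keeps the result consistent.
    Maximality of hook subwords is never followed through the insertion: it is checked on one
    tableau per component and transported. Sums of squares serve in the extremal argument because a
    full i-string without unpaired i reflects the weight, hence keeps the sum, while a further step
    after suitable reflections would increase it. *)

(* The numbers of i-unpaired letters i and i+1.  In phi, a leading i+1 is matched
   with an unpaired i, if there is one: the predecessor is truncated at 0. *)
Fixpoint phi (i : nat) (w : seq nat) : nat :=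
  if w is x :: v then
    if x == i.+1 then (phi i v).-1
    else if x == i then (phi i v).+1 else phi i v
  else 0.

Fixpoint eps (i : nat) (w : seq nat) : nat :=
  if w is x :: v then
    if x == i.+1 then (phi i v == 0) + eps i v else eps i v
  else 0.

Fixpoint en (i : nat) (w : seq nat) : option (seq nat) :=
  if w is x :: v then
    if (x == i.+1) && (phi i v == 0) then Some (i :: v)
    else omap (cons x) (en i v)
  else None.

(** The test compares the truth value of [x == i.+1] with [phi i v]: it holds iff an unpaired i of v
    survives after x has possibly taken one. Then the last unpaired i lies in v; otherwise it can
    only be x. *)
Fixpoint fn (i : nat) (w : seq nat) : option (seq nat) :=
  if w is x :: v then
    if (x == i.+1) < phi i v then omap (cons x) (fn i v)
    else if x == i then Some (i.+1 :: v) else None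
  else None.

Lemma eqnS i : (i == i.+1) = false.
Proof. lia. Qed.

Lemma eqSn i : (i.+1 == i) = false.
Proof. lia. Qed.

Lemma en_phi i w v : en i w = Some v -> phi i v = (phi i w).+1.
Proof.
elim: w v => //= x w IH v; case: eqP => [->|nx] /=.
  case: eqP => [p0 [<-] /=|p0]; first by rewrite eqxx eqnS p0.
  by case: (en i w) IH => //= u /(_ _ erefl) E [<-] /=; rewrite eqxx E; lia.
case: (en i w) IH => //= u /(_ _ erefl) E [<-] /=.
by rewrite E; case: (x == i.+1) (introF eqP nx) => // _; case: eqP.
Qed.

Lemma en_fn i w v : en i w = Some v -> fn i v = Some w.
Proof.
elim: w v => //= x w IH v; case: eqP => [->|nx] /=.
  case: eqP => [p0 [<-] /=|p0]; first by rewrite eqnS p0 eqxx.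
  case E: (en i w) IH => [u|] //= /(_ _ erefl) E1 [<-] /=.
  by rewrite eqxx (en_phi E) E1 /=; case: (phi i w) p0.
case E: (en i w) IH => [u|] //= /(_ _ erefl) E1 [<-] /=.
by rewrite (en_phi E) E1 /=; case: eqP.
Qed.

Lemma fn_en i w v : fn i w = Some v -> en i v = Some w.
Proof.
elim: w v => //= x w IH v.
case: ltnP => [lt|ge].
  case E: (fn i w) IH => [u|] //= /(_ _ erefl) E1 [<-] /=.
  rewrite E1; have := en_phi E1.
  by case: eqP lt => //= _; case: eqP => //=; lia.
case: (x =P i) => [xi|] // [<-] /=; move: ge; rewrite xi eqnS eqxx => /=.
by case: (phi i w).
Qed.

Lemma fn_none i w : (fn i w == None) = (phi i w == 0).
Proof.
elim: w => //= x w IH; case: ltnP => [lt|ge].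
  have -> : (omap (cons x) (fn i w) == None) = (fn i w == None) by case: (fn i w).
  by rewrite IH; move: lt; case: (x =P i.+1); case: (x =P i) => //=; lia.
have NS (t : seq nat) : (Some t == None) = false by [].
by move: ge; case: (x =P i.+1); case: (x =P i); rewrite ?NS ?eqxx => //=; lia.
Qed.

Lemma en_none i w : (en i w == None) = (eps i w == 0).
Proof.
elim: w => //= x w IH.
have E : (omap (cons x) (en i w) == None) = (en i w == None) by case: (en i w).
case: (x =P i.+1) => _ /=; last by rewrite -IH -E.
by case: (phi i w =P 0) => _ //=; rewrite -IH -E.
Qed.

(** The unpaired i+1 of a absorb unpaired i of b, and the remaining ones of b join those of a. With
    the next two lemmas this is the tensor product rule. *)
Lemma phi_cat i a b : phi i (a ++ b) = phi i a + (phi i b - eps i a).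
Proof.
elim: a => /= [|x a ->]; first lia.
by case: (x =P i.+1) => _; [|case: (x =P i) => _]; case: (phi i a =P 0); lia.
Qed.

Lemma eps_cat i a b : eps i (a ++ b) = eps i b + (eps i a - phi i b).
Proof.
elim: a => /= [|x a IH]; first lia.
rewrite phi_cat IH; case: (x =P i.+1) => _ //; case: (phi i a =P 0) => h; lia.
Qed.

Lemma en_cat i a b :
  en i (a ++ b) =
  if phi i b < eps i a then omap (cat^~ b) (en i a) else omap (cat a) (en i b).
Proof.
elim: a => /= [|x a IH]; first by case: (en i b).
have oc : omap (cons x) (omap (cat a) (en i b)) = omap (cat (x :: a)) (en i b).
  by case: (en i b).
have ob : omap (cons x) (omap (cat^~ b) (en i a)) = omap (cat^~ b) (omap (cons x) (en i a)).
  by case: (en i a).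
rewrite phi_cat IH; case: (x =P i.+1) => _ /=; last by case: ifP.
case: (phi i a =P 0) => h /=; last first.
  by rewrite ifF; [case: ifP | lia].
rewrite h add0n subn_eq0.
case: (leqP (phi i b) (eps i a)) => h2; first by rewrite ifT //; lia.
by rewrite !ifF //; lia.
Qed.

Definition mult (k : nat) (w : seq nat) : nat := count (pred1 k) w.

Lemma phi_mult i w : phi i w + mult i.+1 w = eps i w + mult i w.
Proof.
rewrite /mult; elim: w => //= x w IH; case: (x =P i.+1) => [->|_] /=.
  by rewrite eqSn; case: (phi i w =P 0) => h; lia.
by case: (x =P i) => _; lia.
Qed.

Lemma en_mult i w v : en i w = Some v ->
  [/\ mult i v = (mult i w).+1, (mult i.+1 v).+1 = mult i.+1 w
    & forall k, k != i -> k != i.+1 -> mult k v = mult k w].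
Proof.
rewrite /mult; elim: w v => //= x w IH v; case: ifP => [/andP[/eqP -> _] [<-]|_] /=.
  by rewrite !eqxx eqnS eqSn; split=> // k; rewrite ![_ == k]eq_sym => /negbTE -> /negbTE ->.
case: (en i w) IH => //= u /(_ _ erefl) [h1 h2 h3] [<-] /=; split; try lia.
by move=> k k1 k2; rewrite h3.
Qed.

Lemma en_size i w v : en i w = Some v -> size v = size w.
Proof.
elim: w v => //= x w IH v; case: ifP => [_ [<-]|_] //.
by case: (en i w) IH => //= u /(_ _ erefl) <- [<-].
Qed.

Lemma en_eps i w v : en i w = Some v -> eps i w = (eps i v).+1.
Proof.
by move=> e; have [h1 h2 _] := en_mult e; have := en_phi e; have := phi_mult i w;
  have := phi_mult i v; lia.
Qed.

(* The first unmatched i+1 of w, which e_i changes, splits w into a and b. *)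
Lemma en_split i w v : en i w = Some v ->
  exists a b, [/\ w = a ++ i.+1 :: b, v = a ++ i :: b, eps i a = 0 & phi i b = 0].
Proof.
elim: w v => //= x w IH v; case: ifP => [/andP[/eqP -> /eqP p0] [<-]|nx].
  by exists [::], w.
case: (en i w) IH => //= u /(_ _ erefl) [a [b [E1 E2 h1 h2]]] [<-].
exists (x :: a), b; rewrite E1 E2; split=> //=; rewrite h1.
case: (x =P i.+1) nx => //= _; rewrite E1 phi_cat h1 /= eqxx h2.
by case: (phi i a) => //; rewrite addn0.
Qed.

Fixpoint descents (w : seq nat) : seq bool :=
  if w is x :: v then
    if v is y :: _ then (y < x) :: descents v else [::]
  else [::].

Lemma descents_cons x y v : descents (x :: y :: v) = (y < x) :: descents (y :: v).
Proof. by []. Qed.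

(** Only two neighbours could matter. An i right after the changed letter would be matched with it,
    and an i+1 right before it would be an earlier unmatched one. So neither occurs, and all other
    comparisons survive replacing i+1 by i. *)
Lemma en_descents i w v : en i w = Some v -> descents v = descents w.
Proof.
elim: w v => //= x w IH v; case: ifP => [/andP[/eqP -> p0] [<-]|nx].
  case: w p0 {IH} => //= y w; case: (y =P i.+1) => [-> _|n1].
    by congr cons; lia.
  by case: (y =P i) => [//|n2] _; congr cons; lia.
case E: (en i w) IH => [u|] // /(_ _ erefl) h [<-].
case: w E nx h => [|y w] // E nx h; have := en_size E; case: u E h => [|z u] // E h _.
rewrite !descents_cons h; congr cons; move: E => /=; case: ifP => [/andP[/eqP yi p0] [<- _]|_].
  move: nx; rewrite /= yi eqxx (eqP p0) /=; lia.
by case: (en i w) => //= t [<-].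
Qed.

(** * A row bump as a composition of Knuth moves *)

(** The elementary Knuth relations, oriented: under the hypotheses of [knuth1_comm] the pattern weak
    ascent, descent becomes descent, weak ascent, and [knuth2] goes the other way. The letter that
    stays in place lies between the two that are swapped. *)
Definition knuth1 (w : seq nat) : seq nat :=
  if w is a :: b :: c :: r then
    if a <= c then b :: a :: c :: r else a :: c :: b :: r
  else w.

Definition knuth2 (w : seq nat) : seq nat :=
  if w is a :: b :: c :: r then
    if a <= c then a :: c :: b :: r else b :: a :: c :: r
  else w.

Ltac letter_cases :=
  repeat (match goal with
  | |- context [?x == ?y] => first [have -> : (x == y) = false by lia | have -> : (x == y) = true by lia | case: (x =P y) => ? /=]
  | |- context [?x <= ?y] => first [have -> : (x <= y) = false by lia | have -> : (x <= y) = true by lia | case: (leqP x y) => ? /=]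
  end; cbn [omap obind oapp Option.map Option.bind Option.apply andb negb nat_of_bool eqb ]; try lia).

Ltac branch x i :=
  case: (x =P i.+1) => ?; [try lia | case: (x =P i) => ?; try lia].

(** Only the position of a, b, c relative to i and i+1 matters, and r enters only through [phi i r]
    and [en i r], which are generalized; a finite case check remains. *)
Lemma knuth1_comm i a b c r : a <= b -> c < b ->
  phi i (knuth1 [:: a, b, c & r]) = phi i [:: a, b, c & r] /\
  en i (knuth1 [:: a, b, c & r]) = omap knuth1 (en i [:: a, b, c & r]).
Proof.
move=> ab cb; rewrite /knuth1; move: (leqP a c) => ac.
split; last first.
  { rewrite (fun_if (en i)) /=; move: (en i r) (phi i r) => E P.
  branch a i; branch b i; branch c i; case: ac => ac; try lia; case: E => [u|] /=; letter_cases => //=; letter_cases.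
  all: by subst. }
case: ac => ac /=; move: (phi i r) => P; letter_cases.
Qed.

Lemma knuth2_comm i a b c r : b < a -> b <= c ->
  phi i (knuth2 [:: a, b, c & r]) = phi i [:: a, b, c & r] /\
  en i (knuth2 [:: a, b, c & r]) = omap knuth2 (en i [:: a, b, c & r]).
Proof.
move=> ab cb; rewrite /knuth2; move: (leqP a c) => ac.
split; last first.
  { rewrite (fun_if (en i)) /=; move: (en i r) (phi i r) => E P.
  branch a i; branch b i; branch c i; case: ac => ac; try lia; case: E => [u|] /=; letter_cases => //=; letter_cases.
  all: by subst. }
case: ac => ac /=; move: (phi i r) => P; letter_cases.
Qed.

(** Slides a move along the word: K acts on the front triple, its first output letter is final, and
    the next triple starts right after it. *)
Fixpoint drag (K : seq nat -> seq nat) k w :=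
  if k is k'.+1 then (if K w is p :: w' then p :: drag K k' w' else [::]) else w.

(** [D] is indexed by the number of moves still to be made, so that it can demand a whole run of
    descents ahead. The part on [phi] is needed in the induction because [en] on a cons consults
    [phi] of the tail. *)
Lemma drag_comm K (D : nat -> seq nat -> Prop) i :
  (forall k w, D k.+1 w -> phi i (K w) = phi i w /\ en i (K w) = omap K (en i w)) ->
  (forall k w, D k.+1 w -> exists p y, K w = p :: y /\ D k y) ->
  forall k w, D k w ->
  phi i (drag K k w) = phi i w /\ en i (drag K k w) = omap (drag K k) (en i w).
Proof.
move=> HK HD; elim=> [|k IH] w Dw.
  by split=> //=; case: (en i w).
have [hp he] := HK _ _ Dw; have [p [y [E Dy]]] := HD _ _ Dw.
have [ip ie] := IH _ Dy.
rewrite /= E -hp E /= ip; split=> //.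
move: he; rewrite E /= ie; case: ifP => _.
  by case: (en i w) => //= v [<-].
by case: (en i w) (en i y) => [v|] [u|] //= [<-].
Qed.

Definition run1 q w := take q.+1 (descents w) = false :: nseq q true.
Definition run2 r w := take r.+1 (descents w) = true :: nseq r false.

Lemma run1_step q w : run1 q.+1 w ->
  exists a b c r, [/\ w = [:: a, b, c & r], a <= b & c < b].
Proof.
case: w => [|a [|b [|c r]]] //; rewrite /run1 /= => -[].
by case: ltnP => // h1; case: ltnP => // h2 _ _; exists a, b, c, r.
Qed.

Lemma run2_step q w : run2 q.+1 w ->
  exists a b c r, [/\ w = [:: a, b, c & r], b < a & b <= c].
Proof.
case: w => [|a [|b [|c r]]] //; rewrite /run2 /= => -[].
by case: ltnP => // h1; case: ltnP => // h2 _ _; exists a, b, c, r.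
Qed.

Lemma drag_knuth1_comm i q w : run1 q w ->
  phi i (drag knuth1 q w) = phi i w /\ en i (drag knuth1 q w) = omap (drag knuth1 q) (en i w).
Proof.
move: q w; apply: drag_comm => q w D; have [a [b [c [r [E h1 h2]]]]] := run1_step D; subst w.
  exact: knuth1_comm.
move: D; rewrite /run1 !descents_cons => -[_ _ h].
rewrite /knuth1; case: leqP => h3; eexists _, _; split; try reflexivity; rewrite /run1 !descents_cons.
  by move: h => /= ->; congr cons; lia.
rewrite /= ltnNge (ltnW h2) /=; congr cons.
case: r h => [|d r]; case: q => [|q] //=; rewrite ?take0 // => -[dc ->].
by rewrite (ltn_trans dc h2).
Qed.

Lemma drag_knuth2_comm i q w : run2 q w ->
  phi i (drag knuth2 q w) = phi i w /\ en i (drag knuth2 q w) = omap (drag knuth2 q) (en i w).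
Proof.
move: q w; apply: drag_comm => q w D; have [a [b [c [r [E h1 h2]]]]] := run2_step D; subst w.
  exact: knuth2_comm.
move: D; rewrite /run2 !descents_cons => -[_ _ h].
rewrite /knuth2; case: leqP => h3; eexists _, _; split; try reflexivity; rewrite /run2 !descents_cons.
  rewrite /= (leq_trans h1 h3); congr cons.
  case: r h => [|d r]; case: q => [|q] //=; rewrite ?take0 // => -[dc ->].
  by congr cons; lia.
by move: h => /= ->; congr cons; lia.
Qed.

Definition drag_at K s k w := take s w ++ drag K k (drop s w).

Lemma drag_at_comm K s k i w : s <= size w ->
  phi i (drag K k (drop s w)) = phi i (drop s w) /\
  en i (drag K k (drop s w)) = omap (drag K k) (en i (drop s w)) ->
  phi i (drag_at K s k w) = phi i w /\ en i (drag_at K s k w) = omap (drag_at K s k) (en i w).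
Proof.
move=> sw [hp he]; rewrite /drag_at.
have -> : phi i w = phi i (take s w ++ drop s w) by rewrite cat_take_drop.
have -> : en i w = en i (take s w ++ drop s w) by rewrite cat_take_drop.
rewrite !phi_cat hp; split=> //; rewrite !en_cat hp he.
have st : size (take s w) = s by rewrite size_takel.
case: ifP => _.
  case e: (en i (take s w)) => [u|] //=; have su := en_size e.
  by rewrite take_size_cat ?drop_size_cat // su st.
case: (en i (drop s w)) => //= u.
by rewrite take_size_cat ?drop_size_cat.
Qed.

(* The first drag turns x A b C into A x C b, the second turns b M c N into M b N c. *)
Definition bump q r w := drag_at knuth2 q.+1 r (drag knuth1 q w).

(** The travelling letter is x while it passes A, since x is at most the letter that comes next;
    once x has reached its place, b is released and travels past C. *)
Lemma drag_knuth1E A x b C s : sorted gtn (A ++ b :: C) -> x <= b -> all (gtn x) C ->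
  drag knuth1 (size A + size C) (x :: A ++ b :: C ++ s) = A ++ x :: C ++ b :: s.
Proof.
elim: A => [|a A IH] /= pa xb xC.
  elim: C x b pa xb xC => //= c C IH x b /andP[cb pc] xb /andP[cx xC].
  rewrite leqNgt cx /= IH //; last by apply: order_path_min pc => ???; lia.
  - by case: C pc {IH xC} => //= d C /andP[h ->]; rewrite andbT; lia.
  - by rewrite ltnW.
have : all (gtn a) (A ++ b :: C) by apply: order_path_min pa => ???; lia.
rewrite all_cat /= => /and3P[aA ba aC].
have ss := path_sorted pa.
rewrite -IH //; case: A {IH} pa aA ss => [|a' A] /= pa aA ss; first by rewrite xb.
have : all (gtn a') (A ++ b :: C) by apply: order_path_min ss => ???; lia.
rewrite all_cat /= => /and3P[_ ba' _].
by rewrite (_ : x <= a'); last by lia.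
Qed.

Lemma drag_knuth2E M b c N s : sorted leq (M ++ c :: N) -> c < b -> all (leq b) N ->
  drag knuth2 (size M + size N) (b :: M ++ c :: N ++ s) = M ++ b :: N ++ c :: s.
Proof.
elim: M => [|m M IH] /= pm cb bN.
  elim: N b c pm cb bN => //= n N IH b c /andP[cn pn] cb /andP[bn bN].
  rewrite bn /= IH //; first 1 last; try lia.
  - exact: (order_path_min leq_trans pn).
  - by case: N pn {IH bN} => //= d C /andP[h ->]; rewrite andbT; lia.
have : all (leq m) (M ++ c :: N) by apply: order_path_min pm; exact: leq_trans.
rewrite all_cat /= => /and3P[aM mc aN].
have ss := path_sorted pm.
rewrite -IH //; case: M {IH} pm aM ss => [|m' M] /= pm aM ss.
  by rewrite leqNgt cb.
have : all (leq m') (M ++ c :: N) by apply: order_path_min ss; exact: leq_trans.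
rewrite all_cat /= => /and3P[_ ba' _].
by rewrite leqNgt (_ : m' < b) //; lia.
Qed.

(** * Descent patterns of hook words and the domain of a bump *)

Definition bump_des q r w := take (q + r).+2 (descents w) = false :: nseq q.+1 true ++ nseq r false.

(* A hook word read from right to left, with middle letter m: the increasing part of
   the row is the strictly decreasing word D. *)
Definition hookV (D : seq nat) m U := sorted gtn (rcons D m) && sorted leq (m :: U).

Lemma size_descents w : size (descents w) = (size w).-1.
Proof. by elim: w => //= x [|y w] //= ->. Qed.

Lemma descents_take k w : descents (take k.+1 w) = take k (descents w).
Proof. by elim: w k => [|x w IH] [|k] //; rewrite ?take0 //; case: w IH => [|y w] IH //; rewrite descents_cons /= -IH. Qed.

Lemma descents_drop k w : descents (drop k w) = drop k (descents w).
Proof. by elim: w k => [|x w IH] [|k] //; case: w IH => [|y w] IH; rewrite ?drop0 //= IH. Qed.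

Lemma descents_cat a y b : descents (a ++ y :: b) = descents (rcons a y) ++ descents (y :: b).
Proof. by elim: a => //= x [|z a] //= ->. Qed.

Lemma sorted_gtn_descents w : sorted gtn w = (descents w == nseq (size w).-1 true).
Proof. by elim: w => //= x [|y w] //= ->; rewrite eqseq_cons eqb_id. Qed.

Lemma sorted_leq_descents w : sorted leq w = (descents w == nseq (size w).-1 false).
Proof. by elim: w => //= x [|y w] //= ->; rewrite eqseq_cons eqbF_neg -leqNgt. Qed.

Lemma hookV_descents D m U : hookV D m U ->
  descents (D ++ m :: U) = nseq (size D) true ++ nseq (size U) false.
Proof.
rewrite /hookV sorted_gtn_descents sorted_leq_descents size_rcons => /andP[/eqP e1 /eqP e2].
by rewrite descents_cat e1 e2.
Qed.

Lemma descents_hookV p r (V : seq nat) : V != [::] -> descents V = nseq p true ++ nseq r false ->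
  exists (D : seq nat) (m : nat) (U : seq nat), [/\ V = D ++ m :: U, size D = p, size U = r & hookV D m U].
Proof.
move=> V0 dV; have sV : size V = (p + r).+1.
  by move: (size_descents V) V0; rewrite dV size_cat !size_nseq; case: V {dV} => //= ? ? ->.
have [D [m [U [EV sD]]]] : exists D m U, V = D ++ m :: U /\ size D = p.
  exists (take p V), (nth 0 V p), (drop p.+1 V).
  by rewrite -drop_nth ?cat_take_drop ?size_takel // sV; lia.
have sU : size U = r by move: sV; rewrite EV size_cat /= sD; lia.
exists D, m, U; split=> //; move: dV; rewrite EV descents_cat => /eqP.
rewrite eqseq_cat ?size_descents ?size_rcons ?size_nseq //= => /andP[e1 e2].
by rewrite /hookV sorted_gtn_descents sorted_leq_descents size_rcons /= sD sU e1.
Qed.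

Lemma split_dec x D : sorted gtn D -> D != [::] -> x <= head 0 D ->
  exists (A : seq nat) (b : nat) (C : seq nat), [/\ D = A ++ b :: C, x <= b & all (gtn x) C].
Proof.
elim: D => //= d D IH pD _ xd.
case: (leqP x (head 0 D)) => [h|h]; last first.
  exists [::], d, D; split=> //; case: D pD h {IH} => //= e D /andP[_ pD] h.
  by rewrite h; apply: sub_all (order_path_min _ pD) => [z|] /=; [lia | move=> ???; lia].
case: D IH pD h => [|e D] IH pD h.
  by exists [::], d, [::]; split.
have [//|//|A [b [C [E xb xC]]]] := IH _ _ h; first by case/andP: pD.
by exists (d :: A), b, C; rewrite E.
Qed.

Lemma split_inc b m U : sorted leq (m :: U) -> m < b ->
  exists (M : seq nat) (c : nat) (N : seq nat), [/\ m :: U = M ++ c :: N, c < b & all (leq b) N].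
Proof.
elim: U m => [|u U IH] m pU mb; first by exists [::], m, [::].
case: (leqP b u) => h.
  exists [::], m, (u :: U); split=> //=; rewrite h /=.
  move: pU => /= /andP[_ pU].
  by apply: sub_all (order_path_min leq_trans pU) => z /=; lia.
have [|M [c [N [E xb xC]]]] := IH u _ h; first by case/andP: pU.
by exists (m :: M), c, N; rewrite E.
Qed.

(* The reversed row is A b C M c N, where A b C is strictly decreasing, M c N is
   weakly increasing and starts at the middle letter; x replaces b, b replaces c and
   c is bumped. *)
Definition bumpable (x : nat) (A : seq nat) (b : nat) (C M : seq nat) (c : nat) (N : seq nat) :=
  [/\ sorted gtn (A ++ b :: rcons C (head c M)), x <= b & all (gtn x) C] /\
  [/\ sorted leq (M ++ c :: N), c < b & all (leq b) N].

Lemma bumpable_hookV x A b C M c N : bumpable x A b C M c N ->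
  exists U, M ++ c :: N = head c M :: U /\ hookV (A ++ b :: C) (head c M) U.
Proof.
move=> [[h1 h2 h3] [h4 h5 h6]]; exists (behead (M ++ c :: N)).
by rewrite /hookV rcons_cat rcons_cons h1 /=; case: M h4 {h1}.
Qed.

Lemma bumpable_bump x A b C M c N s : bumpable x A b C M c N ->
  bump (size A + size C) (size M + size N) (x :: A ++ b :: C ++ M ++ c :: N ++ s) =
  A ++ x :: C ++ M ++ b :: N ++ c :: s.
Proof.
move=> [[h1 h2 h3] [h4 h5 h6]]; rewrite /bump drag_knuth1E //; last first.
  move: h1; rewrite -rcons_cons -rcons_cat; move: (A ++ b :: C) => l.
  by case: l => //= y l; rewrite rcons_path => /andP[].
have sz : size (A ++ x :: C) = (size A + size C).+1 by rewrite size_cat /=; lia.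
rewrite /drag_at -cat_cons catA take_size_cat // drop_size_cat // drag_knuth2E //.
by rewrite -catA.
Qed.

(** The pattern fixes only the lengths q and r. The pieces inside are then found by comparison: b is
    the last letter of the decreasing run that is at least x, and c the last letter of the
    increasing run below b. *)
Lemma bump_des_bumpable q r w : bump_des q r w ->
  exists (x : nat) (A : seq nat) (b : nat) (C M : seq nat) (c : nat) (N s : seq nat), [/\ w = x :: A ++ b :: C ++ M ++ c :: N ++ s,
    bumpable x A b C M c N, size A + size C = q & size M + size N = r].
Proof.
rewrite /bump_des -descents_take => dw.
have sw : (q + r).+2 < size w.
  have : (q+r).+2 = size (descents w) - (size (descents w) - (q+r).+2).
    by move: dw => /(congr1 size); rewrite descents_take size_take /= size_cat /= !size_nseq; case: ltnP; lia.
  by rewrite size_descents; lia.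
case: w dw sw => //= x w dw sw.
have w0 : take (q + r).+2 w != [::] by case: w sw {dw}.
have [d1 dV] : (head 0 w < x) = false /\ descents (take (q + r).+2 w) = nseq q.+1 true ++ nseq r false.
  by case: w sw w0 dw => //= y w _ _ [-> ->].
have [D [m [U [EV sD sU /andP[pD pU]]]]] := descents_hookV w0 dV.
have [|||A [b [C [ED xb xC]]]] := @split_dec x D.
- by case: D pD {EV sD} => //= d D; rewrite rcons_path => /andP[].
- by case: D sD {EV pD}.
- case: D sD EV {pD} => // d D _; case: w sw {dw dV w0} d1 => //= y w _ h [<- _]; lia.
have mb : m < b.
  move: pD; rewrite ED rcons_cat /= => /cat_sorted2 [_ /=].
  by move=> h; have /allP := order_path_min (fun _ _ _ p1 p2 => ltn_trans p2 p1) h => /(_ m); rewrite mem_rcons inE eqxx; apply.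
have [M [c [N [EU cb bN]]]] := split_inc pU mb.
have Em : m = head c M by case: M EU => [|? ?] [-> _].
exists x, A, b, C, M, c, N, (drop (q + r).+2 w); split.
- by rewrite -{1}(cat_take_drop (q+r).+2 w) EV EU ED -?catA /= -?catA /= -?catA.
- by split; split=> //; rewrite -?EU // -Em -rcons_cons -rcons_cat -ED.
- by move: sD; rewrite ED size_cat /=; lia.
- by have := congr1 size EU; rewrite size_cat /=; lia.
Qed.

Lemma bumpable_bump_des x A b C M c N s : bumpable x A b C M c N ->
  bump_des (size A + size C) (size M + size N) (x :: A ++ b :: C ++ M ++ c :: N ++ s).
Proof.
move=> ok; have [U [EU VVU]] := bumpable_hookV ok; move: ok => [[h1 h2 h3] [h4 h5 h6]].
have sU : size U = size M + size N by have := congr1 size EU; rewrite size_cat /=; lia.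
rewrite /bump_des -descents_take.
have -> : x :: A ++ b :: C ++ M ++ c :: N ++ s = (x :: (A ++ b :: C) ++ M ++ c :: N) ++ s.
  by rewrite /= -?catA /= -?catA /= -?catA.
rewrite take_size_cat; last by rewrite /= !size_cat /= ?size_cat /=; lia.
have := hookV_descents VVU; rewrite -EU size_cat /= addnS sU => dV.
have : x <= head 0 ((A ++ b :: C) ++ M ++ c :: N).
  case: A h1 {VVU dV} => //= a A /= h1.
  have /allP := order_path_min (fun _ _ _ p1 p2 => ltn_trans p2 p1) h1 => /(_ b).
  by rewrite mem_cat inE eqxx orbT => /(_ isT) /=; lia.
move: dV; case: ((A ++ b :: C) ++ _) => [|y s'] //= -> h.
by rewrite ltnNge h.
Qed.

(** The first drag consumes the decreasing run. After it b stands before the weakly increasing piece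
    and exceeds its head, which is the pattern [run2] required by the second drag. *)
Lemma bump_comm q r i w : bump_des q r w ->
  phi i (bump q r w) = phi i w /\ en i (bump q r w) = omap (bump q r) (en i w).
Proof.
have key u : bump_des q r u -> run1 q u /\ (q.+1 <= size (drag knuth1 q u)) /\ run2 r (drop q.+1 (drag knuth1 q u)).
  move=> du; have [x [A [b [C [M [c [N [s [E ok sq sr]]]]]]]]] := bump_des_bumpable du.
  have [[h1 h2 h3] [h4 h5 h6]] := ok; split.
    move: du; rewrite /bump_des /run1 => /(congr1 (take q.+1)); rewrite take_takel; last lia.
    have E1 : nseq q.+1 true = nseq q true ++ [:: true] by rewrite (_ : [:: true] = nseq 1 true) // -nseqD addn1.
    by rewrite E1 -catA => -> /=; rewrite take_size_cat ?size_nseq.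
  rewrite E -sq -sr drag_knuth1E //; last first.
    move: h1; rewrite -rcons_cons -rcons_cat; move: (A ++ b :: C) => l.
    by case: l => //= y l; rewrite rcons_path => /andP[].
  have sz : size (A ++ x :: C) = (size A + size C).+1 by rewrite size_cat /=; lia.
  rewrite -cat_cons catA drop_size_cat // /run2.
  split; first by rewrite size_cat sz leq_addr.
  rewrite -descents_take.
  have -> : b :: M ++ c :: N ++ s = (b :: M ++ c :: N) ++ s by rewrite /= -catA.
  rewrite take_size_cat; last by rewrite /= size_cat /=; lia.
  have Mb : head c M < b.
    by clear -h4 h5; case: M h4 => //= m M h; have /allP := order_path_min leq_trans h => /(_ c); rewrite mem_cat inE eqxx orbT => /(_ isT) /=; lia.
  move: h4; rewrite sorted_leq_descents size_cat /= addnS /= => /eqP <-.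
  by clear -Mb; case: M Mb => //= [|m M] ->.
move=> d; have [d1 [sz d2]] := key _ d; have [p1 e1] := drag_knuth1_comm i d1.
have [p2 e2] := drag_at_comm sz (drag_knuth2_comm i d2).
rewrite /bump p2 p1 e2 e1; split=> //.
by case: (en i w).
Qed.

Lemma bump_des_en q r i w v : en i w = Some v -> bump_des q r w -> bump_des q r v.
Proof. by move=> e; rewrite /bump_des (en_descents e). Qed.

(** * Operators on primed words *)

Definition e_word i (w : word) : option word :=
  omap (fun v => zip v (unzip2 w)) (en i (unzip1 w)).
Definition f_word i (w : word) : option word :=
  omap (fun v => zip v (unzip2 w)) (fn i (unzip1 w)).

Fixpoint first1 (w : word) : option bool :=
  if w is x :: v then if x.1 == 1 then Some x.2 else first1 v else None.

Fixpoint set1 (b : bool) (w : word) : word :=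
  if w is x :: v then if x.1 == 1 then (1, b) :: v else x :: set1 b v else [::].

(** If a 1 follows, replacing w_j by w_k and w_k by w_j - 1 leaves a 1 in both places with the prime
    bits swapped. If none follows, [odflt] keeps the bit of x and [set1] is the identity, so one
    formula covers both clauses. *)
Fixpoint e_bar (w : word) : option word :=
  if w is x :: v then
    if x.1 == 2 then Some ((1, odflt x.2 (first1 v)) :: set1 x.2 v)
    else if x.1 == 1 then None else omap (cons x) (e_bar v)
  else None.

Fixpoint f_bar (w : word) : option word :=
  if w is x :: v then
    if x.1 == 1 then Some ((2, odflt x.2 (first1 v)) :: set1 x.2 v)
    else if x.1 == 2 then None else omap (cons x) (f_bar v)
  else None.

Definition e0 w := if first1 w is Some true then Some (set1 false w) else None.
Definition f0 w := if first1 w is Some false then Some (set1 true w) else None.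

Definition op_e (i : crystal_index) (w : word) : option word :=
  match i with Bar1 => e_bar w | Idx 0 => e0 w | Idx k => e_word k w end.
Definition op_f (i : crystal_index) (w : word) : option word :=
  match i with Bar1 => f_bar w | Idx 0 => f0 w | Idx k => f_word k w end.

Lemma e_word_cons i x v : e_word i (x :: v) =
  if (x.1 == i.+1) && (phi i (unzip1 v) == 0) then Some ((i, x.2) :: v)
  else omap (cons x) (e_word i v).
Proof.
rewrite /e_word /=; case: ifP => _ /=; first by rewrite zip_unzip.
by case: (en i _) => //= u; case: x.
Qed.

Lemma f_word_cons i x v : f_word i (x :: v) =
  if (x.1 == i.+1) < phi i (unzip1 v) then omap (cons x) (f_word i v)
  else if x.1 == i then Some ((i.+1, x.2) :: v) else None.
Proof.
rewrite /f_word /=; case: ifP => _ /=; first by case: (fn i _) => //= u; case: x.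
by case: ifP => _ //=; rewrite zip_unzip.
Qed.

(** * Agreement with the scanning definitions of the operators *)

Fixpoint low_pos i (w : word) k : seq nat :=
  if w is x :: v then
    if x.1 == i.+1 then behead (low_pos i v k.+1)
    else if x.1 == i then k :: low_pos i v k.+1 else low_pos i v k.+1
  else [::].

Fixpoint high_pos i (w : word) k : seq nat :=
  if w is x :: v then
    if (x.1 == i.+1) && nilp (low_pos i v k.+1) then k :: high_pos i v k.+1
    else high_pos i v k.+1
  else [::].

(** The invariant for arbitrary accumulators: the pending openings in [op], most recent first, are
    matched with the first unpaired closings of w, so the shorter of the two lists is used up. *)
Lemma unpaired_scanE i w k cl op : unpaired_scan i w k cl op =
  (rev cl ++ drop (size op) (low_pos i w k),
   rev (drop (size (low_pos i w k)) op) ++ high_pos i w k).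
Proof.
elim: w k cl op => /= [|x w IH] k cl op; first by rewrite drop0 !cats0.
case: (x.1 =P i.+1) => [e|ne] /=.
  rewrite IH size_behead /=; congr pair; first by case: (low_pos i w k.+1).
  by case: (low_pos i w k.+1) => [|y l] //=; rewrite drop0 rev_cons cat_rcons.
case: (x.1 =P i) => [e|ne'] //=; case: op => [|o op]; rewrite !IH /= ?drop0 //.
by rewrite rev_cons cat_rcons.
Qed.

Lemma size_low_pos i w k : size (low_pos i w k) = phi i (unzip1 w).
Proof. by elim: w k => //= x w IH k; case: ifP => _; [rewrite size_behead IH | case: ifP => _ /=; rewrite IH]. Qed.

Lemma lowsS i w k : low_pos i w k.+1 = map succn (low_pos i w k).
Proof. by elim: w k => //= x w IH k; case: ifP => _; [rewrite IH; case: low_pos | case: ifP => _ /=; rewrite IH]. Qed.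

Lemma highsS i w k : high_pos i w k.+1 = map succn (high_pos i w k).
Proof. by elim: w k => //= x w IH k; rewrite lowsS IH; case: (low_pos _ _ _); case: (x.1 == _). Qed.

Lemma e_posE i w : e_pos i w = e_word i w.
Proof.
rewrite /e_pos /unpaired_high unpaired_scanE /=.
elim: w => //= x w IH; rewrite e_word_cons -(size_low_pos i w 1); case: (x.1 =P i.+1) => [e|ne] /=.
  case El: (low_pos i w 1) => [|y l] /=; first by rewrite /set_letter /pred_letter /= e.
  by rewrite -IH highsS; case: (high_pos i w 0).
by rewrite -IH highsS; case: (high_pos i w 0).
Qed.

Lemma f_posE i w : f_pos i w = f_word i w.
Proof.
rewrite /f_pos /unpaired_low unpaired_scanE /= drop0.
elim: w => //= x w IH; rewrite f_word_cons -(size_low_pos i w 0).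
case: (x.1 =P i.+1) => [e|ne] /=.
  rewrite lowsS -IH; case: (low_pos i w 0) => [|y [|z l]] //=.
  - by rewrite e eqSn.
  - by rewrite e eqSn.
  - by rewrite (last_map succn).
case: (x.1 =P i) => [e'|ne'] /=; rewrite lowsS -IH.
  case: (low_pos i w 0) => [|y l] /=; first by rewrite /set_letter /succ_letter /= e'.
  by rewrite (last_map succn).
by case: (low_pos i w 0) => [|y l] //=; rewrite (last_map succn).
Qed.

Lemma e_zeroE w : e_zero w = e0 w.
Proof.
rewrite /e_zero /e0; elim: w => //= -[a b] w IH /=.
case: (a =P 1) => [->|na]; first by case: b; rewrite !xpair_eqE /= ?orbT.
have n1 c : ((a, b) == (1, c)) = false by apply/eqP => -[].
rewrite !n1 eqSS ltnS; case: ifP IH => _.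
  by case: (first1 w) => [[]|].
by case: (first1 w) => [[]|] // [<-].
Qed.

Lemma f_zeroE w : f_zero w = f0 w.
Proof.
rewrite /f_zero /f0; elim: w => //= -[a b] w IH /=.
case: (a =P 1) => [->|na]; first by case: b; rewrite !xpair_eqE /= ?orbT.
have n1 c : ((a, b) == (1, c)) = false by apply/eqP => -[].
rewrite !n1 eqSS ltnS; case: ifP IH => _.
  by case: (first1 w) => [[]|].
by case: (first1 w) => [[]|] // [<-].
Qed.

Lemma find1_spec w (k := find (fun x : letter => x.1 == 1) w) :
  if k == size w then first1 w = None /\ (forall b, set1 b w = w)
  else [/\ first1 w = Some (letter_at w k).2, (letter_at w k).1 = 1
     & forall b, set1 b w = set_letter w k (1, b)].
Proof.
rewrite {}/k; elim: w => //= x w IH; case: (x.1 =P 1) => [e|ne] //=.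
rewrite eqSS; case: eqP IH => _ /= [h1 h2]; first by split=> // b; rewrite h2.
by move=> h3; split=> // b; rewrite h3.
Qed.

Lemma e_bar1E w : e_bar1 w = e_bar w.
Proof.
rewrite /e_bar1; elim: w => //= x w IH.
case: (x.1 =P 2) => [e|ne] /=; last first.
  case: (x.1 =P 1) => [e|ne'] /=; first by rewrite orbT.
  rewrite -IH !eqSS ltnS; case: ifP => _ //.
  by case: ifP.
rewrite e /= eqSS; have /= := find1_spec w; case: eqP => _ /=.
  by move=> [-> h2]; rewrite /= h2 /set_letter /pred_letter /= e.
move=> [h1 h2 h3]; rewrite h1 /= h3 /set_letter /= /letter_at /= /pred_letter e.
by move: h2; rewrite /letter_at; case: (nth _ _ _) => ? ? /= ->.
Qed.

Lemma f_bar1E w : f_bar1 w = f_bar w.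
Proof.
rewrite /f_bar1; elim: w => //= x w IH.
case: (x.1 =P 1) => [e|ne] /=; last first.
  case: (x.1 =P 2) => [e|ne'] /=; first by rewrite orbT.
  rewrite -IH !eqSS; case: ifP => _ //.
  by rewrite addSn ltnS; case: ifP.
rewrite drop0 add1n ltnS; have /= := find1_spec w.
have := find_size (fun x : letter => x.1 == 1) w.
case: eqP => [->|ne] /= _.
  by move=> [-> h2]; rewrite leqnn /= h2 /set_letter /succ_letter /= e.
move=> [h1 h2 h3]; rewrite ifF; last first.
  by have := find_size (fun x : letter => x.1 == 1) w; lia.
rewrite h1 /= h3 /set_letter /= /letter_at /= /succ_letter.
have -> : x = (1, x.2) by move: e; case: x => a b /= ->.
by move: h2; rewrite /letter_at; case: (nth _ _ _) => ? ? /= ->.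
Qed.

Lemma word_eE i w : word_e i w = op_e i w.
Proof. by case: i => [|[|i]] /=; rewrite ?e_bar1E ?e_zeroE ?e_posE. Qed.

Lemma word_fE i w : word_f i w = op_f i w.
Proof. by case: i => [|[|i]] /=; rewrite ?f_bar1E ?f_zeroE ?f_posE. Qed.

Fixpoint first12 (w : word) : nat :=
  if w is x :: v then
    if x.1 == 2 then 2 else if x.1 == 1 then 1 else first12 v
  else 0.

Lemma e_bar_none w : (e_bar w == None) = (first12 w != 2).
Proof. by elim: w => //= x w IH; case: ifP => // _; case: ifP => // _; rewrite -IH; case: (e_bar w). Qed.

Lemma f_bar_none w : (f_bar w == None) = (first12 w != 1).
Proof.
elim: w => //= x w IH; case: ifP => [/eqP -> //|_]; case: ifP => // _.
by rewrite -IH; case: (f_bar w).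
Qed.

Lemma set1_id b w : first1 w = Some b -> set1 b w = w.
Proof. by elim: w => //= -[x c] w IH /=; case: eqP => [-> [->] //|_ /IH ->]. Qed.

Lemma set1_none b w : first1 w = None -> set1 b w = w.
Proof. by elim: w => //= x w IH /=; case: eqP => // _ /IH ->. Qed.

Lemma set1_set1 b c w : set1 b (set1 c w) = set1 b w.
Proof. by elim: w => //= x w IH; case: (x.1 =P 1) => //= h; case: eqP => // _; rewrite IH. Qed.

Lemma first1_set1 b w : first1 (set1 b w) = if first1 w is Some _ then Some b else None.
Proof. by elim: w => //= x w IH; case: (x.1 =P 1) => //= h; case: eqP. Qed.

Lemma set1_unzip1 b w : unzip1 (set1 b w) = unzip1 w.
Proof. by elim: w => //= x w IH; case: eqP => [->|_] //=; rewrite IH. Qed.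

Lemma set1_size b w : size (set1 b w) = size w.
Proof. by have := congr1 size (set1_unzip1 b w); rewrite !size_map. Qed.

Lemma e_bar_f_bar y z : e_bar y = Some z <-> f_bar z = Some y.
Proof.
split.
  elim: y z => //= -[x a] y IH z /=; case: (x =P 2) => [->|n2] /=.
    move=> [<-] /=; rewrite first1_set1 set1_set1.
    by case E: (first1 y) => [c|] /=; rewrite ?(set1_id E) ?(set1_none _ E).
  case: (x =P 1) => // n1; case E: (e_bar y) => [u|] //= [<-] /=.
  by rewrite (introF eqP n1) (introF eqP n2) (IH _ E).
elim: z y => //= -[x a] z IH y /=; case: (x =P 1) => [->|n1] /=.
  move=> [<-] /=; rewrite first1_set1 set1_set1.
  by case E: (first1 z) => [c|] /=; rewrite ?(set1_id E) ?(set1_none _ E).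
case: (x =P 2) => // n2; case E: (f_bar z) => [u|] //= [<-] /=.
by rewrite (introF eqP n1) (introF eqP n2) (IH _ E).
Qed.

Lemma e_word_f_word i y z : e_word i y = Some z <-> f_word i z = Some y.
Proof.
have szn (u : seq nat) v : en i u = Some v -> size u = size v by move/en_size.
rewrite /e_word /f_word; split.
  case e: (en i _) => [v|] //= [<-]; have := szn _ _ e; rewrite size_map => sv.
  by rewrite unzip1_zip ?unzip2_zip ?size_map ?sv // (en_fn e) /= zip_unzip.
case e: (fn i _) => [v|] //= [<-]; have e' := fn_en e; have := szn _ _ e'; rewrite size_map => sv.
by rewrite unzip1_zip ?unzip2_zip ?size_map ?sv // e' /= zip_unzip.
Qed.

Lemma op_ef i y z : op_e i y = Some z <-> op_f i z = Some y.
Proof.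
case: i => [|[|i]]; [exact: e_bar_f_bar| |exact: e_word_f_word].
rewrite /= /e0 /f0; split.
  by case e: (first1 y) => [[]|] // [<-]; rewrite first1_set1 e set1_set1 set1_id.
by case e: (first1 z) => [[]|] // [<-]; rewrite first1_set1 e set1_set1 set1_id.
Qed.

Lemma e_word_unzip i y z : e_word i y = Some z ->
  en i (unzip1 y) = Some (unzip1 z) /\ unzip2 z = unzip2 y.
Proof.
rewrite /e_word; case e: (en i _) => [v|] //= [<-].
by rewrite unzip1_zip ?unzip2_zip // (en_size e) !size_map.
Qed.

Lemma e_word_intro i y z : en i (unzip1 y) = Some (unzip1 z) -> unzip2 z = unzip2 y ->
  e_word i y = Some z.
Proof. by move=> e1 e2; rewrite /e_word e1 /= -e2 zip_unzip. Qed.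

Definition option_rel (R : word -> word -> Prop) o o' :=
  match o, o' with
  | Some y, Some y' => R y y'
  | None, None => True
  | _, _ => False
  end.

(** * Bisimulations *)

(* Bisimulation for the crystal operators, strong enough to be stable under
   prepending a letter; first1 and set1 account for the primes that e_bar1 and
   f_bar1 exchange across that letter. *)
Definition sim (R : word -> word -> Prop) := forall y y', R y y' ->
  [/\ first1 y' = first1 y, first12 y' = first12 y,
      forall i, phi i (unzip1 y') = phi i (unzip1 y)
    & forall b, R (set1 b y) (set1 b y')] /\
  forall i, option_rel R (op_e i y) (op_e i y') /\ option_rel R (op_f i y) (op_f i y').

Definition cons_rel (R : word -> word -> Prop) y y' :=
  exists x v v', [/\ y = x :: v, y' = x :: v' & R v v'].

Definition comp_rel (R S : word -> word -> Prop) y y' := exists2 z, R y z & S z y'.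

Lemma sim_cons_rel R : sim R -> sim (cons_rel R).
Proof.
move=> sR _ _ [x [v [v' [-> -> r]]]]; have [[h1 h2 h3 h4] h5] := sR _ _ r.
have c w w' : R w w' -> forall x, cons_rel R (x :: w) (x :: w') by move=> rr y; exists y, w, w'.
have oc o o' y : option_rel R o o' -> option_rel (cons_rel R) (omap (cons y) o) (omap (cons y) o').
  by case: o o' => [w|] [w'|] //= rr; apply: c.
split; first split=> /=; rewrite ?h1 ?h2 //.
- by move=> i; rewrite h3.
- by move=> b; case: ifP => _; [apply: c | apply: c].
case=> [|[|i]] /=.
- have [he hf] := h5 Bar1; rewrite h1; split; case: ifP => _ //=; rewrite ?h1; try (by apply: c);
   by case: ifP => _ //; apply: oc.
- rewrite /e0 /f0 /= h1; have [] := h5 (Idx 0); rewrite /= /e0 /f0 h1.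
  by case: (x.1 =P 1) => _ /=; [case: x => ? []; split => //; apply: c
    | case: (first1 v) => [[]|] //; split => //; apply: c].
- have [he hf] := h5 (Idx i.+1); rewrite !e_word_cons !f_word_cons !h3; split.
    by case: ifP => _; [apply: c | apply: oc].
  by case: ifP => _; [apply: oc | case: ifP => _ //; apply: c].
Qed.

Lemma sim_comp_rel R S : sim R -> sim S -> sim (comp_rel R S).
Proof.
move=> sR sS y y' [z r s]; have [[h1 h2 h3 h4] h5] := sR _ _ r.
have [[k1 k2 k3 k4] k5] := sS _ _ s.
split; first split; rewrite ?k1 ?k2 //.
- by move=> i; rewrite k3.
- by move=> b; exists (set1 b z).
have oc o o' o'' : option_rel R o o' -> option_rel S o' o'' -> option_rel (comp_rel R S) o o''.
  by case: o o' o'' => [w|] [w'|] [w''|] //= rr ss; exists w'.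
by move=> i; have [a b] := h5 i; have [c d] := k5 i; split; apply: oc; eassumption.
Qed.

Definition skip_rel k R := iter k cons_rel R.

Lemma sim_skip_rel k R : sim R -> sim (skip_rel k R).
Proof. by move=> s; elim: k => //= k; apply: sim_cons_rel. Qed.

Lemma skip_relP k R y y' : skip_rel k R y y' <->
  exists p v v', [/\ size p = k, y = p ++ v, y' = p ++ v' & R v v'].
Proof.
elim: k y y' => [|k IH] y y' /=; split.
- by move=> r; exists [::], y, y'.
- by move=> [p [v [v' [/size0nil -> -> ->]]]].
- move=> [x [v [v' [-> -> /IH [p [u [u' [s -> -> r]]]]]]]].
  by exists (x :: p), u, u'; rewrite /= s.
move=> [[|x p] [v [v' [s -> -> r]]]] //; case: s => s.
by exists x, (p ++ v), (p ++ v'); split=> //; apply/IH; exists p, v, v'.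
Qed.

(* Commutation with the f operators follows from that with the e operators,
   their inverses, once the relation is functional on a domain closed under f. *)
Lemma simI (L : Type) (row_rel : L -> word -> word -> Prop) (row_dom : word -> Prop) :
  (forall l y y', row_rel l y y' -> row_dom y) ->
  (forall y, row_dom y -> exists l y', row_rel l y y') ->
  (forall l y y' l2 y2', row_rel l y y' -> row_rel l2 y y2' -> l = l2 /\ y' = y2') ->
  (forall i y z, row_dom y -> op_f i y = Some z -> row_dom z) ->
  (forall l y y', row_rel l y y' -> [/\ first1 y' = first1 y, first12 y' = first12 y
     & forall b, row_rel l (set1 b y) (set1 b y')]) ->
  (forall l y y' z, row_rel l y y' -> e_bar y = Some z ->
     exists2 z', e_bar y' = Some z' & row_rel l z z') ->
  (forall l y y' i, row_rel l y y' -> phi i (unzip1 y') = phi i (unzip1 y) /\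
     option_rel (row_rel l) (e_word i.+1 y) (e_word i.+1 y')) ->
  forall l, sim (row_rel l).
Proof.
move=> H1 H2 H3 H4 H5 H6 H7 l y y' r; have [a1 a2 a3] := H5 _ _ _ r.
split; first by split=> // i; case: (H7 _ _ _ i r).
have He i : option_rel (row_rel l) (op_e i y) (op_e i y').
  case: i => [|[|i]].
  - rewrite /=; case e: (e_bar y) => [z|].
      by have [z' -> rz] := H6 _ _ _ _ r e.
    by move/eqP: e; rewrite e_bar_none -a2 -e_bar_none => /eqP ->.
  - by rewrite /= /e0 a1; case: (first1 y) => [[]|] //=; apply: a3.
  - by case: (H7 _ _ _ i r).
move=> i; split; first exact: He.
case e: (op_f i y) => [z|]; last first.
  case: i e => [|[|i]] /=.
  - by move/eqP; rewrite f_bar_none -a2 -f_bar_none => /eqP ->.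
  - by rewrite /f0 a1; case: (first1 y) => [[]|].
  - rewrite /f_word; case e: (fn _ _) => [//|] _; move/eqP: e; rewrite fn_none.
    by have [<- _] := H7 _ _ _ i.+1 r; rewrite -fn_none => /eqP ->.
have [l2 [z' rz]] := H2 _ (H4 _ _ _ (H1 _ _ _ r) e).
suff : option_rel (row_rel l2) (op_e i z) (op_e i z').
  move/op_ef: (e) => ->; case e2: (op_e i z') => [y2'|] //= r2.
  have [El Ey] := H3 _ _ _ _ _ r r2; subst l2 y2'.
  by move/op_ef: e2 => ->.
case: i e => [|[|i]] e.
- move/op_ef: e => /= e; have [u e2 ru] := H6 _ _ _ _ rz e.
  by rewrite e e2.
- by have [b1 b2 b3] := H5 _ _ _ rz; rewrite /= /e0 b1; case: (first1 z) => [[]|] //=; apply: b3.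
- by case: (H7 _ _ _ i rz).
Qed.

Lemma first1_cat a b : first1 (a ++ b) = if first1 a is Some c then Some c else first1 b.
Proof. by elim: a => //= x a ->; case: ifP. Qed.

Lemma set1_cat t a b :
  set1 t (a ++ b) = if first1 a is Some _ then set1 t a ++ b else a ++ set1 t b.
Proof. by elim: a => //= x a ->; case: ifP => // _; case: (first1 a). Qed.

Lemma first12_cat a b : first12 (a ++ b) = if first12 a == 0 then first12 b else first12 a.
Proof. by elim: a => //= x a ->; case: ifP => // _; case: ifP. Qed.

Lemma e_bar_cat a b : first12 a = 0 -> e_bar (a ++ b) = omap (cat a) (e_bar b).
Proof.
elim: a => /= [|x a IH]; first by case: (e_bar b).
by case: ifP => // _; case: ifP => // _ h; rewrite IH //; case: (e_bar b).
Qed.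

Lemma f_bar_cat a b : first12 a = 0 -> f_bar (a ++ b) = omap (cat a) (f_bar b).
Proof.
elim: a => /= [|x a IH]; first by case: (f_bar b).
by case: ifP => // _; case: ifP => // _ h; rewrite IH //; case: (f_bar b).
Qed.

(** The 2 to be lowered lies in a, but its partner 1 may lie in b; then b changes only in the bit of
    its first 1. *)
Lemma e_bar_cat2 a b : first12 a = 2 -> exists a' t,
  size a' = size a /\ (e_bar (a ++ b) = Some (a' ++ b) \/ e_bar (a ++ b) = Some (a' ++ set1 t b)).
Proof.
elim: a => //= x a IH; case: ifP => [_ _|_].
  rewrite first1_cat set1_cat; case: (first1 a) => [c|].
    by exists ((1, c) :: set1 x.2 a), true; rewrite /= set1_size; split=> //; left.
  by exists ((1, odflt x.2 (first1 b)) :: a), x.2; split=> //; right.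
case: ifP => // _ /IH [a' [t [s h]]]; exists (x :: a'), t; split; first by rewrite /= s.
by case: h => ->; [left | right].
Qed.

Lemma f_bar_cat2 a b : first12 a = 1 -> exists a' t,
  size a' = size a /\ (f_bar (a ++ b) = Some (a' ++ b) \/ f_bar (a ++ b) = Some (a' ++ set1 t b)).
Proof.
elim: a => //= x a IH; case: (x.1 =P 2) => // n2; case: ifP => [_ _|_].
  rewrite first1_cat set1_cat; case: (first1 a) => [c|].
    by exists ((2, c) :: set1 x.2 a), true; rewrite /= set1_size; split=> //; left.
  by exists ((2, odflt x.2 (first1 b)) :: a), x.2; split=> //; right.
move=> /IH [a' [t [s h]]]; exists (x :: a'), t; split; first by rewrite /= s.
by case: h => ->; [left | right].
Qed.

Lemma first12_le a : first12 a <= 2.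
Proof. by elim: a => //= x a IH; case: ifP => // _; case: ifP. Qed.

(** * Rows of primed decomposition tableaux *)

Definition noprime (s : seq nat) : word := [seq (a, false) | a <- s].

Lemma noprime_cat s t : noprime (s ++ t) = noprime s ++ noprime t. Proof. exact: map_cat. Qed.
Lemma size_noprime s : size (noprime s) = size s. Proof. exact: size_map. Qed.
Lemma unzip1_noprime s : unzip1 (noprime s) = s.
Proof. by rewrite /unzip1 -map_comp map_id. Qed.
Lemma unzip2_noprime s : unzip2 (noprime s) = nseq (size s) false.
Proof. by rewrite /unzip2 -map_comp; elim: s => //= ? ? ->. Qed.

Lemma unzip1_cat (a b : word) : unzip1 (a ++ b) = unzip1 a ++ unzip1 b.
Proof. exact: map_cat. Qed.
Lemma unzip2_cat (a b : word) : unzip2 (a ++ b) = unzip2 a ++ unzip2 b.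
Proof. exact: map_cat. Qed.

Lemma word_ext (a b : word) : unzip1 a = unzip1 b -> unzip2 a = unzip2 b -> a = b.
Proof. by move=> e1 e2; rewrite -(zip_unzip a) -(zip_unzip b) e1 e2. Qed.

Lemma first1_noprime s : all (leq 2) s -> first1 (noprime s) = None.
Proof. by elim: s => //= x s IH /andP[h1 /IH ->]; case: eqP h1 => // ->. Qed.

Lemma first12_noprime s : all (leq 3) s -> first12 (noprime s) = 0.
Proof. by elim: s => //= x s IH /andP[h1 /IH ->]; move: h1; case: eqP => [->|] //; case: eqP => [->|]. Qed.

Definition hookw D (m : nat) U (mu : bool) : word := noprime D ++ (m, mu) :: noprime U.

(** Descents and prime bits alone characterize a reversed primed hook row. Operators of positive
    index keep both. *)
Definition is_hookw (v : word) := exists p r mu,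
  descents (unzip1 v) = nseq p true ++ nseq r false /\
  unzip2 v = nseq p false ++ mu :: nseq r false.

Lemma hookwP v : is_hookw v -> exists D m U mu, v = hookw D m U mu /\ hookV D m U.
Proof.
move=> [p [r [mu [h1 h2]]]].
have v0 : unzip1 v != [::] by move: h2; case: v {h1} => //; case: p.
have [D [m [U [E sD sU ok]]]] := descents_hookV v0 h1.
exists D, m, U, mu; split=> //; apply: word_ext.
  by rewrite /hookw unzip1_cat /= !unzip1_noprime E.
by rewrite /hookw unzip2_cat /= !unzip2_noprime sD sU h2.
Qed.

Lemma hookw_ok D m U mu : hookV D m U -> is_hookw (hookw D m U mu).
Proof.
move=> ok; exists (size D), (size U), mu.
by rewrite /hookw unzip1_cat unzip2_cat /= !unzip1_noprime !unzip2_noprime hookV_descents.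
Qed.

Lemma hookV_D D m U : hookV D m U -> all (ltn m) D.
Proof.
rewrite /hookV => /andP[h _]; elim: D h => //= x [|y D] IH /=; first by rewrite !andbT.
move=> /andP[yx h]; have := IH h; rewrite /= => /andP[my aD].
by rewrite my aD andbT (ltn_trans my yx).
Qed.

Lemma hookV_U D m U : hookV D m U -> all (leq m) U.
Proof. by move=> /andP[_ h]; exact: order_path_min leq_trans h. Qed.

Lemma gtn_trans : transitive gtn.
Proof. by move=> y x z /= h1 h2; apply: ltn_trans h2 h1. Qed.

Lemma sorted_gtn_rcons D m : sorted gtn (rcons D m) = all (ltn m) D && sorted gtn D.
Proof. by rewrite !(sorted_pairwise gtn_trans) pairwise_rcons. Qed.

Lemma hookVE D m U : hookV D m U = [&& all (ltn m) D, sorted gtn D & path leq m U].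
Proof. by rewrite /hookV sorted_gtn_rcons andbA. Qed.

Lemma hookV_down m' D m U : m' <= m -> hookV D m U -> hookV D m' U.
Proof.
rewrite !hookVE => h /and3P[h1 -> h3]; rewrite (sub_all _ h1) => [|z /=]; last lia.
by case: U h3 => //= u U /andP[h3 ->]; rewrite (leq_trans h h3).
Qed.

Definition posw (w : word) := all (fun x : letter => 0 < x.1) w.

Lemma set1_pos b w : posw (set1 b w) = posw w.
Proof. by elim: w => //= x w IH; case: eqP => [->|_] //=; rewrite IH. Qed.

(** Letters of D exceed m and those of U are at least m, so the first 1 of the row, if any, is its
    middle letter, the only place where a prime is allowed. *)
Lemma is_hookw_set1 b v : posw v -> is_hookw v -> is_hookw (set1 b v).
Proof.
move=> pv /hookwP [D [m [U [mu [E ok]]]]]; subst v; move: pv; rewrite /hookw /posw all_cat /= => /and3P[_ m0 _].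
have run2 : all (leq 2) D by apply: sub_all (hookV_D ok) => z /=; lia.
rewrite set1_cat first1_noprime //=; case: eqP => [E|n1]; first by rewrite -E; apply: hookw_ok.
have U2 : all (leq 2) U by apply: sub_all (hookV_U ok) => z /=; lia.
by rewrite set1_none ?first1_noprime //; apply: hookw_ok.
Qed.

Lemma le2_le3 D m : all (ltn m) D -> 1 <= m -> all (leq 2) D.
Proof. by move=> h h'; apply: sub_all h => z /=; lia. Qed.

Lemma e_bar_noprime s b : all (leq 3) s -> e_bar (noprime s ++ b) = omap (cat (noprime s)) (e_bar b).
Proof. by move=> h; rewrite e_bar_cat // first12_noprime. Qed.

Lemma f_bar_noprime s b : all (leq 3) s -> f_bar (noprime s ++ b) = omap (cat (noprime s)) (f_bar b).
Proof. by move=> h; rewrite f_bar_cat // first12_noprime. Qed.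

Lemma first1_plc s b : all (leq 2) s -> first1 (noprime s ++ b) = first1 b.
Proof. by move=> h; rewrite first1_cat first1_noprime. Qed.

Lemma set1_plc t s b : all (leq 2) s -> set1 t (noprime s ++ b) = noprime s ++ set1 t b.
Proof. by move=> h; rewrite set1_cat first1_noprime. Qed.

Lemma first12_plc s b : all (leq 3) s -> first12 (noprime s ++ b) = first12 b.
Proof. by move=> h; rewrite first12_cat first12_noprime. Qed.

Lemma dec_last2 D : sorted gtn D -> all (leq 2) D ->
  all (leq 3) D \/ exists D', [/\ D = rcons D' 2, all (leq 3) D' & sorted gtn D'].
Proof.
case/lastP: D => [|D x]; first by left.
rewrite sorted_gtn_rcons all_rcons => /andP[h1 h2] /andP[h3 h4].
have [x2|n2] := eqVneq x 2; last first.
  by left; rewrite all_rcons (sub_all _ h1) => [|z /=]; lia.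
right; exists D; rewrite -x2; split=> //; apply: sub_all h1 => z /=; lia.
Qed.

Lemma is_hookw_e_bar v c z : posw v -> is_hookw v -> e_bar (v ++ c) = Some z ->
  exists v' c', [/\ z = v' ++ c', size v' = size v & is_hookw v'].
Proof.
move=> pv /hookwP [D [m [U [mu [E ok]]]]]; subst v; move: pv; rewrite /hookw /posw all_cat /= => /and3P[_ m0 _].
have := ok; rewrite hookVE => /and3P[aD sD pU].
have aU := hookV_U ok; have run2 := le2_le3 aD m0.
rewrite -catA /=.
case: (dec_last2 sD run2) => [D3|[D' [ED D3 sD']]].
  rewrite e_bar_noprime //=; case: (m =P 2) => [E|n2].
    move=> [<-]; eexists (noprime D ++ (1, _) :: noprime U), _; split.
    - rewrite set1_plc; last by apply: sub_all aU => t /=; lia.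
      by rewrite -catA.
    - by rewrite !size_cat.
    - by apply: hookw_ok; apply: hookV_down ok; lia.
  case: (m =P 1) => // n1; rewrite e_bar_noprime; last by apply: sub_all aU => t /=; lia.
  case: (e_bar c) => //= u [<-]; exists (hookw D m U mu), u; split=> //; last exact: hookw_ok.
  by rewrite /hookw -catA.
(* A final 2 in D forces m = 1. The 2 becomes a 1 with the bit of the old middle, which turns
   unprimed: in the reversed row the middle moves one place to the left and takes its bit along. *)
have m1 : m = 1 by move: aD; rewrite ED all_rcons => /andP[/=]; lia.
subst D m; rewrite /noprime map_rcons cat_rcons -/(noprime _) e_bar_noprime //= => -[<-].
exists (noprime D' ++ (1, mu) :: (1, false) :: noprime U), c; split; first by rewrite -catA.
  by rewrite /noprime ?map_rcons ?cat_rcons !size_cat /= ?size_rcons ?size_map /=; lia.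
have -> : (1, false) :: noprime U = noprime (1 :: U) by [].
apply: hookw_ok; rewrite hookVE sD' /= pU andbT; apply: sub_all D3 => t /=; lia.
Qed.

Lemma is_hookw_f_bar v c z : posw v -> is_hookw v -> f_bar (v ++ c) = Some z ->
  exists v' c', [/\ z = v' ++ c', size v' = size v & is_hookw v'].
Proof.
move=> pv /hookwP [D [m [U [mu [E ok]]]]]; subst v; move: pv; rewrite /hookw /posw all_cat /= => /and3P[_ m0 _].
have := ok; rewrite hookVE => /and3P[aD sD pU].
have aU := hookV_U ok; have run2 := le2_le3 aD m0.
rewrite -catA /=.
case: (dec_last2 sD run2) => [D3|[D' [ED D3 sD']]]; last first.
  by rewrite ED /noprime map_rcons cat_rcons -/(noprime _) f_bar_noprime.
rewrite f_bar_noprime //=; case: (m =P 1) => [E|n1]; last first.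
  case: (m =P 2) => // n2; rewrite f_bar_noprime; last by apply: sub_all aU => t /=; lia.
  case: (f_bar c) => //= u [<-]; exists (hookw D m U mu), u; split=> //; last exact: hookw_ok.
  by rewrite /hookw -catA.
move=> [<-]; subst m; case: U ok pU aU => [|u U] ok pU aU.
  eexists (hookw D 2 [::] _), _; split; first by rewrite /hookw -catA; reflexivity.
    by rewrite /hookw !size_cat.
  by apply: hookw_ok; rewrite hookVE sD /= andbT.
(* The inverse shift: the raised letter joins the decreasing part, and the next 1 becomes the middle
   and receives its bit. *)
have [u1|un1] := eqVneq u 1.
  subst u; exists (hookw (rcons D 2) 1 U mu), c; split.
  - by rewrite /hookw /noprime map_rcons cat_rcons -catA.
  - by rewrite /hookw /noprime map_rcons cat_rcons !size_cat.
  apply: hookw_ok; rewrite hookVE sorted_gtn_rcons sD all_rcons /= aD andbT.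
  by move: pU => /= ->; rewrite ?andbT.
have u2 : 1 < u by move: aU => /= /andP[]; lia.
have pU2 : path leq 2 (u :: U) by move: pU => /= /andP[_ ->]; rewrite u2.
eexists (hookw D 2 (u :: U) _), _; split.
- rewrite /hookw set1_plc ?first1_plc; first by rewrite -catA; reflexivity.
    by apply: order_path_min leq_trans pU2.
  by apply: order_path_min leq_trans pU2.
- by rewrite /hookw !size_cat.
by apply: hookw_ok; rewrite hookVE sD pU2 /= andbT.
Qed.

(** * Middle elements of reversed rows *)

Lemma hook_atE W q : q < size W ->
  hook_at (rev W) q = (descents W == nseq (size W - q.+1) true ++ nseq q false).
Proof.
move=> qW; rewrite /hook_at take_rev drop_rev !rev_sorted.
set p := size W - q.+1; have pq : size W - q = p.+1 by rewrite /p; lia.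
rewrite pq.
have pW : p < size W by rewrite /p; lia.
have e1 : sorted (fun x y => geq y x) (drop p W) = sorted leq (drop p W) by apply: eq_sorted.
have e2 : sorted (fun x y : nat => y < x) (take p.+1 W) = sorted gtn (take p.+1 W) by apply: eq_sorted.
rewrite e1 e2 sorted_leq_descents sorted_gtn_descents descents_take descents_drop size_take size_drop.
have -> : (if p.+1 < size W then p.+1 else size W).-1 = p by case: ltnP; lia.
have -> : (size W - p).-1 = q by rewrite /p; lia.
rewrite -{3}(cat_take_drop p (descents W)) eqseq_cat ?size_nseq; first exact: andbC.
by rewrite size_takel // size_descents; lia.
Qed.

Lemma nseq_tf_inj p q p' q' : nseq p true ++ nseq q false = nseq p' true ++ nseq q' false ->
  p = p' /\ q = q'.
Proof.
move=> h; have := congr1 (count id) h; have := congr1 size h.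
rewrite !size_cat !count_cat !size_nseq !count_nseq /=; lia.
Qed.

Lemma find_iota (P : pred nat) n q : q < n -> P q -> (forall j, j < q -> ~~ P j) ->
  find P (iota 0 n) = q.
Proof.
move=> qn Pq H; have -> : n = q + (n - q) by lia.
rewrite iotaD find_cat size_iota ifF; last first.
  by apply/negbTE/hasPn => j; rewrite mem_iota => /H.
by case: (n - q) (subn_gt0 q n) => [|k]; rewrite ?qn //= add0n Pq; lia.
Qed.

Lemma middle_rev D m U : hookV D m U -> middle (rev (D ++ m :: U)) = size U.
Proof.
move=> ok; have s : size (D ++ m :: U) = (size D + size U).+1 by rewrite size_cat /=; lia.
rewrite /middle size_rev s; apply: find_iota; first lia.
  rewrite hook_atE; last by rewrite s; lia.
  rewrite s hookV_descents //; apply/eqP; congr (nseq _ _ ++ _); lia.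
move=> j jU; rewrite hook_atE ?s ?hookV_descents //; last lia.
by apply/eqP => /nseq_tf_inj; lia.
Qed.

Lemma hook_wordP (W : seq nat) : reflect (exists p r, W != [::] /\ descents W = nseq p true ++ nseq r false)
  (hook_word (rev W)).
Proof.
apply: (iffP hasP) => [[q]|[p [r [W0 dW]]]].
  rewrite mem_iota size_rev add0n => /andP[_ qW]; rewrite hook_atE // => /eqP h.
  by exists (size W - q.+1), q; split=> //; case: W qW {h}.
have := size_descents W; rewrite dW size_cat !size_nseq => s.
exists r; first by rewrite mem_iota size_rev; case: W W0 s {dW} => //= ? ? _; lia.
have W1 : 0 < size W by case: W W0 {dW s}.
have sW : size W = (p + r).+1 by lia.
rewrite hook_atE; last lia.
rewrite dW sW; apply/eqP; congr (nseq _ _ ++ _); lia.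
Qed.

Lemma nth_hookw D m U mu k : nth letter0 (hookw D m U mu) k =
  (nth 0 (D ++ m :: U) k, mu && (k == size D)).
Proof.
rewrite /hookw !nth_cat size_noprime; case: ltnP => h.
  rewrite (nth_map 0) // (ltn_eqF h) andbF //.
case: (k - size D) (subnK h) => [|j] /= e; first by rewrite -e eqxx andbT.
have -> : (k == size D) = false by lia.
rewrite andbF; have [hj|hj] := ltnP j (size U); first by rewrite (nth_map 0).
by rewrite !nth_default ?size_noprime.
Qed.

Lemma size_hookw D m U mu : size (hookw D m U mu) = (size D + size U).+1.
Proof. by rewrite /hookw size_cat /= !size_noprime; lia. Qed.

Lemma prime_middle_rev D m U b : hookV D m U ->
  prime_middle (rev (D ++ m :: U)) b = rev (hookw D m U b).
Proof.
move=> ok; have s : size (D ++ m :: U) = (size D + size U).+1 by rewrite size_cat /=; lia.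
apply: (@eq_from_nth _ letter0); first by rewrite size_map size_iota !size_rev size_hookw s.
move=> k; rewrite size_map size_iota size_rev => hook_seq.
rewrite (nth_map 0) ?size_iota ?size_rev // nth_iota ?size_rev // add0n middle_rev //.
rewrite !nth_rev ?size_hookw ?nth_hookw ?s; try by rewrite s in hook_seq; lia.
by congr (_, _ && _); rewrite s in hook_seq; lia.
Qed.

Lemma ceil_rev (v : word) : ceil_row (rev v) = rev (unzip1 v).
Proof. exact: map_rev. Qed.

Lemma unzip1_hookw D m U mu : unzip1 (hookw D m U mu) = D ++ m :: U.
Proof. by rewrite /hookw unzip1_cat /= !unzip1_noprime. Qed.

Lemma mid_primed_rev D m U mu : letter_at (rev (hookw D m U mu)) (size U) = (m, mu).
Proof.
rewrite /letter_at nth_rev size_hookw ?nth_hookw; last lia.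
have -> : (size D + size U).+1 - (size U).+1 = size D by lia.
by rewrite eqxx andbT nth_cat ltnn subnn.
Qed.

Lemma set_nth_cat (s1 : seq nat) y s2 z : set_nth 0 (s1 ++ y :: s2) (size s1) z = s1 ++ z :: s2.
Proof. by elim: s1 => //= x s1 ->. Qed.

Lemma find_cat_cons (P : pred nat) s1 y s2 : all (predC P) s1 -> P y ->
  find P (s1 ++ y :: s2) = size s1.
Proof. by elim: s1 => /= [_ ->|x s1 IH /andP[/negbTE -> h] /(IH h) ->]. Qed.

(* The middle position changes exactly when M is empty or x <= head M. *)
Definition flagged (x : nat) (M : seq nat) : bool := (M == [::]) || (x <= head 0 M).

(** * One row step as a relation on words *)

Definition bump_in x (al : bool) A b C M c N mu (rest : word) : word :=
  (x, al) :: hookw (A ++ b :: C) (head c M) (behead (M ++ c :: N)) mu ++ rest.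

(** The branches are the possible places of the new middle: x if it does not exceed the old middle
    m, the letter m itself if it does, and the end of x C if M is empty. Only when m stays the
    middle is its position unchanged, so only then does the bumped letter carry the bit of x. *)
Definition bump_out x al A b C M c N mu (rest : word) : word :=
  if M is m :: M1 then
    if x <= m then hookw A x (M ++ b :: N) al ++ (c, mu) :: rest
    else hookw (A ++ x :: C) m (M1 ++ b :: N) mu ++ (c, al) :: rest
  else hookw (A ++ belast x C) (last x C) (b :: N) al ++ (c, mu) :: rest.

Inductive bump_rel (s : nat) (y y' : word) : Prop :=
  BumpIntro x al A b C M c N mu rest of
    bumpable x A b C M c N & s = size A + size C + size M + size N + 2 & posw y &
    y = bump_in x al A b C M c N mu rest & y' = bump_out x al A b C M c N mu rest.

Lemma sorted_gtn_cat A B : sorted gtn (A ++ B) =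
  [&& allrel gtn A B, sorted gtn A & sorted gtn B].
Proof. by rewrite !(sorted_pairwise gtn_trans) pairwise_cat. Qed.

Lemma sorted_leq_cat A B : sorted leq (A ++ B) =
  [&& allrel leq A B, sorted leq A & sorted leq B].
Proof. by rewrite !(sorted_pairwise leq_trans) pairwise_cat. Qed.

Lemma allrelE (r : rel nat) A B : reflect (forall u v, u \in A -> v \in B -> r u v) (allrel r A B).
Proof. by apply: (iffP allrelP) => h u v; apply: h. Qed.

Record bump_facts x A b C M c N : Prop := BumpFacts {
  f_Ab : all (ltn b) A; f_A : sorted gtn A; f_bC : all (gtn b) C; f_C : sorted gtn C;
  f_mC : all (ltn (head c M)) C; f_mb : head c M < b; f_xb : x <= b; f_xC : all (gtn x) C;
  f_M : sorted leq M; f_Mc : all (geq c) M; f_N : sorted leq N; f_bN : all (leq b) N;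
  f_cb : c < b; f_mc : head c M <= c; f_mM : all (leq (head c M)) M }.

Lemma bumpable_facts x A b C M c N : bumpable x A b C M c N -> bump_facts x A b C M c N.
Proof.
move=> [[h1 h2 h3] [h4 h5 h6]].
move: h1; rewrite sorted_gtn_cat /= => /and3P[/allrelE r1 sA].
rewrite path_sortedE; last exact: gtn_trans.
rewrite all_rcons sorted_gtn_rcons => /and3P[/andP[mb bC] mC sC].
move: h4; rewrite sorted_leq_cat /= => /and3P[/allrelE r2 sM].
rewrite path_sortedE; last exact: leq_trans.
move=> /andP[cN sN].
have Mc : all (geq c) M by apply/allP => u uM; apply: r2 => //; rewrite inE eqxx.
split=> //.
- by apply/allP => u uA; apply: r1 => //; rewrite inE eqxx.
- by clear -Mc; case: M Mc => //= m M /andP[].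
by clear -sM; case: M sM => //= m M h; rewrite leqnn; exact: order_path_min leq_trans h.
Qed.

Lemma hookV_in x A b C M c N : bumpable x A b C M c N ->
  hookV (A ++ b :: C) (head c M) (behead (M ++ c :: N)).
Proof. by move=> /bumpable_hookV [U [E]]; rewrite E. Qed.

Lemma sorted_AxC x A b C M c N : bumpable x A b C M c N -> sorted gtn (A ++ x :: C).
Proof.
move=> /bumpable_facts F; rewrite sorted_gtn_cat (f_A F) /=.
rewrite path_sortedE ?(f_xC F) ?(f_C F) ?andbT; last exact: gtn_trans.
apply/allrelE => u v /(allP (f_Ab F)) /= bu; rewrite inE => /orP[/eqP ->|/(allP (f_bC F)) /=].
  by have := f_xb F; lia.
lia.
Qed.

Lemma sorted_MbN x A b C M c N : bumpable x A b C M c N -> sorted leq (M ++ b :: N).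
Proof.
move=> /bumpable_facts F; rewrite sorted_leq_cat (f_M F) /=.
rewrite path_sortedE ?(f_bN F) ?(f_N F) ?andbT; last exact: leq_trans.
have cb := f_cb F.
apply/allrelE => u v /(allP (f_Mc F)) /= bu; rewrite inE => /orP[/eqP ->|/(allP (f_bN F)) /=]; lia.
Qed.

(** A letter of C would be larger than m and smaller than x. *)
Lemma flagged_C x A b C m M c N : bumpable x A b C (m :: M) c N -> x <= m -> C = [::].
Proof.
by move=> /bumpable_facts F xm; case: C F => // d C F; have := f_mC F; have := f_xC F => /=; lia.
Qed.

Lemma hookV_out1 x A b C c N : bumpable x A b C [::] c N ->
  hookV (A ++ belast x C) (last x C) (b :: N).
Proof.
move=> ok; have := sorted_MbN ok; have := sorted_AxC ok; have F := bumpable_facts ok.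
rewrite /hookV lastI -rcons_cat => -> /= ->; rewrite andbT.
have := f_xb F; have := f_bC F; case/lastP: C {ok F} => [|C d] //=.
by rewrite last_rcons all_rcons => /andP[/=]; lia.
Qed.

Lemma hookV_out2 x A b m M c N : bumpable x A b [::] (m :: M) c N -> x <= m ->
  hookV A x (m :: M ++ b :: N).
Proof.
move=> ok xm; have := sorted_MbN ok; have := sorted_AxC ok.
by rewrite /hookV cats1 /= xm => -> ->.
Qed.

Lemma hookV_out3 x A b C m M c N : bumpable x A b C (m :: M) c N -> m < x ->
  hookV (A ++ x :: C) m (M ++ b :: N).
Proof.
move=> ok xm; have := sorted_MbN ok; have := sorted_AxC ok; have F := bumpable_facts ok.
rewrite hookVE => -> /= ->; rewrite !andbT all_cat /= xm (f_mC F) andbT.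
by rewrite andbT; apply: sub_all (f_Ab F) => u /=; have := f_mb F => /=; lia.
Qed.

Lemma unzip1_bump_in x al A b C M c N mu rest :
  unzip1 (bump_in x al A b C M c N mu rest) = x :: A ++ b :: C ++ M ++ c :: N ++ unzip1 rest.
Proof.
rewrite /bump_in /= unzip1_cat unzip1_hookw -?catA /= -?catA; case: M => //= m M.
by rewrite -?catA.
Qed.

Lemma unzip1_bump_out x al A b C M c N mu rest : bumpable x A b C M c N ->
  unzip1 (bump_out x al A b C M c N mu rest) = A ++ x :: C ++ M ++ b :: N ++ c :: unzip1 rest.
Proof.
move=> ok; rewrite /bump_out; case: M ok => [|m M] ok.
  by rewrite unzip1_cat unzip1_hookw -cat_rcons rcons_cat -lastI -?catA.
case: leqP => xm; last by rewrite unzip1_cat unzip1_hookw /= -?catA /= -?catA.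
by rewrite (flagged_C ok xm) unzip1_cat unzip1_hookw /= -?catA /= -?catA.
Qed.

Lemma unzip2_hookw D m U mu : unzip2 (hookw D m U mu) = nseq (size D) false ++ mu :: nseq (size U) false.
Proof. by rewrite /hookw unzip2_cat /= !unzip2_noprime. Qed.

Lemma unzip2_bump_in x al A b C M c N mu rest :
  unzip2 (bump_in x al A b C M c N mu rest) =
  al :: (nseq (size A + size C).+1 false ++ mu :: nseq (size M + size N) false) ++ unzip2 rest.
Proof.
rewrite /bump_in /= unzip2_cat unzip2_hookw size_cat /= addnS size_behead size_cat /=.
by rewrite addnS.
Qed.

Definition bump_bits (fl : bool) q r (al mu : bool) (br : seq bool) :=
  if fl then (nseq q false ++ al :: nseq r.+1 false) ++ mu :: br
  else (nseq q.+1 false ++ mu :: nseq r false) ++ al :: br.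

Lemma unzip2_bump_out x al A b C M c N mu rest : bumpable x A b C M c N ->
  unzip2 (bump_out x al A b C M c N mu rest) =
  bump_bits (flagged x M) (size A + size C) (size M + size N) al mu (unzip2 rest).
Proof.
move=> ok; rewrite /bump_out /flagged /bump_bits; case: M ok => [|m M] ok /=.
  by rewrite unzip2_cat unzip2_hookw size_cat size_belast /= add0n.
case: leqP => xm; rewrite unzip2_cat unzip2_hookw /= ?size_cat /=; last by rewrite !addnS.
by rewrite (flagged_C ok xm) addn0 addnS.
Qed.

(** The position [size A + size C] compares the last letter of x C with its successor in the output.
    Thus the flag is a descent of the output, and operators of positive index cannot change it. *)
Lemma flagged_descents x A b C M c N s : bumpable x A b C M c N ->
  nth false (descents (A ++ x :: C ++ M ++ b :: N ++ s)) (size A + size C) = ~~ flagged x M.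
Proof.
have key D m U t p : hookV D m U -> nth false (descents (D ++ m :: U ++ t)) p = (p < size D) ||
   (size D + size U <= p) && nth false (descents (D ++ m :: U ++ t)) p.
  move=> ok; have := hookV_descents ok.
  rewrite -cat_cons catA => h.
  have sz : size (D ++ m :: U) = (size D + size U).+1 by rewrite size_cat /=; lia.
  have e : take (size D + size U) (descents ((D ++ m :: U) ++ t)) = descents (D ++ m :: U).
    by rewrite -descents_take -sz take_size_cat.
  case: (ltnP p (size D + size U)) => hp; last by rewrite /= ; lia.
  rewrite -(nth_take _ hp) e h nth_cat !nth_nseq size_nseq.
  by case: ltnP => //= h2; rewrite if_same.
move=> ok; have F := bumpable_facts ok; rewrite /flagged; case: M ok F => [|m M] ok F /=.
  have -> : A ++ x :: C ++ b :: N ++ s = (A ++ belast x C) ++ last x C :: (b :: N) ++ s.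
    by rewrite -[in RHS]cat_rcons rcons_cat -lastI -?catA.
  rewrite (key _ _ _ _ _ (hookV_out1 ok)) size_cat size_belast /= ltnn /=.
  by rewrite leqNgt; case: ltnP => //; lia.
case: leqP => xm /=.
  have C0 := flagged_C ok xm; subst C; rewrite /= addn0.
  have := key _ _ _ s (size A) (hookV_out2 ok xm); rewrite /= -?catA /= => ->.
  by rewrite ltnn size_cat /=; lia.
have := key _ _ _ s (size A + size C) (hookV_out3 ok xm); rewrite -?catA /= -?catA /= => ->.
by rewrite size_cat /= addnS ltnS leqnn.
Qed.

(* [append_rel s o] and [bump_rel s] describe the action on x :: row ++ rest, for a
   reversed row of length s, of an insertion that appends a box with parity o and of
   one that bumps a letter. *)
Inductive append_rel (s : nat) (o : bool) (y y' : word) : Prop :=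
| Append0 x al rest of s = 0 & o = false & posw y & y = (x, al) :: rest & y' = y
| Append1 x al m U mu rest of x <= m & hookV [::] m U & s = (size U).+1 & o = mu & posw y &
    y = (x, al) :: hookw [::] m U mu ++ rest & y' = hookw [::] x (m :: U) al ++ rest
| Append2 x al D m U mu rest of hookV (x :: D) m U & s = (size D + size U).+1 & o = al & posw y &
    y = (x, al) :: hookw D m U mu ++ rest & y' = hookw (x :: D) m U mu ++ rest.

Lemma cons_rev (x : nat) V : rcons (rev V) x = rev (x :: V).
Proof. by rewrite rev_cons. Qed.

Lemma hookV_hook D m U : hookV D m U -> hook_word (rev (D ++ m :: U)).
Proof.
by move=> ok; apply/hook_wordP; exists (size D), (size U); rewrite hookV_descents //; case: D {ok}.
Qed.

Lemma hookV_tl x D m U : hookV (x :: D) m U -> hookV D m U.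
Proof. by rewrite !hookVE /= => /and3P[/andP[_ ->] /path_sorted -> ->]. Qed.

Lemma unzip1_rev (v : word) : unzip1 (rev v) = rev (unzip1 v).
Proof. exact: map_rev. Qed.

Lemma append_rel_row s o y y' : append_rel s o y y' -> exists x v r' rest,
  [/\ y = x :: v ++ rest, size v = s, s = 0 \/ is_hookw v,
      row_insert x (rev v) = (r', None, o) &
   y' = rev r' ++ rest /\ [/\ size r' = s.+1, is_hookw (rev r') & {subset unzip1 r' <= x.1 :: unzip1 v}]].
Proof.
case.
- move=> x al rest -> -> _ -> ->; exists (x, al), [::], [:: (x, al)], rest.
  split=> //; [by left| |split=> //; split=> //]; last by exists 0, 0, al.
  rewrite /row_insert /= /hook_word /= /middle /prime_middle /=.
  by rewrite /hook_at /= /letter_at /= andbT.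
- move=> x al m U mu rest xm ok -> -> _ -> ->.
  have ok2 : hookV [::] x (m :: U) by move: ok; rewrite !hookVE /= xm.
  exists (x, al), (hookw [::] m U mu), (rev (hookw [::] x (m :: U) al)), rest.
  split; rewrite ?size_hookw ?revK ?size_rev ?size_hookw //; first by right; apply: hookw_ok.
    2: { split=> //; split=> //; first exact: hookw_ok.
         by move=> u; rewrite unzip1_rev mem_rev !unzip1_hookw. }
  rewrite /row_insert ceil_rev unzip1_hookw cons_rev (hookV_hook ok2) (middle_rev ok).
  rewrite (middle_rev ok2) /= (gtn_eqF (ltnSn _)) orbT.
  by rewrite (prime_middle_rev al ok2) mid_primed_rev.
move=> x al D m U mu rest ok -> -> _ -> ->; have ok2 := hookV_tl ok.
exists (x, al), (hookw D m U mu), (rev (hookw (x :: D) m U mu)), rest.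
split; rewrite ?size_hookw ?revK ?size_rev ?size_hookw //; first by right; apply: hookw_ok.
  2: { split=> //; split=> //; first exact: hookw_ok.
       by move=> u; rewrite unzip1_rev mem_rev !unzip1_hookw. }
rewrite /row_insert ceil_rev unzip1_hookw cons_rev (hookV_hook ok) (middle_rev ok2).
rewrite (middle_rev ok) eqxx orbF mid_primed_rev.
by rewrite /nilp size_rev size_cat /= addnS /= (prime_middle_rev mu ok).
Qed.

(** The last conjunct, c below some letter of the row, is recorded for the bound on the letters of
    the following rows. *)
Lemma bump_rel_row s y y' : bump_rel s y y' -> exists x v r' c g rest,
  [/\ y = x :: v ++ rest, size v = s, is_hookw v,
      row_insert x (rev v) = (r', Some c, g) &
   y' = rev r' ++ (c, g) :: rest /\ [/\ size r' = s, is_hookw (rev r'),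
     {subset unzip1 r' <= x.1 :: unzip1 v}, c \in unzip1 v &
     exists2 b, b \in unzip1 v & c < b]].
Proof.
case=> x al A b C M c N mu rest ok -> _ -> ->.
have okv := hookV_in ok; have F := bumpable_facts ok.
set v := hookw (A ++ b :: C) (head c M) (behead (M ++ c :: N)) mu.
have sv : size v = size A + size C + size M + size N + 2.
  by rewrite /v size_hookw size_behead !size_cat /=; lia.
have Ev : (A ++ b :: C) ++ head c M :: behead (M ++ c :: N) = (A ++ b :: C) ++ M ++ c :: N.
  by congr cat; case: (M).
have sU : size (behead (M ++ c :: N)) = size M + size N by rewrite size_behead size_cat /=; lia.
(* Reversed, the extended row begins with a weak ascent followed by a descent, which no hook word
   does. *)
have hook_seq : hook_word (rcons (rev ((A ++ b :: C) ++ M ++ c :: N)) x) = false.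
  rewrite cons_rev; apply/hook_wordP => -[p [r [_]]].
  have := bumpable_bump_des [::] ok; rewrite /bump_des cats0 -catA /= => + e; rewrite e.
  by move: e => _; case: p => [|p] //=; case: r => [|[|r]].
(* The row is searched from left to right, that is, backwards here: the search skips C, whose
   letters are below x, and stops at b. The later search for c likewise skips N, whose letters are
   at least b. *)
have find_kb : find (leq x) (drop (size M + size N).+1 (rev ((A ++ b :: C) ++ M ++ c :: N))) = size C.
  rewrite rev_cat drop_size_cat; last by rewrite size_rev size_cat /=; lia.
  rewrite rev_cat rev_cons -cats1 -catA /= find_cat_cons ?size_rev ?(f_xb F) //.
  by rewrite all_rev; apply: sub_all (f_xC F) => u /=; lia.
have Erev : rev ((A ++ b :: C) ++ M ++ c :: N) = (rev (M ++ c :: N) ++ rev C) ++ b :: rev A.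
  by rewrite rev_cat (rev_cat A) rev_cons -cats1 -?catA.
have skb : (size M + size N).+1 + size C = size (rev (M ++ c :: N) ++ rev C).
  by rewrite size_cat !size_rev size_cat /=; lia.
have nth_kb : nth 0 (rev ((A ++ b :: C) ++ M ++ c :: N)) ((size M + size N).+1 + size C) = b.
  by rewrite Erev skb nth_cat ltnn subnn.
have find_kc : find (gtn b) (take (size M + size N).+1 (rev ((A ++ b :: C) ++ M ++ c :: N))) = size N.
  rewrite rev_cat take_size_cat; last by rewrite size_rev size_cat /=; lia.
  rewrite rev_cat rev_cons -cats1 -catA /= find_cat_cons; [by rewrite size_rev| |exact: (f_cb F)].
  by rewrite all_rev; apply: sub_all (f_bN F) => u /=; lia.
have Erev2 t : (rev (M ++ c :: N) ++ rev C) ++ t :: rev A = rev N ++ c :: rev M ++ rev C ++ t :: rev A.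
  by rewrite rev_cat rev_cons -cats1 -?catA /= -?catA.
have nth_kc : nth 0 (rev ((A ++ b :: C) ++ M ++ c :: N)) (size N) = c.
  by rewrite Erev Erev2 -(size_rev N) nth_cat ltnn subnn.
have Eout t u : rev N ++ t :: rev M ++ rev C ++ u :: rev A = rev (A ++ u :: C ++ M ++ t :: N).
  by rewrite !(rev_cat, rev_cons) -!cats1 -?catA /= -?catA.
have step : row_insert (x, al) (rev v) =
  let r' := rev (A ++ x :: C ++ M ++ b :: N) in
  if middle r' != size M + size N then (prime_middle r' al, Some c, mu)
  else (prime_middle r' mu, Some c, al).
  rewrite /row_insert /v ceil_rev unzip1_hookw Ev hook_seq /= -Ev (middle_rev okv) mid_primed_rev Ev sU.
  rewrite find_kb nth_kb find_kc nth_kc Erev skb set_nth_cat !Erev2 -(size_rev N) set_nth_cat !Eout.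
  by rewrite /nilp size_rev size_cat /= addnS.
have uv : unzip1 v = (A ++ b :: C) ++ M ++ c :: N by rewrite /v unzip1_hookw Ev.
have cv : c \in unzip1 v by rewrite uv !(mem_cat, inE) eqxx !orbT.
have bv : exists2 b, b \in unzip1 v & c < b.
  by exists b; [rewrite uv !(mem_cat, inE) eqxx !orbT | exact: (f_cb F)].
have sub (w : word) : unzip1 w = A ++ x :: C ++ M ++ b :: N -> {subset unzip1 (rev w) <= x :: unzip1 v}.
  move=> e u; rewrite unzip1_rev mem_rev e uv !(mem_cat, inE).
  by do ![case/orP => [->|] | move=> -> ]; rewrite ?orbT.
have vE : bump_in x al A b C M c N mu rest = (x, al) :: v ++ rest by [].
have okw : is_hookw v by apply: hookw_ok.
rewrite vE; clear - ok F sU step sv okw cv bv sub; clearbody v.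
have sz : size (A ++ x :: C ++ M ++ b :: N) = size A + size C + size M + size N + 2.
  by rewrite !size_cat /= !size_cat /=; lia.
rewrite /bump_out; case: M ok F sU sz sv step sub => [|m M] ok F sU sz sv step sub.
  have E : A ++ x :: C ++ [::] ++ b :: N = (A ++ belast x C) ++ last x C :: b :: N.
    by rewrite -[in RHS]cat_rcons rcons_cat -lastI -?catA.
  exists (x, al), v, (rev (hookw (A ++ belast x C) (last x C) (b :: N) al)), c, mu, rest.
  split=> //; last first.
    rewrite revK; split=> //; split=> //.
    - by rewrite size_rev size_hookw size_cat size_belast /=; lia.
    - exact: hookw_ok (hookV_out1 ok).
    by apply: sub; rewrite unzip1_hookw E.
  rewrite step /= E (middle_rev (hookV_out1 ok)) /= (prime_middle_rev al (hookV_out1 ok)).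
  by rewrite ifT //; lia.
case: leqP => xm.
  have C0 := flagged_C ok xm; subst C.
  exists (x, al), v, (rev (hookw A x (m :: M ++ b :: N) al)), c, mu, rest.
  split=> //; last first.
    rewrite revK; split=> //; split=> //.
    - by rewrite size_rev size_hookw /= size_cat /=; lia.
    - exact: hookw_ok (hookV_out2 ok xm).
    by apply: sub; rewrite unzip1_hookw.
  rewrite step /= (middle_rev (hookV_out2 ok xm)) /= (prime_middle_rev al (hookV_out2 ok xm)).
  by rewrite ifT // size_cat /=; lia.
exists (x, al), v, (rev (hookw (A ++ x :: C) m (M ++ b :: N) mu)), c, al, rest.
split=> //; last first.
  rewrite revK; split=> //; split=> //.
  - by rewrite size_rev size_hookw /= !size_cat /=; lia.
  - exact: hookw_ok (hookV_out3 ok xm).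
  by apply: sub; rewrite unzip1_hookw -catA.
rewrite step /=.
have -> : A ++ x :: C ++ m :: M ++ b :: N = (A ++ x :: C) ++ m :: M ++ b :: N by rewrite -catA.
rewrite (middle_rev (hookV_out3 ok xm)) /= (prime_middle_rev mu (hookV_out3 ok xm)).
by rewrite ifF // size_cat /=; lia.
Qed.

Ltac slia := repeat match goal with
  | H : @eq (list _) _ _ |- _ => clear H
  | H : is_true (all _ _) |- _ => clear H
  | H : is_true (sorted _ _) |- _ => clear H
  | H : is_true (path _ _ _) |- _ => clear H
  | H : is_true (hookV _ _ _) |- _ => clear H
  | H : is_hookw _ |- _ => clear H
  | H : forall _, _ |- _ => clear H
  end; lia.

(** * Hook windows under the operators *)

Definition hook_win (k : nat) (a v c z : word) := exists a' v' c',
  [/\ z = a' ++ v' ++ c', size a' = size a, size v' = size v & is_hookw v'].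

Lemma hook_win_descents a v c z : is_hookw v -> unzip2 z = unzip2 (a ++ v ++ c) ->
  descents (unzip1 z) = descents (unzip1 (a ++ v ++ c)) -> hook_win 0 a v c z.
Proof.
move=> [p [r [mu [h1 h2]]]] e2 e1.
have sv : size v = (p + r).+1 by have := congr1 size h2; rewrite size_map size_cat /= !size_nseq => ->; lia.
have sz : size z = size (a ++ v ++ c) by have := congr1 size e2; rewrite !size_map.
exists (take (size a) z), (take (size v) (drop (size a) z)), (drop (size v) (drop (size a) z)).
have sa : size (take (size a) z) = size a by rewrite size_takel // sz !size_cat; lia.
split=> //; first by rewrite !cat_take_drop.
  by rewrite size_takel // size_drop sz !size_cat; lia.
exists p, r, mu; split.
  rewrite /unzip1 map_take map_drop -/(unzip1 _) sv descents_take descents_drop e1.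
  rewrite -descents_drop -descents_take unzip1_cat drop_size_cat ?size_map // unzip1_cat.
  by rewrite take_size_cat ?size_map.
rewrite /unzip2 map_take map_drop -/(unzip2 _) e2 unzip2_cat drop_size_cat ?size_map //.
by rewrite unzip2_cat take_size_cat ?size_map.
Qed.

Lemma hook_win_set1 b a v c : posw v -> is_hookw v -> hook_win 0 a v c (set1 b (a ++ v ++ c)).
Proof.
move=> pv ov; rewrite !set1_cat; case: (first1 a) => [?|].
  by exists (set1 b a), v, c; rewrite set1_size.
case: (first1 v) => [?|]; last by exists a, v, (set1 b c).
by exists a, (set1 b v), c; split; rewrite ?set1_size //; apply: is_hookw_set1.
Qed.

(** For index bar 1: if the lowered 2 lies before the window, the window changes at most by [set1];
    otherwise [is_hookw_e_bar] applies from the window on. Index 0 is a [set1], and positive indices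
    keep descents and bits. *)
Lemma hook_win_e i a v c z : posw v -> is_hookw v -> op_e i (a ++ v ++ c) = Some z -> hook_win 0 a v c z.
Proof.
move=> pv ov; case: i => [|[|i]] /=.
- case e: (first12 a) (first12_le a) => [|[|[|k]]] // _.
  + rewrite e_bar_cat //; case e2: (e_bar (v ++ c)) => [u|] //= [<-].
    have [v' [c' [-> s1 o1]]] := is_hookw_e_bar pv ov e2.
    by exists a, v', c'.
  + by move/eqP: (e_bar_none (a ++ v ++ c)); rewrite first12_cat e; case: (e_bar _).
  + have [a' [t [s [->|->]]]] := e_bar_cat2 (v ++ c) e => -[<-].
      by exists a', v, c.
    have [a0 [v' [c' [E /size0nil a00 s2 o]]]] := hook_win_set1 t [::] c pv ov.
    rewrite a00 /= in E; rewrite E.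
    by exists a', v', c'.
- by rewrite /e0; case: (first1 _) => [[]|] // [<-]; apply: hook_win_set1.
- by move=> /e_word_unzip [e1 e2]; apply: hook_win_descents => //; apply: en_descents e1.
Qed.

Lemma hook_win_f i a v c z : posw v -> is_hookw v -> op_f i (a ++ v ++ c) = Some z -> hook_win 0 a v c z.
Proof.
move=> pv ov; case: i => [|[|i]] /=.
- case e: (first12 a) (first12_le a) => [|[|[|k]]] // _.
  + rewrite f_bar_cat //; case e2: (f_bar (v ++ c)) => [u|] //= [<-].
    have [v' [c' [-> s1 o1]]] := is_hookw_f_bar pv ov e2.
    by exists a, v', c'.
  + have [a' [t [s [->|->]]]] := f_bar_cat2 (v ++ c) e => -[<-].
      by exists a', v, c.
    have [a0 [v' [c' [E /size0nil a00 s2 o]]]] := hook_win_set1 t [::] c pv ov.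
    rewrite a00 /= in E; rewrite E.
    by exists a', v', c'.
  + by move/eqP: (f_bar_none (a ++ v ++ c)); rewrite first12_cat e; case: (f_bar _).
- by rewrite /f0; case: (first1 _) => [[]|] // [<-]; apply: hook_win_set1.
- move=> /e_word_f_word /e_word_unzip [e1 e2]; apply: hook_win_descents => //.
  by symmetry; apply: en_descents e1.
Qed.

Lemma posw_cat a b : posw (a ++ b) = posw a && posw b.
Proof. exact: all_cat. Qed.

Lemma posw_unzip1 w : posw w = all (ltn 0) (unzip1 w).
Proof. by rewrite /posw all_map. Qed.

Lemma en_pos i w v : 0 < i -> en i w = Some v -> all (ltn 0) v = all (ltn 0) w.
Proof.
move=> i0; elim: w v => //= x w IH v; case: ifP => [/andP[/eqP -> _] [<-] /=|_]; first by rewrite i0.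
by case: (en i w) IH => //= u /(_ _ erefl) <- [<-].
Qed.

Lemma e_bar_pos y z : e_bar y = Some z -> posw z = posw y.
Proof.
elim: y z => //= x y IH z; case: ifP => [/eqP -> [<-] /=|_]; first by rewrite set1_pos.
by case: ifP => // _; case: (e_bar y) IH => //= u /(_ _ erefl) <- [<-].
Qed.

Lemma posw_op_e i y z : op_e i y = Some z -> posw z = posw y.
Proof.
case: i => [|[|i]] /=; first exact: e_bar_pos.
  by rewrite /e0; case: (first1 y) => [[]|] // [<-]; rewrite set1_pos.
by move=> /e_word_unzip [e1 _]; rewrite !posw_unzip1; apply: en_pos e1.
Qed.

Lemma posw_op_f i y z : op_f i y = Some z -> posw z = posw y.
Proof. by move=> /op_ef /posw_op_e ->. Qed.

Lemma hookV_cons x D m U : hookV (x :: D) m U = (head m D < x) && hookV D m U.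
Proof. by rewrite /hookV; case: D => [|y D] /=; rewrite ?andbT ?andbA. Qed.

Lemma e_bar_size y z : e_bar y = Some z -> size z = size y.
Proof.
elim: y z => //= x y IH z; case: ifP => [_ [<-] /=|_]; first by rewrite set1_size.
by case: ifP => // _; case: (e_bar y) IH => //= u /(_ _ erefl) <- [<-].
Qed.

Lemma e_size i y z : op_e i y = Some z -> size z = size y.
Proof.
case: i => [|[|i]] /=; first exact: e_bar_size.
  by rewrite /e0; case: (first1 y) => [[]|] // [<-]; rewrite set1_size.
by move=> /e_word_unzip [/en_size e1 _]; move: e1; rewrite !size_map.
Qed.

Lemma f_size i y z : op_f i y = Some z -> size z = size y.
Proof. by move=> /op_ef /e_size ->. Qed.

(** * Totality and determinism of row steps *)

Definition row_dom s y := posw y /\ exists x v rest,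
  [/\ y = x :: v ++ rest, size v = s & s = 0 \/ is_hookw v].

Definition row_rel s (l : option bool) y y' := if l is Some o then append_rel s o y y' else bump_rel s y y'.

Lemma append_rel_pos s o y y' : append_rel s o y y' -> posw y. Proof. by case. Qed.
Lemma bump_rel_pos s y y' : bump_rel s y y' -> posw y. Proof. by case. Qed.

Lemma row_rel_row_dom s l y y' : row_rel s l y y' -> row_dom s y.
Proof.
case: l => [o|] /= r.
  split; first exact: append_rel_pos r.
  by have [x [v [r' [rest [-> sv ov _ _]]]]] := append_rel_row r; exists x, v, rest.
split; first exact: bump_rel_pos r.
by have [x [v [r' [c [g [rest [-> sv ov _ _]]]]]]] := bump_rel_row r; exists x, v, rest; split=> //; right.
Qed.

Lemma row_dom_row_rel s y : row_dom s y -> exists l y', row_rel s l y y'.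
Proof.
move=> [py [[x al] [v [rest [Ey sv [s0|]]]]]].
  subst s; move/size0nil: s0 => v0; subst v.
  by exists (Some false), y; apply: (@Append0 _ _ _ _ x al rest).
move=> /hookwP [D [m [U [mu [Ev ok]]]]].
have ss : s = (size D + size U).+1 by rewrite -sv Ev size_hookw.
rewrite Ev in Ey.
(* [head m D] is the first letter of the reversed row. If x exceeds it, x extends the decreasing
   part; otherwise a box is appended only if D is empty. *)
case: (leqP x (head m D)) => h; last first.
  exists (Some al), (hookw (x :: D) m U mu ++ rest).
  by apply: (@Append2 _ _ _ _ x al D m U mu rest) => //; rewrite hookV_cons h.
case: D ok Ev Ey ss h => [|d D] ok Ev Ey ss /= h.
  exists (Some mu), (hookw [::] x (m :: U) al ++ rest).
  by apply: (@Append1 _ _ _ _ x al m U mu rest).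
have [sD sU] : sorted gtn (rcons (d :: D) m) /\ sorted leq (m :: U) by apply/andP.
have [||A [b [C [ED xb xC]]]] := @split_dec x (d :: D) _ _ h => //.
  by move: sD; rewrite sorted_gtn_rcons => /andP[].
have [|M [c [N [EU cb bN]]]] := @split_inc b m U sU.
  by have /allP := hookV_D ok; apply; rewrite ED mem_cat inE eqxx orbT.
have Em : m = head c M by case: M EU => [|? ?] [-> _].
have EU' : U = behead (M ++ c :: N) by rewrite -EU.
exists None, (bump_out x al A b C M c N mu rest).
apply: (@BumpIntro _ _ _ x al A b C M c N mu rest) => //.
- by split; split=> //; rewrite -?EU // -Em -rcons_cons -rcons_cat -ED.
- rewrite ss EU' ED size_behead !size_cat /=; lia.
- by rewrite Ey /bump_in -ED -Em -EU'.
Qed.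

(** Both relations lie in the graph of [row_insert]: s fixes where the row ends, and label and
    output are functions of the result of the insertion. *)
Lemma row_rel_fun s l y y' l2 y2' : row_rel s l y y' -> row_rel s l2 y y2' -> l = l2 /\ y' = y2'.
Proof.
have inj (x x2 : letter) (v v2 rest rest2 : word) :
  x :: v ++ rest = x2 :: v2 ++ rest2 -> size v = s -> size v2 = s ->
  [/\ x = x2, v = v2 & rest = rest2].
  by move=> [-> /eqP] + s1 s2; rewrite eqseq_cat ?s1 ?s2 // => /andP[/eqP -> /eqP ->].
case: l => [o|] /=; case: l2 => [o2|] /=.
- move=> /append_rel_row [x [v [r' [rest [-> sv _ e [-> _]]]]]].
  move=> /append_rel_row [x2 [v2 [r2' [rest2 [E sv2 _ e2 [-> _]]]]]].
  by have [Ex Ev Er] := inj _ _ _ _ _ _ E sv sv2; move: e; rewrite Ex Ev Er e2 => -[-> ->].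
- move=> /append_rel_row [x [v [r' [rest [-> sv _ e [-> _]]]]]].
  move=> /bump_rel_row [x2 [v2 [r2' [c2 [g2 [rest2 [E sv2 _ e2 [-> _]]]]]]]].
  by have [Ex Ev Er] := inj _ _ _ _ _ _ E sv sv2; move: e; rewrite Ex Ev Er e2.
- move=> /bump_rel_row [x [v [r' [c [g [rest [-> sv _ e [-> _]]]]]]]].
  move=> /append_rel_row [x2 [v2 [r2' [rest2 [E sv2 _ e2 [-> _]]]]]].
  by have [Ex Ev Er] := inj _ _ _ _ _ _ E sv sv2; move: e; rewrite Ex Ev Er e2.
- move=> /bump_rel_row [x [v [r' [c [g [rest [-> sv _ e [-> _]]]]]]]].
  move=> /bump_rel_row [x2 [v2 [r2' [c2 [g2 [rest2 [E sv2 _ e2 [-> _]]]]]]]].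
  by have [Ex Ev Er] := inj _ _ _ _ _ _ E sv sv2; move: e; rewrite Ex Ev Er e2 => -[-> -> ->].
Qed.

Lemma row_dom_f s i y z : row_dom s y -> op_f i y = Some z -> row_dom s z.
Proof.
move=> [py [x [v [rest [Ey sv ov]]]]] e; split; first by rewrite (posw_op_f e).
have py' : posw v by move: py; rewrite Ey -cat1s !posw_cat => /and3P[].
case: ov => [s0|ov].
  have := f_size e; rewrite Ey; case: z {e} => [|x' z] // _.
  by exists x', [::], z; split=> //; left.
rewrite Ey -cat1s in e; have [a' [v' [c' [-> sa sv' ov']]]] := hook_win_f py' ov e.
by case: a' sa => [|x' [|]] //= _; exists x', v', c'; rewrite sv'; split=> //; right.
Qed.

(** * Appending a box: operators of index 0 and bar 1 *)

Lemma append_rel_12 s o y y' : append_rel s o y y' -> [/\ first1 y' = first1 y, first12 y' = first12 y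
     & forall b, append_rel s o (set1 b y) (set1 b y')].
Proof.
case.
- move=> x al rest s0 o0 py Ey ->; split=> // b.
  case: (x =P 1) => [x1|n1].
    by apply: (@Append0 _ _ _ _ 1 b rest); rewrite ?set1_pos // Ey /= x1.
  by apply: (@Append0 _ _ _ _ x al (set1 b rest)); rewrite ?set1_pos // Ey /= (introF eqP n1).
- move=> x al m U mu rest xm ok Es Eo py Ey Ey'.
  have x0 : 0 < x by move: py; rewrite Ey /= => /andP[].
  have mU := hookV_U ok.
  have [x1|n1] := eqVneq x 1.
    rewrite Ey' [in first1 y]Ey [in first12 y]Ey /= x1; split=> // b.
    by apply: (@Append1 _ _ _ _ 1 b m U mu rest) => //; [rewrite -x1|rewrite set1_pos|rewrite Ey /= x1].
  have m2 : 2 <= m by slia.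
  have U2 : all (leq 2) U by apply: sub_all mU => z /=; slia.
  have e1 : first1 y = first1 rest.
    by rewrite Ey /= (negbTE n1) first1_plc // (gtn_eqF m2).
  have e1' : first1 y' = first1 rest.
    by rewrite Ey' /= (negbTE n1) /= first1_plc // (gtn_eqF m2).
  have e2 b : set1 b y = (x, al) :: hookw [::] m U mu ++ set1 b rest.
    by rewrite Ey /= (negbTE n1) set1_plc // (gtn_eqF m2).
  have e2' b : set1 b y' = hookw [::] x (m :: U) al ++ set1 b rest.
    by rewrite Ey' /= (negbTE n1) /= set1_plc // (gtn_eqF m2).
  split; first by rewrite e1 e1'.
    rewrite Ey Ey' /=; case: (x =P 2) => // n2; rewrite (negbTE n1) /=.
  by move=> b; apply: (@Append1 _ _ _ _ x al m U mu (set1 b rest)); rewrite ?set1_pos.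
move=> x al D m U mu rest ok Es Eo py Ey Ey'.
have m0 : 0 < m by move: py; rewrite Ey /= posw_cat /hookw posw_cat /= => /andP[_ /andP[/andP[_ /andP[]]]].
have okD := hookV_tl ok; have xD2 := le2_le3 (hookV_D ok) m0.
have mU := hookV_U okD.
have /andP[x2 run2] : (2 <= x) && all (leq 2) D by [].
have e1 w (c : bool) : first1 ((x, c) :: noprime D ++ w) = first1 w.
  by rewrite /= (gtn_eqF x2) first1_plc.
have e2 b w (c : bool) : set1 b ((x, c) :: noprime D ++ w) = (x, c) :: noprime D ++ set1 b w.
  by rewrite /= (gtn_eqF x2) set1_plc.
have Ey1 : y = (x, al) :: noprime D ++ (m, mu) :: noprime U ++ rest by rewrite Ey /hookw -catA.
have Ey1' : y' = (x, false) :: noprime D ++ (m, mu) :: noprime U ++ rest by rewrite Ey' /hookw -catA.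
split; first by rewrite Ey1 Ey1' !e1.
  by rewrite Ey1 Ey1'.
move=> b; have [mm|nm] := eqVneq m 1.
  apply: (@Append2 _ _ _ _ x al D m U b rest); rewrite ?set1_pos //.
    by rewrite Ey1 e2 /= mm /hookw -catA.
  by rewrite Ey1' e2 /= mm /hookw -catA.
have U2 : all (leq 2) U by apply: sub_all mU => z /=; slia.
apply: (@Append2 _ _ _ _ x al D m U mu (set1 b rest)); rewrite ?set1_pos //.
  by rewrite Ey1 e2 /= (negbTE nm) set1_plc // /hookw -catA.
by rewrite Ey1' e2 /= (negbTE nm) set1_plc // /hookw -catA.
Qed.

Lemma append_rel_e_bar s o y y' z : append_rel s o y y' -> e_bar y = Some z ->
  exists2 z', e_bar y' = Some z' & append_rel s o z z'.
Proof.
case.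
- move=> x al rest s0 o0 py Ey -> e; exists z => //.
  have := e_bar_size e; rewrite Ey; case: z e => [|[x' al'] z] e // _.
  by apply: (@Append0 _ _ _ _ x' al' z) => //; rewrite (e_bar_pos e).
- move=> x al m U mu rest xm ok Es Eo py Ey Ey' e.
  have x0 : 0 < x by move: py; rewrite Ey /= => /andP[].
  have pz := e_bar_pos e.
  have mU := hookV_U ok; move: e.
  rewrite [in e_bar y]Ey /= ; case: (x =P 2) => [x2|n2].
    have U2 : all (leq 2) U by apply: sub_all mU => t /=; slia.
    have nm : (m == 1) = false by slia.
    rewrite nm first1_plc // set1_plc // => -[Ez].
    exists (hookw [::] 1 (m :: U) (odflt al (first1 rest)) ++ set1 al rest).
      by rewrite Ey' x2 /= nm first1_plc // set1_plc.
    apply: (@Append1 _ _ _ _ 1 (odflt al (first1 rest)) m U mu (set1 al rest)) => //; last by rewrite pz.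
    slia.
  case: (x =P 1) => // n1.
  have U3 : all (leq 3) U by apply: sub_all mU => t /=; slia.
  have nm2 : (m == 2) = false by slia.
  have nm1 : (m == 1) = false by slia.
  rewrite nm1 nm2 e_bar_noprime //; case e: (e_bar rest) => [u|] //= [Ez].
  exists (hookw [::] x (m :: U) al ++ u).
    by rewrite Ey' /= (introF eqP n1) (introF eqP n2) /= nm1 nm2 e_bar_noprime // e.
  by apply: (@Append1 _ _ _ _ x al m U mu u) => //; rewrite ?pz.
move=> x al D m U mu rest ok Es Eo py Ey Ey' e.
have pz := e_bar_pos e.
have m0 : 0 < m by move: py; rewrite Ey /= posw_cat /hookw posw_cat /= => /andP[_ /andP[/andP[_ /andP[]]]].
have okD := hookV_tl ok; have xD2 := le2_le3 (hookV_D ok) m0.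
have mU := hookV_U okD.
have /andP[x2 run2] : (2 <= x) && all (leq 2) D by [].
have Ey1 : y = (x, al) :: noprime D ++ (m, mu) :: noprime U ++ rest by rewrite Ey /hookw -catA.
have Ey1' : y' = (x, false) :: noprime D ++ (m, mu) :: noprime U ++ rest by rewrite Ey' /hookw -catA.
have := ok; rewrite hookVE => /and3P[axD sxD pU].
(* If x = 2, it stands directly before the middle 1 and [e_bar] swaps their bits. Afterwards x
   equals the middle, so the other kind of append applies: the parity was the bit of x and is now
   the bit of the old middle, and the swap makes both equal to [al]. *)
have [x3|nx3] := ltnP 2 x; last first.
  have xx : x = 2 by slia.
  have D0 : D = [::].
    by case: D axD sxD xD2 {ok Es Ey Ey' okD run2 Ey1 Ey1'} => //= d D /andP[_ /andP[h _]] /andP[h2 _]; slia.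
  have mm : m = 1 by move: axD; rewrite xx /= => /andP[]; slia.
  subst D m x; move: e; rewrite Ey1 /= => -[Ez].
  exists (hookw [::] 1 (1 :: U) mu ++ rest); first by rewrite Ey1'.
  by apply: (@Append1 _ _ _ _ 1 mu 1 U al rest) => //; rewrite ?pz.
have nx1 : (x == 1) = false by slia.
have nx2 : (x == 2) = false by slia.
have sD : sorted gtn D by move: sxD => /= /path_sorted.
move: e; case: (dec_last2 sD run2) => [D3|[D' [ED D3 sD']]]; last first.
  have mm : m = 1 by move: axD; rewrite ED /= all_rcons => /and3P[_ /= h _]; slia.
  rewrite Ey1 /= nx1 nx2 ED /noprime map_rcons cat_rcons -/(noprime _) e_bar_noprime //= mm /= => -[Ez].
  have ok' : hookV (x :: D') 1 (1 :: U).
    move: sxD pU; rewrite hookVE ED mm -rcons_cons sorted_gtn_rcons /= => /andP[_ ->] ->.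
    by rewrite ?andbT (ltnW x3) /= ?andbT; apply: sub_all D3 => t /=; slia.
  exists (hookw (x :: D') 1 (1 :: U) mu ++ rest).
    rewrite Ey1' /= nx1 nx2 ED /noprime map_rcons cat_rcons -/(noprime _) e_bar_noprime //= mm /=.
    by rewrite /hookw /= -catA.
  apply: (@Append2 _ _ _ _ x al D' 1 (1 :: U) mu rest) => //; rewrite ?pz //.
    by rewrite Es ED size_rcons /=; slia.
  by rewrite -Ez /hookw -catA.
rewrite Ey1 /= nx1 nx2 e_bar_noprime //=; case: (m =P 2) => [m2|nm2].
  have U2 : all (leq 2) U by apply: sub_all mU => t /=; slia.
  rewrite first1_plc // set1_plc //= => -[Ez].
  exists (hookw (x :: D) 1 U (odflt mu (first1 rest)) ++ set1 mu rest).
    rewrite Ey1' /= nx1 nx2 e_bar_noprime //= m2 /= first1_plc // set1_plc // /hookw.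
    by rewrite /= -catA.
  apply: (@Append2 _ _ _ _ x al D 1 U (odflt mu (first1 rest)) (set1 mu rest)) => //; rewrite ?pz //.
    by apply: hookV_down ok; slia.
  by rewrite -Ez /hookw -catA.
case: (m =P 1) => // nm1; have U3 : all (leq 3) U by apply: sub_all mU => t /=; slia.
rewrite e_bar_noprime //; case e: (e_bar rest) => [u|] //= [Ez].
exists (hookw (x :: D) m U mu ++ u).
  rewrite Ey1' /= nx1 nx2 e_bar_noprime //= (introF eqP nm1) (introF eqP nm2) e_bar_noprime // e /= /hookw.
  by rewrite /= -catA.
by apply: (@Append2 _ _ _ _ x al D m U mu u) => //; rewrite ?pz // -Ez /hookw -catA.
Qed.

(** * Bumping: operators of index 0 and bar 1 *)

Lemma bumpable_x x' x A b M c N : bumpable x A b [::] M c N -> x' <= x -> bumpable x' A b [::] M c N.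
Proof. by move=> [[h1 h2 h3] h4] h; split=> //; split=> //; apply: leq_trans h h2. Qed.

Lemma sorted_gtn_down A m m' : m' <= m -> sorted gtn (rcons A m) -> sorted gtn (rcons A m').
Proof.
by move=> h; rewrite !sorted_gtn_rcons => /andP[h1 ->]; rewrite (sub_all _ h1) // => z /=; lia.
Qed.

Lemma bumpable_c c' x A b C c N : bumpable x A b C [::] c N -> c' <= c -> bumpable x A b C [::] c' N.
Proof.
move=> [[h1 h2 h3] [h4 h5 h6]] h; split; split=> //=; last first.
- by apply: leq_ltn_trans h h5.
- by case: N h4 {h6} => //= n N /andP[h4 ->]; rewrite (leq_trans h h4).
by move: h1; rewrite -!rcons_cons -!rcons_cat; apply: sorted_gtn_down.
Qed.

Lemma bumpable_m m' x A b C m M c N :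
  bumpable x A b C (m :: M) c N -> m' <= m -> bumpable x A b C (m' :: M) c N.
Proof.
move=> [[h1 h2 h3] [h4 h5 h6]] h; split; split=> //=; last first.
  by move: h4 => /=; case: (M ++ _) => //= n N' /andP[h4 ->]; rewrite (leq_trans h h4).
by move: h1; rewrite -!rcons_cons -!rcons_cat; apply: sorted_gtn_down.
Qed.

(** For the case that the last letter of the decreasing part is lowered from 2 to 1: it becomes the
    front of the increasing part, with the same value as the old middle [head c M]. *)
Lemma bumpable_drop x A b C l M c N :
  bumpable x A b (rcons C l) M c N -> bumpable x A b C (head c M :: M) c N.
Proof.
move=> ok; have F := bumpable_facts ok; move: ok => [[h1 h2 h3] [h4 h5 h6]]; split; split=> //=.
- apply: (subseq_sorted gtn_trans _ h1); apply: cat_subseq; first exact: subseq_refl.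
  rewrite /= eqxx -!cats1 -catA; apply: cat_subseq; first exact: subseq_refl.
  exact: (suffix_subseq [:: l]).
- by move: h3; rewrite all_rcons => /andP[].
- by case: M h4 {h1 F} => //= [|m M] ->; rewrite leqnn.
Qed.

Lemma bump_rel_form1 s y y' x al A b c N mu rest : bumpable x A b [::] [::] c N ->
  s = size A + size N + 2 -> posw y ->
  y = (x, al) :: noprime A ++ (b, false) :: (c, mu) :: noprime N ++ rest ->
  y' = noprime A ++ (x, al) :: (b, false) :: noprime N ++ (c, mu) :: rest -> bump_rel s y y'.
Proof.
move=> ok Es py Ey Ey'; apply: (@BumpIntro _ _ _ x al A b [::] [::] c N mu rest) => //.
- by rewrite Es /=; lia.
- by rewrite Ey /bump_in /hookw ?noprime_cat /= -?catA /= -?catA.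
by rewrite Ey' /bump_out /hookw /= cats0 -?catA /= -?catA.
Qed.

Lemma bump_rel_form2 s y y' x al A b C l c N mu rest : bumpable x A b (rcons C l) [::] c N ->
  s = size A + size C + size N + 3 -> posw y ->
  y = (x, al) :: noprime A ++ (b, false) :: noprime C ++ (l, false) :: (c, mu) :: noprime N ++ rest ->
  y' = noprime A ++ (x, false) :: noprime C ++ (l, al) :: (b, false) :: noprime N ++ (c, mu) :: rest -> bump_rel s y y'.
Proof.
move=> ok Es py Ey Ey'; apply: (@BumpIntro _ _ _ x al A b (rcons C l) [::] c N mu rest) => //.
- by rewrite Es size_rcons /=; lia.
- by rewrite Ey /bump_in /hookw noprime_cat /= /noprime map_rcons -?catA /= cat_rcons.
rewrite Ey' /bump_out /hookw last_rcons belast_rcons /= noprime_cat /= -?catA /= -?catA /=.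
by [].
Qed.

Lemma bump_rel_form3 s y y' x al A b m M c N mu rest : bumpable x A b [::] (m :: M) c N -> x <= m ->
  s = size A + size M + size N + 3 -> posw y ->
  y = (x, al) :: noprime A ++ (b, false) :: (m, mu) :: noprime M ++ (c, false) :: noprime N ++ rest ->
  y' = noprime A ++ (x, al) :: (m, false) :: noprime M ++ (b, false) :: noprime N ++ (c, mu) :: rest -> bump_rel s y y'.
Proof.
move=> ok xm Es py Ey Ey'; apply: (@BumpIntro _ _ _ x al A b [::] (m :: M) c N mu rest) => //.
- by rewrite Es /=; lia.
- by rewrite Ey /bump_in /hookw /= ?noprime_cat /= -?catA /= ?noprime_cat /= -?catA /= -?catA.
by rewrite Ey' /bump_out /hookw xm /= ?noprime_cat /= -?catA /= -?catA.
Qed.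

Lemma bump_rel_form4 s y y' x al A b C m M c N mu rest : bumpable x A b C (m :: M) c N -> m < x ->
  s = size A + size C + size M + size N + 3 -> posw y ->
  y = (x, al) :: noprime A ++ (b, false) :: noprime C ++ (m, mu) :: noprime M ++ (c, false) :: noprime N ++ rest ->
  y' = noprime A ++ (x, false) :: noprime C ++ (m, mu) :: noprime M ++ (b, false) :: noprime N ++ (c, al) :: rest ->
  bump_rel s y y'.
Proof.
move=> ok xm Es py Ey Ey'; apply: (@BumpIntro _ _ _ x al A b C (m :: M) c N mu rest) => //.
- by rewrite Es /=; lia.
- by rewrite Ey /bump_in /hookw /= ?noprime_cat /= -?catA /= ?noprime_cat /= -?catA /= -?catA.
by rewrite Ey' /bump_out leqNgt xm /= /hookw ?noprime_cat /= -?catA /= -?catA /= -?catA.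
Qed.

(** The hook words are written out so that [e_bar], [first1] and [set1] can be computed by
    rewriting. If M is empty, the last letter of a nonempty C has to be displayed, because it
    becomes the new middle. *)
Inductive bump_rel_case (s : nat) (y y' : word) : Prop :=
| BumpCase1 x al A b c N mu rest of bumpable x A b [::] [::] c N & s = size A + size N + 2 &
  y = (x, al) :: noprime A ++ (b, false) :: (c, mu) :: noprime N ++ rest &
  y' = noprime A ++ (x, al) :: (b, false) :: noprime N ++ (c, mu) :: rest
| BumpCase2 x al A b C l c N mu rest of bumpable x A b (rcons C l) [::] c N &
  s = size A + size C + size N + 3 &
  y = (x, al) :: noprime A ++ (b, false) :: noprime C ++ (l, false) :: (c, mu) :: noprime N ++ rest &
  y' = noprime A ++ (x, false) :: noprime C ++ (l, al) :: (b, false) :: noprime N ++ (c, mu) :: rest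
| BumpCase3 x al A b m M c N mu rest of bumpable x A b [::] (m :: M) c N & x <= m &
  s = size A + size M + size N + 3 &
  y = (x, al) :: noprime A ++ (b, false) :: (m, mu) :: noprime M ++ (c, false) :: noprime N ++ rest &
  y' = noprime A ++ (x, al) :: (m, false) :: noprime M ++ (b, false) :: noprime N ++ (c, mu) :: rest
| BumpCase4 x al A b C m M c N mu rest of bumpable x A b C (m :: M) c N & m < x &
  s = size A + size C + size M + size N + 3 &
  y = (x, al) :: noprime A ++ (b, false) :: noprime C ++ (m, mu) :: noprime M ++ (c, false) :: noprime N ++ rest &
  y' = noprime A ++ (x, false) :: noprime C ++ (m, mu) :: noprime M ++ (b, false) :: noprime N ++ (c, al) :: rest.

Lemma bump_rel_cases s y y' : bump_rel s y y' -> posw y /\ bump_rel_case s y y'.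
Proof.
case=> x al A b C M c N mu rest ok Es py Ey Ey'; split=> //.
case: M ok Es Ey Ey' => [|m M] ok Es Ey Ey'.
  case/lastP: C ok Es Ey Ey' => [|C l] ok Es Ey Ey'.
    apply: (@BumpCase1 _ _ _ x al A b c N mu rest) => //.
    - by rewrite Es /=; lia.
    - by rewrite Ey /bump_in /hookw ?noprime_cat /= -?catA /= -?catA.
    by rewrite Ey' /bump_out /hookw /= cats0 -?catA /= -?catA.
  apply: (@BumpCase2 _ _ _ x al A b C l c N mu rest) => //.
  - by rewrite Es size_rcons /=; lia.
  - by rewrite Ey /bump_in /hookw noprime_cat /= /noprime map_rcons -?catA /= cat_rcons.
  by rewrite Ey' /bump_out /hookw last_rcons belast_rcons /= noprime_cat /= -?catA /= -?catA /=.
case: (leqP x m) => xm.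
  have C0 := flagged_C ok xm; subst C.
  apply: (@BumpCase3 _ _ _ x al A b m M c N mu rest) => //.
  - by rewrite Es /=; lia.
  - by rewrite Ey /bump_in /hookw /= ?noprime_cat /= -?catA /= ?noprime_cat /= -?catA /= -?catA.
  by rewrite Ey' /bump_out /hookw xm /= ?noprime_cat /= -?catA /= -?catA.
apply: (@BumpCase4 _ _ _ x al A b C m M c N mu rest) => //.
- by rewrite Es /=; lia.
- by rewrite Ey /bump_in /hookw /= ?noprime_cat /= -?catA /= ?noprime_cat /= -?catA /= -?catA.
by rewrite Ey' /bump_out leqNgt xm /= /hookw ?noprime_cat /= -?catA /= -?catA /= -?catA.
Qed.

Ltac clia := repeat match goal with
  | H : @eq (list _) _ _ |- _ => clear H
  | H : @eq (option _) _ _ |- _ => clear H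
  | H : is_true (all _ _) |- _ => clear H
  | H : is_true (posw _) |- _ => clear H
  | H : bumpable _ _ _ _ _ _ _ |- _ => clear H
  | H : bump_facts _ _ _ _ _ _ _ |- _ => clear H
  | H : forall _, _ |- _ => clear H
  end; lia.

Ltac neq := repeat match goal with
  | |- context [@eq_op ?T ?a ?b] =>
      first [rewrite (_ : @eq_op T a b = false); last by clia
            | rewrite (_ : @eq_op T a b = true); last by clia]
  end.

Ltac red1 := repeat (first
  [ progress (cbn [first1 set1 first12 e_bar fst snd]; neq)
  | rewrite first1_plc; last assumption
  | rewrite set1_plc; last assumption
  | rewrite first12_plc; last assumption
  | rewrite e_bar_noprime; last assumption ]); try by [].

Lemma all_weak (p q : nat) s : q <= p -> all (leq p) s -> all (leq q) s.
Proof. by move=> h; apply: sub_all => z /=; lia. Qed.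

Lemma all_gt_le (p q : nat) s : q <= p.+1 -> all (ltn p) s -> all (leq q) s.
Proof. by move=> h; apply: sub_all => z /=; lia. Qed.

Lemma posw_mem y (z : letter) : posw y -> z \in y -> 0 < z.1.
Proof. by move/allP => h /h. Qed.

Ltac memt := rewrite !(inE, mem_cat) eqxx ?orbT.

Lemma bump_rel_12 s y y' : bump_rel s y y' -> [/\ first1 y' = first1 y, first12 y' = first12 y
     & forall b, bump_rel s (set1 b y) (set1 b y')].
Proof.
move=> /bump_rel_cases [py]; have pyb t : posw (set1 t y) by rewrite set1_pos.
case.
- move=> x al A b c N mu rest ok Es Ey Ey'; have F := bumpable_facts ok.
  move: (f_cb F) (f_xb F) => cb xb.
  have x0 : 0 < x by apply: (@posw_mem y (x, al)); rewrite // Ey; memt.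
  have c0 : 0 < c by apply: (@posw_mem y (c, mu)); rewrite // Ey; memt.
  have A3 : all (leq 3) A by apply: all_gt_le (f_Ab F); lia.
  have A2 : all (leq 2) A by apply: all_weak A3.
  have N2 : all (leq 2) N by apply: all_weak (f_bN F); lia.
  have [x1|x1] := eqVneq x 1.
    split; [by rewrite Ey Ey'; red1 | by rewrite Ey Ey'; red1 | move=> t].
    by apply: (@bump_rel_form1 _ _ _ 1 t A b c N mu rest) => //; [rewrite -x1|rewrite Ey; red1|rewrite Ey'; red1].
  split; first by rewrite Ey Ey'; red1; case: (c =P 1) => h; red1.
    rewrite Ey Ey'; case: (x =P 2) => h; red1.
    have N3 : all (leq 3) N by apply: all_weak (f_bN F); lia.
    by red1.
  move=> t; have [c1|c1] := eqVneq c 1.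
    by apply: (@bump_rel_form1 _ _ _ x al A b 1 N t rest) => //; [rewrite -c1|rewrite Ey; red1|rewrite Ey'; red1].
  by apply: (@bump_rel_form1 _ _ _ x al A b c N mu (set1 t rest)) => //; [rewrite Ey; red1|rewrite Ey'; red1].
- move=> x al A b C l c N mu rest ok Es Ey Ey'; have F := bumpable_facts ok.
  move: (f_cb F) (f_xb F) => cb xb.
  have c0 : 0 < c by apply: (@posw_mem y (c, mu)); rewrite // Ey; memt.
  have /andP[lx _] : (l < x) && all (gtn x) C by have := f_xC F; rewrite all_rcons.
  have /andP[cl _] : (c < l) && all (ltn c) C by have := f_mC F; rewrite all_rcons.
  have x3 : 3 <= x by lia.
  have A3 : all (leq 3) A by apply: all_gt_le (f_Ab F); lia.
  have A2 : all (leq 2) A by apply: all_weak A3.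
  have N3 : all (leq 3) N by apply: all_weak (f_bN F); lia.
  have N2 : all (leq 2) N by apply: all_weak N3.
  have C3 : all (leq 3) C.
    have := f_C F; rewrite sorted_gtn_rcons => /andP[h _]; apply: all_gt_le h; lia.
  have C2 : all (leq 2) C by apply: all_weak C3.
  split; first by rewrite Ey Ey'; red1; case: (c =P 1) => h; red1.
    rewrite Ey Ey'; red1; case: (l =P 2) => h; red1.
  move=> t; have [c1|c1] := eqVneq c 1.
    by apply: (@bump_rel_form2 _ _ _ x al A b C l 1 N t rest) => //; [rewrite -c1|rewrite Ey; red1|rewrite Ey'; red1].
  by apply: (@bump_rel_form2 _ _ _ x al A b C l c N mu (set1 t rest)) => //; [rewrite Ey; red1|rewrite Ey'; red1].
- move=> x al A b m M c N mu rest ok xm Es Ey Ey'; have F := bumpable_facts ok.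
  move: (f_cb F) (f_xb F) (f_mc F) => /= cb xb mc.
  have x0 : 0 < x by apply: (@posw_mem y (x, al)); rewrite // Ey; memt.
  have A3 : all (leq 3) A by apply: all_gt_le (f_Ab F); lia.
  have A2 : all (leq 2) A by apply: all_weak A3.
  have [x1|x1] := eqVneq x 1.
    split; [by rewrite Ey Ey'; red1 | by rewrite Ey Ey'; red1 | move=> t].
    by apply: (@bump_rel_form3 _ _ _ 1 t A b m M c N mu rest) => //; [rewrite -x1|rewrite -x1|rewrite Ey; red1|rewrite Ey'; red1].
  have M2 : all (leq 2) M by have /andP[_ h] := f_mM F; apply: all_weak h => /=; lia.
  have N2 : all (leq 2) N by apply: all_weak (f_bN F); lia.
  split; first by rewrite Ey Ey'; red1.
    rewrite Ey Ey'; case: (x =P 2) => h; red1.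
    have M3 : all (leq 3) M by have /andP[_ h'] := f_mM F; apply: all_weak h' => /=; lia.
    have N3 : all (leq 3) N by apply: all_weak (f_bN F); lia.
    by red1.
  by move=> t; apply: (@bump_rel_form3 _ _ _ x al A b m M c N mu (set1 t rest)) => //; [rewrite Ey; red1|rewrite Ey'; red1].
move=> x al A b C m M c N mu rest ok xm Es Ey Ey'; have F := bumpable_facts ok.
move: (f_cb F) (f_xb F) (f_mc F) => /= cb xb mc.
have m0 : 0 < m by apply: (@posw_mem y (m, mu)); rewrite // Ey; memt.
have A3 : all (leq 3) A by apply: all_gt_le (f_Ab F); lia.
have A2 : all (leq 2) A by apply: all_weak A3.
have C2 : all (leq 2) C by apply: all_gt_le (f_mC F) => /=; lia.
have N2 : all (leq 2) N by apply: all_weak (f_bN F); lia.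
split.
- rewrite Ey Ey'; red1; case: (m =P 1) => h; red1.
  have M2 : all (leq 2) M by have /andP[_ h'] := f_mM F; apply: all_weak h' => /=; lia.
  by red1.
- rewrite Ey Ey'; case: (x =P 2) => h; red1.
  have N3 : all (leq 3) N by apply: all_weak (f_bN F); lia.
  case: (dec_last2 (f_C F) C2) => [C3|[C' [EC C3 _]]]; last first.
    by rewrite EC /noprime map_rcons !cat_rcons -/(noprime _); red1.
  red1.
  case: (m =P 2) => m2; red1; case: (m =P 1) => m1; red1.
  have M3 : all (leq 3) M by have /andP[_ h'] := f_mM F; apply: all_weak h' => /=; lia.
  by red1.
move=> t; have [m1|m1] := eqVneq m 1.
  by apply: (@bump_rel_form4 _ _ _ x al A b C 1 M c N t rest) => //; [rewrite -m1|rewrite -m1|rewrite Ey; red1|rewrite Ey'; red1].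
have M2 : all (leq 2) M by have /andP[_ h'] := f_mM F; apply: all_weak h' => /=; lia.
by apply: (@bump_rel_form4 _ _ _ x al A b C m M c N mu (set1 t rest)) => //; [rewrite Ey; red1|rewrite Ey'; red1].
Qed.

(** Besides changing letters, [e_bar] can turn one shape of a bump into another: the second into the
    fourth when l = 2, the fourth into the third when x = 2. In both cases the bits that [e_bar]
    swaps are [al] and [mu], on one side or the other, which matches the change of rule. *)
Lemma bump_rel_e_bar s y y' z : bump_rel s y y' -> e_bar y = Some z ->
  exists2 z', e_bar y' = Some z' & bump_rel s z z'.
Proof.
move=> /bump_rel_cases [py yy'] e; have pz : posw z by rewrite (e_bar_pos e).
move: e; case: yy'.
- move=> x al A b c N mu rest ok Es Ey Ey'; have F := bumpable_facts ok.
  move: (f_cb F) (f_xb F) => cb xb.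
  have x0 : 0 < x by apply: (@posw_mem y (x, al)); rewrite // Ey; memt.
  have c0 : 0 < c by apply: (@posw_mem y (c, mu)); rewrite // Ey; memt.
  have A3 : all (leq 3) A by apply: all_gt_le (f_Ab F); lia.
  have A2 : all (leq 2) A by apply: all_weak A3.
  have N2 : all (leq 2) N by apply: all_weak (f_bN F); lia.
  rewrite Ey; case: (x =P 1) => [x1|x1]; first by red1.
  case: (x =P 2) => [x2|x2].
    have ok1 := bumpable_x (x' := 1) ok x0.
    case: (c =P 1) => [c1|c1]; red1; move=> [Ez].
      exists (noprime A ++ (1, mu) :: (b, false) :: noprime N ++ (1, al) :: rest).
        by rewrite Ey'; red1.
      by subst c; apply: (@bump_rel_form1 _ _ _ 1 mu A b 1 N al rest).
    exists (noprime A ++ (1, odflt al (first1 rest)) :: (b, false) :: noprime N ++ (c, mu) :: set1 al rest).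
      by rewrite Ey'; red1.
    by apply: (@bump_rel_form1 _ _ _ 1 (odflt al (first1 rest)) A b c N mu (set1 al rest)).
  have N3 : all (leq 3) N by apply: all_weak (f_bN F); lia.
  case: (c =P 1) => [c1|c1]; first by red1.
  case: (c =P 2) => [c2|c2]; red1.
    move=> [Ez].
    exists (noprime A ++ (x, al) :: (b, false) :: noprime N ++ (1, odflt mu (first1 rest)) :: set1 mu rest).
      by rewrite Ey'; red1.
    apply: (@bump_rel_form1 _ _ _ x al A b 1 N (odflt mu (first1 rest)) (set1 mu rest)) => //.
    by apply: bumpable_c ok _; lia.
  case e: (e_bar rest) => [u|] //= [Ez].
  exists (noprime A ++ (x, al) :: (b, false) :: noprime N ++ (c, mu) :: u).
    by rewrite Ey'; red1; rewrite e.
  by apply: (@bump_rel_form1 _ _ _ x al A b c N mu u).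
- move=> x al A b C l c N mu rest ok Es Ey Ey'; have F := bumpable_facts ok.
  move: (f_cb F) (f_xb F) => cb xb.
  have c0 : 0 < c by apply: (@posw_mem y (c, mu)); rewrite // Ey; memt.
  have /andP[lx _] : (l < x) && all (gtn x) C by have := f_xC F; rewrite all_rcons.
  have /andP[cl _] : (c < l) && all (ltn c) C by have := f_mC F; rewrite all_rcons.
  have x3 : 3 <= x by lia.
  have A3 : all (leq 3) A by apply: all_gt_le (f_Ab F); lia.
  have A2 : all (leq 2) A by apply: all_weak A3.
  have N3 : all (leq 3) N by apply: all_weak (f_bN F); lia.
  have N2 : all (leq 2) N by apply: all_weak N3.
  have C3 : all (leq 3) C.
    have := f_C F; rewrite sorted_gtn_rcons => /andP[h _]; apply: all_gt_le h; lia.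
  have C2 : all (leq 2) C by apply: all_weak C3.
  rewrite Ey; case: (l =P 2) => [l2|l2].
    have c1 : c = 1 by lia.
    subst l c; red1; move=> [Ez].
    exists (noprime A ++ (x, false) :: noprime C ++ (1, mu) :: (b, false) :: noprime N ++ (1, al) :: rest).
      by rewrite Ey'; red1.
    apply: (@bump_rel_form4 _ _ _ x al A b C 1 [::] 1 N mu rest) => //; [exact: (bumpable_drop ok)|lia|rewrite Es /=; lia].
  case: (c =P 1) => [c1|c1]; first by red1.
  case: (c =P 2) => [c2|c2]; red1.
    move=> [Ez].
    exists (noprime A ++ (x, false) :: noprime C ++ (l, al) :: (b, false) :: noprime N ++ (1, odflt mu (first1 rest)) :: set1 mu rest).
      by rewrite Ey'; red1.
    apply: (@bump_rel_form2 _ _ _ x al A b C l 1 N (odflt mu (first1 rest)) (set1 mu rest)) => //.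
    by apply: bumpable_c ok _; lia.
  case e: (e_bar rest) => [u|] //= [Ez].
  exists (noprime A ++ (x, false) :: noprime C ++ (l, al) :: (b, false) :: noprime N ++ (c, mu) :: u).
    by rewrite Ey'; red1; rewrite e.
  by apply: (@bump_rel_form2 _ _ _ x al A b C l c N mu u).
- move=> x al A b m M c N mu rest ok xm Es Ey Ey'; have F := bumpable_facts ok.
  move: (f_cb F) (f_xb F) (f_mc F) => /= cb xb mc.
  have x0 : 0 < x by apply: (@posw_mem y (x, al)); rewrite // Ey; memt.
  have A3 : all (leq 3) A by apply: all_gt_le (f_Ab F); lia.
  have A2 : all (leq 2) A by apply: all_weak A3.
  rewrite Ey; case: (x =P 1) => [x1|x1]; first by red1.
  have M2 : all (leq 2) M by have /andP[_ h] := f_mM F; apply: all_weak h => /=; lia.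
  have N2 : all (leq 2) N by apply: all_weak (f_bN F); lia.
  case: (x =P 2) => [x2|x2].
    red1; move=> [Ez].
    exists (noprime A ++ (1, odflt al (first1 rest)) :: (m, false) :: noprime M ++ (b, false) :: noprime N ++ (c, mu) :: set1 al rest).
      by rewrite Ey'; red1.
    apply: (@bump_rel_form3 _ _ _ 1 (odflt al (first1 rest)) A b m M c N mu (set1 al rest)) => //; last by lia.
    exact: (bumpable_x ok).
  have M3 : all (leq 3) M by have /andP[_ h'] := f_mM F; apply: all_weak h' => /=; lia.
  have N3 : all (leq 3) N by apply: all_weak (f_bN F); lia.
  red1; case e: (e_bar rest) => [u|] //= [Ez].
  exists (noprime A ++ (x, al) :: (m, false) :: noprime M ++ (b, false) :: noprime N ++ (c, mu) :: u).
    by rewrite Ey'; red1; rewrite e.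
  by apply: (@bump_rel_form3 _ _ _ x al A b m M c N mu u).
move=> x al A b C m M c N mu rest ok xm Es Ey Ey'; have F := bumpable_facts ok.
move: (f_cb F) (f_xb F) (f_mc F) => /= cb xb mc.
have m0 : 0 < m by apply: (@posw_mem y (m, mu)); rewrite // Ey; memt.
have A3 : all (leq 3) A by apply: all_gt_le (f_Ab F); lia.
have A2 : all (leq 2) A by apply: all_weak A3.
have C2 : all (leq 2) C by apply: all_gt_le (f_mC F) => /=; lia.
have N2 : all (leq 2) N by apply: all_weak (f_bN F); lia.
rewrite Ey; case: (x =P 2) => [x2|x2].
  have m1 : m = 1 by lia.
  have C0 : C = [::].
    by move: (f_mC F) (f_xC F); rewrite x2 m1; case: (C) => //= d C' /andP[h1 _] /andP[h2 _]; clear -h1 h2; lia.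
  subst C m; red1; move=> [Ez].
  exists (noprime A ++ (1, mu) :: (1, false) :: noprime M ++ (b, false) :: noprime N ++ (c, al) :: rest).
    by rewrite Ey'; red1.
  apply: (@bump_rel_form3 _ _ _ 1 mu A b 1 M c N al rest) => //; last by rewrite Es /=; lia.
  by apply: (bumpable_x ok); lia.
have N3 : all (leq 3) N by apply: all_weak (f_bN F); lia.
case: (dec_last2 (f_C F) C2) => [C3|[C' [EC C3 _]]]; last first.
  have C2' : all (leq 2) C' by apply: all_weak C3.
  have m1 : m = 1.
    have := f_mC F; rewrite EC all_rcons => /andP[/= h _]; clear -h m0; lia.
  subst C m; rewrite /noprime map_rcons cat_rcons -!/(noprime _); red1; move=> [Ez].
  exists (noprime A ++ (x, false) :: noprime C' ++ (1, mu) :: (1, false) :: noprime M ++ (b, false) :: noprime N ++ (c, al) :: rest).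
    by rewrite Ey' /noprime map_rcons cat_rcons -!/(noprime _); red1.
  apply: (@bump_rel_form4 _ _ _ x al A b C' 1 (1 :: M) c N mu rest) => //; last by rewrite Es size_rcons /=; lia.
  exact: (bumpable_drop ok).
case: (m =P 2) => [m2|m2].
  have M2 : all (leq 2) M by have /andP[_ h'] := f_mM F; apply: all_weak h' => /=; lia.
  red1; move=> [Ez].
  exists (noprime A ++ (x, false) :: noprime C ++ (1, odflt mu (first1 rest)) :: noprime M ++ (b, false) :: noprime N ++ (c, al) :: set1 mu rest).
    by rewrite Ey'; red1.
  apply: (@bump_rel_form4 _ _ _ x al A b C 1 M c N (odflt mu (first1 rest)) (set1 mu rest)) => //; last by lia.
  by apply: bumpable_m ok _; lia.
case: (m =P 1) => [m1|m1]; first by red1.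
have M3 : all (leq 3) M by have /andP[_ h'] := f_mM F; apply: all_weak h' => /=; lia.
red1; case e: (e_bar rest) => [u|] //= [Ez].
exists (noprime A ++ (x, false) :: noprime C ++ (m, mu) :: noprime M ++ (b, false) :: noprime N ++ (c, al) :: u).
  by rewrite Ey'; red1; rewrite e.
by apply: (@bump_rel_form4 _ _ _ x al A b C m M c N mu u).
Qed.

(** * Row steps and the operators of positive index *)

Lemma option_rel_e_word R i y y' :
  (en i.+1 (unzip1 y) = None -> en i.+1 (unzip1 y') = None) ->
  (forall z, e_word i.+1 y = Some z -> exists2 z', e_word i.+1 y' = Some z' & R z z') ->
  option_rel R (e_word i.+1 y) (e_word i.+1 y').
Proof.
move=> h1 h2; case e: (e_word i.+1 y) => [z|]; first by have [z' -> r] := h2 _ e.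
have -> // : e_word i.+1 y' = None.
by rewrite /e_word h1 //; move: e; rewrite /e_word; case: (en _ _).
Qed.

(** The letters commute by [bump_comm]. As for bits, e_i moves none, and those of the output are a
    function of q, r, the input bits and the flag, which is a descent of the output. *)
Lemma bump_rel_e_word s y y' i : bump_rel s y y' -> phi i (unzip1 y') = phi i (unzip1 y) /\
  option_rel (bump_rel s) (e_word i.+1 y) (e_word i.+1 y').
Proof.
case=> x al A b C M c N mu rest ok Es py Ey Ey'.
set q := size A + size C; set r := size M + size N.
have u1 : unzip1 y' = bump q r (unzip1 y).
  by rewrite Ey Ey' unzip1_bump_out // unzip1_bump_in bumpable_bump.
have dd : bump_des q r (unzip1 y) by rewrite Ey unzip1_bump_in; apply: bumpable_bump_des.
have [_ E] := bump_comm i.+1 dd; have [P _] := bump_comm i dd; rewrite -u1 in P E.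
split=> //; apply: option_rel_e_word => //; first by rewrite E => ->.
move=> z ez; have pz : posw z by rewrite (posw_op_e (i := Idx i.+1) ez).
have [e1 e2] := e_word_unzip ez.
have [x2 [A2 [b2 [C2 [M2 [c2 [N2 [s2 [Ez ok2 sq sr]]]]]]]]] := bump_des_bumpable (bump_des_en e1 dd).
have sz : size s2 = size (unzip2 rest).
  have := congr1 size Ez; have := en_size e1; rewrite Ey unzip1_bump_in => -> /=.
  by rewrite !size_cat /= !size_cat /= !size_cat /= !size_map; rewrite /q /r in sq sr; lia.
have Ez' : z = bump_in x2 al A2 b2 C2 M2 c2 N2 mu (zip s2 (unzip2 rest)).
  apply: word_ext; first by rewrite unzip1_bump_in unzip1_zip ?sz // Ez.
  by rewrite e2 Ey !unzip2_bump_in unzip2_zip ?sz // sq sr.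
exists (bump_out x2 al A2 b2 C2 M2 c2 N2 mu (zip s2 (unzip2 rest))); last first.
  by apply: (@BumpIntro _ _ _ x2 al A2 b2 C2 M2 c2 N2 mu (zip s2 (unzip2 rest))) => //;
     rewrite Es /q /r in sq sr *; lia.
have EE : en i.+1 (unzip1 y') = Some (unzip1 (bump_out x2 al A2 b2 C2 M2 c2 N2 mu (zip s2 (unzip2 rest)))).
  by rewrite E e1 /= Ez unzip1_bump_out // unzip1_zip ?sz // -sq -sr bumpable_bump.
apply: e_word_intro => //.
rewrite unzip2_bump_out // Ey' unzip2_bump_out // unzip2_zip ?sz // sq sr; congr bump_bits.
have := en_descents EE; rewrite unzip1_bump_out // Ey' unzip1_bump_out // => /(congr1 (fun l => nth false l q)).
rewrite (flagged_descents _ ok); rewrite -[in LHS]sq (flagged_descents _ ok2).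
by move/(congr1 negb); rewrite !negbK.
Qed.

Lemma en_hookV i D m U (w v : seq nat) : hookV D m U -> en i (D ++ m :: U ++ w) = Some v ->
  exists D' m' U' w', [/\ v = D' ++ m' :: U' ++ w', hookV D' m' U', size D' = size D, size U' = size U
    & size w' = size w].
Proof.
move=> ok e.
have sv := en_size e; have dv := en_descents e.
set k := (size D + size U).+1.
have sw : size (D ++ m :: U) = k by rewrite size_cat /= addnS.
have dt : descents (take k v) = nseq (size D) true ++ nseq (size U) false.
  rewrite descents_take dv -descents_take -/k -cat_cons catA take_size_cat //.
  exact: hookV_descents.
have sk : size (take k v) = k.
  by rewrite size_takel // sv -cat_cons catA size_cat sw leq_addr.
have t0 : take k v != [::] by case: (take k v) sk.
have [D' [m' [U' [E sD sU ok']]]] := descents_hookV t0 dt.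
exists D', m', U', (drop k v); split=> //.
  by rewrite -cat_cons catA -E cat_take_drop.
by rewrite size_drop sv -cat_cons catA size_cat sw addKn.
Qed.

Lemma unzip1_hookw_cat D m U mu rest : unzip1 (hookw D m U mu ++ rest) = D ++ m :: U ++ unzip1 rest.
Proof. by rewrite unzip1_cat unzip1_hookw -catA. Qed.

Lemma unzip2_hookw_cat D m U mu rest : unzip2 (hookw D m U mu ++ rest) =
  nseq (size D) false ++ mu :: nseq (size U) false ++ unzip2 rest.
Proof. by rewrite unzip2_cat unzip2_hookw -catA. Qed.

Lemma unzip1_cons_hookw x al D m U mu rest : unzip1 ((x, al) :: hookw D m U mu ++ rest) =
  x :: D ++ m :: U ++ unzip1 rest.
Proof. by rewrite -(unzip1_hookw_cat D m U mu). Qed.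

Lemma unzip2_cons_hookw x al D m U mu rest : unzip2 ((x, al) :: hookw D m U mu ++ rest) =
  al :: nseq (size D) false ++ mu :: nseq (size U) false ++ unzip2 rest.
Proof. by rewrite -(unzip2_hookw_cat D m U mu). Qed.

(** Appending leaves the letters of the word as they are and only redistributes bits; what has to be
    seen is that the hook formed by x and the row persists. *)
Lemma append_rel_e_word s o y y' i : append_rel s o y y' -> phi i (unzip1 y') = phi i (unzip1 y) /\
  option_rel (append_rel s o) (e_word i.+1 y) (e_word i.+1 y').
Proof.
case.
- move=> x al rest s0 o0 py Ey ->; split=> //; case e: (e_word _ _) => [z|] //=.
  have := e_size (i := Idx i.+1) e; rewrite Ey; case: z e => [|[x' al'] z] e // _.
  by apply: (@Append0 _ _ _ _ x' al' z) => //; rewrite (posw_op_e (i := Idx i.+1) e).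
- move=> x al m U mu rest xm ok Es Eo py Ey Ey'.
  have u1 : unzip1 y' = unzip1 y by rewrite Ey Ey' unzip1_cons_hookw unzip1_hookw_cat.
  split; first by rewrite u1.
  apply: option_rel_e_word; rewrite ?u1 // => z ez.
  have pz : posw z by rewrite (posw_op_e (i := Idx i.+1) ez).
  have [e1 e2] := e_word_unzip ez.
  have ok2 : hookV [::] x (m :: U) by move: ok; rewrite !hookVE /= xm.
  have Eu : unzip1 y = [::] ++ x :: (m :: U) ++ unzip1 rest by rewrite Ey unzip1_cons_hookw.
  rewrite Eu in e1; have [D' [x' [U' [w' [Ez okz sD sU sw]]]]] := en_hookV ok2 e1.
  move/size0nil: sD => D0; subst D'; case: U' sU Ez okz => [|m' U'] //= [sU] Ez okz.
  have sw2 : size w' = size (unzip2 rest) by rewrite sw !size_map.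
  have okm : hookV [::] m' U' by move: okz; rewrite !hookVE /= => /andP[].
  have xm' : x' <= m' by move: okz; rewrite !hookVE /= => /andP[].
  exists (hookw [::] x' (m' :: U') al ++ zip w' (unzip2 rest)).
    apply: e_word_intro.
      by rewrite u1 Eu e1 Ez unzip1_hookw_cat unzip1_zip ?sw2.
    by rewrite Ey' !unzip2_hookw_cat /= unzip2_zip ?sw2 // sU.
  apply: (@Append1 _ _ _ _ x' al m' U' mu (zip w' (unzip2 rest))) => //; first by rewrite Es sU.
  apply: word_ext; first by rewrite Ez unzip1_cons_hookw unzip1_zip ?sw2.
  by rewrite e2 Ey !unzip2_cons_hookw unzip2_zip ?sw2 //= sU.
move=> x al D m U mu rest ok Es Eo py Ey Ey'.
have u1 : unzip1 y' = unzip1 y by rewrite Ey Ey' unzip1_cons_hookw unzip1_hookw_cat.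
split; first by rewrite u1.
apply: option_rel_e_word; rewrite ?u1 // => z ez.
have pz : posw z by rewrite (posw_op_e (i := Idx i.+1) ez).
have [e1 e2] := e_word_unzip ez.
have Eu : unzip1 y = (x :: D) ++ m :: U ++ unzip1 rest by rewrite Ey unzip1_cons_hookw.
rewrite Eu in e1; have [D' [m' [U' [w' [Ez okz sD sU sw]]]]] := en_hookV ok e1.
case: D' sD Ez okz => [|x' D'] //= [sD] Ez okz.
have sw2 : size w' = size (unzip2 rest) by rewrite sw !size_map.
exists (hookw (x' :: D') m' U' mu ++ zip w' (unzip2 rest)).
  apply: e_word_intro.
    by rewrite u1 Eu e1 Ez unzip1_hookw_cat unzip1_zip ?sw2.
  by rewrite Ey' !unzip2_hookw_cat /= unzip2_zip ?sw2 // sU sD.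
apply: (@Append2 _ _ _ _ x' al D' m' U' mu (zip w' (unzip2 rest))) => //; first by rewrite Es sU sD.
apply: word_ext; first by rewrite Ez unzip1_cons_hookw unzip1_zip ?sw2.
by rewrite e2 Ey !unzip2_cons_hookw unzip2_zip ?sw2 //= sU sD.
Qed.

Lemma sim_row_rel s l : sim (row_rel s l).
Proof.
apply: (@simI _ (row_rel s) (row_dom s)).
- exact: row_rel_row_dom.
- exact: row_dom_row_rel.
- exact: row_rel_fun.
- exact: row_dom_f.
- by case=> [o|] y y'; [apply: append_rel_12 | apply: bump_rel_12].
- by case=> [o|] y y' z; [apply: append_rel_e_bar | apply: bump_rel_e_bar].
by case=> [o|] y y' i r; [exact: (append_rel_e_word i r) | exact: (bump_rel_e_word i r)].
Qed.

Lemma sim_append_rel s o : sim (append_rel s o). Proof. exact: (sim_row_rel (l := Some o)). Qed.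
Lemma sim_bump_rel s : sim (bump_rel s). Proof. exact: (sim_row_rel (l := None)). Qed.

(** * Insertion into a tableau *)

(** After a bump in a row of length s the word is the new row, the bumped letter and the remaining
    rows. Skipping s letters presents the next row step in the same form. *)
Fixpoint insert_rel (sh : seq nat) (k : nat) (o : bool) : word -> word -> Prop :=
  match sh, k with
  | [::], 0 => append_rel 0 o
  | [::], _ => fun _ _ => False
  | s :: _, 0 => append_rel s o
  | s :: sh', k'.+1 => comp_rel (bump_rel s) (skip_rel s (insert_rel sh' k' o))
  end.

Lemma sim_insert_rel sh k o : sim (insert_rel sh k o).
Proof.
elim: sh k => [|s sh IH] [|k] /=; try exact: sim_append_rel; first by [].
by apply: sim_comp_rel; [exact: sim_bump_rel | apply: sim_skip_rel].
Qed.

Definition hook_rows (T : tableau) := (forall r, r \in T -> is_hookw (rev r)) /\ posw (flatten T).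

Lemma hook_rows_cons r T : hook_rows (r :: T) <-> [/\ is_hookw (rev r), posw r & hook_rows T].
Proof.
rewrite /hook_rows /= posw_cat; split.
  move=> [h /andP[pr pT]]; split=> //; first by apply: h; rewrite inE eqxx.
  by split=> // u uT; apply: h; rewrite inE uT orbT.
move=> [h1 pr [h2 pT]]; rewrite pr pT; split=> // u.
by rewrite inE => /orP[/eqP -> //|/h2].
Qed.

Lemma posw_sub (a b : word) : {subset unzip1 a <= unzip1 b} -> posw b -> posw a.
Proof. by rewrite !posw_unzip1 => h /allP h2; apply/allP => u /h /h2. Qed.

Lemma posw_rev r : posw (rev r) = posw r.
Proof. exact: all_rev. Qed.

Lemma revrow_cons r T : revrow (r :: T) = rev r ++ revrow T.
Proof. by []. Qed.

Lemma posw_revrow T : posw (revrow T) = posw (flatten T).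
Proof. by elim: T => //= r T IH; rewrite revrow_cons !posw_cat posw_rev IH. Qed.

Lemma row_dom_row (x : letter) row rest s : 0 < x.1 -> is_hookw (rev row) -> posw row -> posw rest -> size row = s ->
  row_dom s (x :: rev row ++ rest).
Proof.
move=> x0 ov pr prest sr; split; first by rewrite /= x0 posw_cat posw_rev pr.
by exists x, (rev row), rest; split=> //; [rewrite size_rev | right].
Qed.

Fixpoint row_bound N (T : tableau) : bool :=
  if T is r :: T' then all (geq N) (unzip1 r) && row_bound N.-1 T' else true.

Lemma row_bound_sub (N : nat) (s t : seq nat) : {subset s <= t} -> all (geq N) t -> all (geq N) s.
Proof. by move=> h /allP h2; apply/allP => u /h /h2. Qed.

(** The bound on letters drops by one per row because a bumped letter is smaller than another letter
    of the row it leaves. *)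
Lemma dec_insert_rel x T T' k o : hook_rows T -> 0 < x.1 -> dec_insert x T = (T', k, o) ->
  [/\ insert_rel (shape T) k o (x :: revrow T) (revrow T'), hook_rows T', shape T' = incr_nth (shape T) k
    & forall N, x.1 <= N -> row_bound N T -> row_bound N T'].
Proof.
elim: T x T' k o => [|row T IH] x T' k o.
  move=> _ x0; have d0 : row_dom 0 [:: x].
    by split; [rewrite /= x0 | exists x, [::], [::]; split=> //; left].
  have [[o1|] [y' r]] := row_dom_row_rel d0; last first.
    by have [x1 [v [r' [c [g [rest [_ /size0nil -> [p [q [mu [_ h]]]]]]]]]]] := bump_rel_row r; case: p h.
  have [x1 [v [r' [rest [E /size0nil v0 _ er [Ey' [sr' ov sub]]]]]]] := append_rel_row r.
  subst v; case: E => ? ?; subst x1 rest.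
  have er' : row_insert x [::] = (r', None, o1) := er.
  rewrite /dec_insert er' => -[<- <- <-]; split=> //=.
  - by move: r => /=; rewrite Ey' /revrow /=.
  - apply/hook_rows_cons; split=> //; apply: (@posw_sub r' [:: x]) => //=; by rewrite x0.
  - by rewrite sr'.
  by move=> N xN _; rewrite andbT; apply: row_bound_sub sub _; rewrite /= xN.
move=> /hook_rows_cons [ov pr okt] x0 /=.
have d := row_dom_row x0 ov pr (_ : posw (revrow T)) (erefl (size row)).
have {d} d := d ltac:(by rewrite posw_revrow; case: okt).
have [[o1|] [y' r]] := row_dom_row_rel d.
  have [x1 [v [r' [rest [[<- E] sv _ er [Ey' [sr' ov' sub]]]]]]] := append_rel_row r.
  have [Ev Er] : v = rev row /\ rest = revrow T.
    by move/eqP: E; rewrite eqseq_cat ?size_rev ?sv // => /andP[/eqP <- /eqP <-].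
  subst v rest; rewrite revK in er; rewrite er => -[<- <- <-]; split.
  - by move: r => /=; rewrite Ey'.
  - apply/hook_rows_cons; split=> //; apply: (@posw_sub r' (x :: rev row)) => //=; by rewrite x0 posw_rev.
  - by rewrite /= sr'.
  move=> N xN /= /andP[rN ->]; rewrite andbT; apply: row_bound_sub sub _.
  by rewrite /= xN unzip1_rev all_rev.
have [x1 [v [r' [c [g [rest [[<- E] sv _ er [Ey' [sr' ov' sub cv [b bv cb]]]]]]]]]] := bump_rel_row r.
have [Ev Er] : v = rev row /\ rest = revrow T.
  by move/eqP: E; rewrite eqseq_cat ?size_rev ?sv // => /andP[/eqP <- /eqP <-].
subst v rest; rewrite revK in er; rewrite er.
case ed: (dec_insert (c, g) T) => [[T2 k2] o2] [<- <- <-].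
have c0 : 0 < c by move: pr; rewrite -posw_rev posw_unzip1 => /allP /(_ _ cv).
have [h1 h2 h3 h4] := IH (c, g) _ _ _ okt c0 ed; split.
- exists y'; first exact: r.
  apply/skip_relP; exists (rev r'), ((c, g) :: revrow T), (revrow T2); split=> //.
  by rewrite size_rev.
- apply/hook_rows_cons; split=> //; apply: (@posw_sub r' (x :: rev row)) => //=; by rewrite x0 posw_rev.
- by rewrite /= sr' h3.
move=> N xN /= /andP[rN TN]; rewrite h4 ?andbT //.
  by apply: row_bound_sub sub _; rewrite /= xN unzip1_rev all_rev.
have : b <= N by apply: (allP rN); move: bv; rewrite unzip1_rev mem_rev.
by move: cb => /=; lia.
Qed.

(** * Reversibility of insertion *)

Lemma cat_inj (T : eqType) (a b c d : seq T) : size a = size c -> a ++ b = c ++ d -> a = c /\ b = d.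
Proof. by move=> s /eqP; rewrite eqseq_cat // => /andP[/eqP -> /eqP ->]. Qed.

Lemma cat_find_inj (P : pred nat) s1 y t1 s2 y2 t2 :
  all (predC P) s1 -> P y -> all (predC P) s2 -> P y2 ->
  s1 ++ y :: t1 = s2 ++ y2 :: t2 -> [/\ s1 = s2, y = y2 & t1 = t2].
Proof.
move=> a1 p1 a2 p2 E; have := congr1 (find P) E; rewrite !find_cat_cons // => s.
by have [-> [-> ->]] := cat_inj s E.
Qed.

Lemma noprime_inj s t : noprime s = noprime t -> s = t.
Proof. by move/(congr1 unzip1); rewrite !unzip1_noprime. Qed.

Lemma hookw_inj D m U mu r run2 m2 U2 mu2 r2 : hookV D m U -> hookV run2 m2 U2 ->
  size D + size U = size run2 + size U2 -> hookw D m U mu ++ r = hookw run2 m2 U2 mu2 ++ r2 ->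
  [/\ D = run2, m = m2, U = U2 & mu = mu2] /\ r = r2.
Proof.
move=> v1 v2 s E; have [E1 ->] : hookw D m U mu = hookw run2 m2 U2 mu2 /\ r = r2.
  by apply: cat_inj E; rewrite !size_hookw s.
have /(congr1 descents) := congr1 unzip1 E1; rewrite !unzip1_hookw !hookV_descents // => /nseq_tf_inj [sD sU].
split=> //; move: E1; rewrite /hookw => /cat_inj; rewrite !size_noprime => /(_ sD) [/noprime_inj -> [-> -> /noprime_inj ->]].
by [].
Qed.

(** Appending to a nonempty row forgets one bit, which the parity o restores. The two kinds of
    append are told apart by whether the decreasing part of the result is empty. *)
Lemma append_rel_inj s o y y2 y' : append_rel s o y y' -> append_rel s o y2 y' -> y = y2.
Proof.
case.
- move=> x al rest s0 o0 py Ey Ey'; case; try by rewrite s0.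
  by move=> x2 al2 rest2 _ _ _ _ <-.
- move=> x al m U mu rest xm ok Es Eo py Ey Ey'; have ok1 : hookV [::] x (m :: U).
    by move: ok; rewrite !hookVE /= xm.
  case.
  + by rewrite Es.
  + move=> x2 al2 m2 U2 mu2 rest2 xm2 okk Es2 Eo2 py2 Ey2 Ey2'.
    have ok2 : hookV [::] x2 (m2 :: U2) by move: okk; rewrite !hookVE /= xm2.
    rewrite Ey' in Ey2'; have [|[_ e1 [e2 e3] e4] e5] := hookw_inj ok1 ok2 _ Ey2'.
      by rewrite /= -Es -Es2.
    by rewrite Ey Ey2 e1 e2 e3 e4 e5 -Eo -Eo2.
  + move=> x2 al2 run2 m2 U2 mu2 rest2 ok2 Es2 Eo2 py2 Ey2 Ey2'.
    rewrite Ey' in Ey2'; have [|[]] // := hookw_inj ok1 ok2 _ Ey2'.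
    by rewrite /= -Es addSn -Es2.
move=> x al D m U mu rest ok1 Es Eo py Ey Ey'; case.
- by rewrite Es.
- move=> x2 al2 m2 U2 mu2 rest2 xm2 okk Es2 Eo2 py2 Ey2 Ey2'.
  have ok2 : hookV [::] x2 (m2 :: U2) by move: okk; rewrite !hookVE /= xm2.
  rewrite Ey' in Ey2'; have [|[]] // := hookw_inj ok1 ok2 _ Ey2'.
  by rewrite /= -Es2 addSn -Es.
move=> x2 al2 run2 m2 U2 mu2 rest2 ok2 Es2 Eo2 py2 Ey2 Ey2'.
rewrite Ey' in Ey2'; have [|[[e0 e0'] e1 e2 e4] e5] := hookw_inj ok1 ok2 _ Ey2'.
  by rewrite /= !addSn -Es -Es2.
by rewrite Ey Ey2 e0 e0' e1 e2 e4 e5 -Eo -Eo2.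
Qed.

(** Undoing a bump: c is known, b is the first letter of M b N above c, and x is the first letter of
    A x C not above b. *)
Lemma bumpable_core x A b C M c N x2 A2 b2 C2 M2 N2 :
  bumpable x A b C M c N -> bumpable x2 A2 b2 C2 M2 c N2 ->
  A ++ x :: C = A2 ++ x2 :: C2 -> M ++ b :: N = M2 ++ b2 :: N2 ->
  [/\ [/\ x = x2, A = A2 & C = C2], b = b2, M = M2 & N = N2].
Proof.
move=> /bumpable_facts F /bumpable_facts F2 E1 E2.
have [|||| e1 e2 e3] := @cat_find_inj (ltn c) _ _ _ _ _ _ _ _ _ _ E2.
- by apply: sub_all (f_Mc F) => u /=; lia.
- exact: (f_cb F).
- by apply: sub_all (f_Mc F2) => u /=; lia.
- exact: (f_cb F2).
subst b2; have [|||| e4 e5 e6] := @cat_find_inj (geq b) _ _ _ _ _ _ _ _ _ _ E1 => //.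
- by apply: sub_all (f_Ab F) => u /=; lia.
- exact: (f_xb F).
- by apply: sub_all (f_Ab F2) => u /=; lia.
exact: (f_xb F2).
Qed.

Inductive bump_out_spec x al A b C M c N mu rest (y' : word) : Prop :=
| BumpOutF D m U of hookV D m U & A ++ x :: C = rcons D m & M ++ b :: N = U & M = [::] \/ C = [::] &
    y' = hookw D m U al ++ (c, mu) :: rest & size D + size U = size A + size C + size M + size N + 1
| BumpOutU D m U of hookV D m U & A ++ x :: C = D & M ++ b :: N = m :: U & M != [::] &
    y' = hookw D m U mu ++ (c, al) :: rest & size D + size U = size A + size C + size M + size N + 1.

Lemma bump_outP x al A b C M c N mu rest : bumpable x A b C M c N ->
  bump_out_spec x al A b C M c N mu rest (bump_out x al A b C M c N mu rest).
Proof.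
move=> ok; rewrite /bump_out; case: M ok => [|m M] ok.
  apply: (@BumpOutF _ _ _ _ _ _ _ _ _ _ _ (A ++ belast x C) (last x C) (b :: N)) => //.
  - exact: hookV_out1 ok.
  - by rewrite lastI rcons_cat.
  - by left.
  - by rewrite size_cat size_belast /=; lia.
case: leqP => xm.
  apply: (@BumpOutF _ _ _ _ _ _ _ _ _ _ _ A x (m :: M ++ b :: N)) => //.
  - by have C0 := flagged_C ok xm; subst C; exact: hookV_out2 ok xm.
  - by rewrite (flagged_C ok xm) cats1.
  - by right; rewrite (flagged_C ok xm).
  - by rewrite (flagged_C ok xm) /= size_cat /=; lia.
apply: (@BumpOutU _ _ _ _ _ _ _ _ _ _ _ (A ++ x :: C) m (M ++ b :: N)) => //.
- exact: hookV_out3 ok xm.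
- by rewrite !size_cat /=; lia.
Qed.

(** Both readings would share the middle m and what follows it, hence b. If C is empty, x2 is a
    letter of A, so above b. Otherwise M is empty and m is the last letter of C, so above c, while
    as the head of M2 it is at most c. *)
Lemma bump_out_mix x A b C M c N x2 A2 b2 C2 M2 N2 D m U :
  bumpable x A b C M c N -> bumpable x2 A2 b2 C2 M2 c N2 ->
  A ++ x :: C = rcons D m -> M ++ b :: N = U -> M = [::] \/ C = [::] ->
  A2 ++ x2 :: C2 = D -> M2 ++ b2 :: N2 = m :: U -> M2 != [::] -> False.
Proof.
move=> /bumpable_facts F /bumpable_facts F2 E1 E2 MC E3 E4.
case: M2 F2 E4 => //= m2 M2 F2 [m2m E4] _; subst m2.
have mc : m <= c by have /andP[] := f_Mc F2.
rewrite -E2 in E4; have [|||| e1 e2 e3] := @cat_find_inj (ltn c) _ _ _ _ _ _ _ _ _ _ E4.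
- by have /andP[_ h] := f_Mc F2; apply: sub_all h => u /=; lia.
- exact: (f_cb F2).
- by apply: sub_all (f_Mc F) => u /=; lia.
- exact: (f_cb F).
subst b2 M2 N2; case/lastP: C F MC E1 => [|C l] F MC E1.
  move: E1; rewrite cats1 => /rcons_inj [EA _].
  have : x2 \in A by rewrite EA -E3 mem_cat inE eqxx orbT.
  by move/(allP (f_Ab F)) => /=; have := f_xb F2; lia.
case: MC => [M0|]; last by case: (C).
move: E1; rewrite -rcons_cons -rcons_cat => /rcons_inj [_ lm]; subst l.
have := f_mC F; rewrite M0 all_rcons /= => /andP[]; lia.
Qed.

Lemma bump_rel_inj s y y2 y' : bump_rel s y y' -> bump_rel s y2 y' -> y = y2.
Proof.
case=> x al A b C M c N mu rest ok Es _ Ey Ey'.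
case=> x2 al2 A2 b2 C2 M2 c2 N2 mu2 rest2 ok2 Es2 _ Ey2 Ey2'.
have ss : size A + size C + size M + size N + 1 = size A2 + size C2 + size M2 + size N2 + 1 by lia.
have core (H : [/\ [/\ x = x2, A = A2 & C = C2], b = b2, M = M2 & N = N2]) :
    al = al2 -> mu = mu2 -> c = c2 -> rest = rest2 -> y = y2.
  by case: H Ey Ey2 => [[-> -> ->] -> -> ->] -> -> -> -> -> ->.
have := bump_outP al mu rest ok; rewrite -Ey'; have := bump_outP al2 mu2 rest2 ok2; rewrite -Ey2'.
case=> D' m' U' v' e1 e2 e3 e4 e5; case=> D m U v f1 f2 f3 f4 f5;
 rewrite e4 in f4; have [|[EE1 EE2 EE3 EE4] [EE5 EE6 EE7]] := hookw_inj v' v _ f4; try lia; move: e1 e2; rewrite EE1 EE2 EE3 => e1 e2; subst c2.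
- by apply: core => //; apply: bumpable_core ok ok2 _ _; rewrite ?f1 ?f2.
- by case: (bump_out_mix ok2 ok e1 e2 e3 f1 f2 f3).
- by case: (bump_out_mix ok ok2 f1 f2 f3 e1 e2 e3).
by apply: core => //; apply: bumpable_core ok ok2 _ _; rewrite ?f1 ?f2.
Qed.

Lemma insert_rel_fun sh k o y y' k2 o2 y2' : insert_rel sh k o y y' -> insert_rel sh k2 o2 y y2' ->
  [/\ k = k2, o = o2 & y' = y2'].
Proof.
have fAA s o1 o3 z z1 z2 : append_rel s o1 z z1 -> append_rel s o3 z z2 -> o1 = o3 /\ z1 = z2.
  by move=> r1 r2; have [[<-] <-] := @row_rel_fun s (Some o1) z z1 (Some o3) z2 r1 r2.
elim: sh k k2 y y' y2' => [|s sh IH] [|k] [|k2] y y' y2' //=.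
- by move=> r1 r2; have [-> ->] := fAA _ _ _ _ _ _ r1 r2.
- by move=> r1 r2; have [-> ->] := fAA _ _ _ _ _ _ r1 r2.
- by move=> r1 [z r2 _]; have [] := @row_rel_fun s (Some o) y y' None z r1 r2.
- by move=> [z r2 _] r1; have [] := @row_rel_fun s (Some o2) y y2' None z r1 r2.
move=> [z r1 /skip_relP [p [v [v' [sp Ez Ey' d]]]]] [z2 r2 /skip_relP [p2 [w [w' [sp2 Ez2 Ey2' d2]]]]].
have [_ Ezz] := @row_rel_fun s None y z None z2 r1 r2.
have [Ep Ew] : p = p2 /\ v = w by apply: cat_inj; rewrite ?sp ?sp2 // -Ez -Ez2.
subst w; have [-> -> Ev] := IH _ _ _ _ _ d d2.
by rewrite Ey' Ey2' Ep Ev.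
Qed.

Lemma insert_rel_inj sh k o y y2 y' : insert_rel sh k o y y' -> insert_rel sh k o y2 y' -> y = y2.
Proof.
elim: sh k y y2 y' => [|s sh IH] [|k] y y2 y' //=; try exact: append_rel_inj.
move=> [z r1 /skip_relP [p [v [v' [sp Ez Ey' d]]]]] [z2 r2 /skip_relP [p2 [w [w' [sp2 Ez2 Ey2' d2]]]]].
have [Ep Ew] : p = p2 /\ v' = w' by apply: cat_inj; rewrite ?sp ?sp2 // -Ey' -Ey2'.
subst w'; have Ev := IH _ _ _ _ d d2; subst w p2.
by subst z z2; apply: bump_rel_inj r1 r2.
Qed.

(** * Histories and the recording tableau *)

Lemma Pdec_cons x w : Pdec (x :: w) = (dec_insert x (Pdec w)).1.1.
Proof. by rewrite /Pdec /=; case: (PQdec w) => P Q; case: (dec_insert x P) => [[]]. Qed.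

Lemma Qdec_cons x w : Qdec (x :: w) =
  add_box (Qdec w) (dec_insert x (Pdec w)).1.2 ((size w).+1, (dec_insert x (Pdec w)).2).
Proof. by rewrite /Pdec /Qdec /=; case: (PQdec w) => P Q /=; case: (dec_insert x P) => [[]]. Qed.

(* Encodes the same information as Qdec, see Qdec_eq. *)
Fixpoint hist (w : word) : seq (nat * bool) :=
  if w is x :: w' then
    ((dec_insert x (Pdec w')).1.2, (dec_insert x (Pdec w')).2) :: hist w'
  else [::].

Definition hist_shape (h : seq (nat * bool)) : seq nat :=
  foldr (fun ko sh => incr_nth sh ko.1) [::] h.

Fixpoint word_rel (h : seq (nat * bool)) : word -> word -> Prop :=
  if h is ko :: h' then comp_rel (cons_rel (word_rel h')) (insert_rel (hist_shape h') ko.1 ko.2)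
  else fun y y' => y = [::] /\ y' = [::].

Lemma sim_word_rel h : sim (word_rel h).
Proof.
elim: h => [|[k o] h IH] /=.
  by move=> y y' [-> ->]; split=> //; case=> [|[|i]].
by apply: sim_comp_rel; [apply: sim_cons_rel | apply: sim_insert_rel].
Qed.

Lemma insert_rel_k sh k o y y' : insert_rel sh k o y y' -> k <= size sh.
Proof.
elim: sh k y y' => [|s sh IH] [|k] y y' //= [z _ /skip_relP [p [v [v' [_ _ _ d]]]]].
exact: IH d.
Qed.

Lemma word_relP w : posw w ->
  [/\ word_rel (hist w) w (revrow (Pdec w)), hook_rows (Pdec w), shape (Pdec w) = hist_shape (hist w)
    & forall k o h, hist w = (k, o) :: h -> k <= size (hist_shape h)].
Proof.
elim: w => [|x w IH] /= pw; first by split=> //; split.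
have /andP[x0 pw'] := pw; have [r ok sh _] := IH pw'.
case E: (dec_insert x (Pdec w)) => [[T' k] o] /=.
have [h1 h2 h3 _] := dec_insert_rel ok x0 E.
rewrite Pdec_cons E /= h3 sh; rewrite sh in h1; split=> //.
  exists (x :: revrow (Pdec w)) => //.
  by exists x, w, (revrow (Pdec w)).
by move=> k' o' h [<- _ <-]; apply: insert_rel_k h1.
Qed.

Lemma word_rel_fun h w t h2 t2 : word_rel h w t -> word_rel h2 w t2 -> h = h2 /\ t = t2.
Proof.
elim: h h2 w t t2 => [|[k o] h IH] [|[k2 o2] h2] w t t2 /=.
- by move=> [_ ->] [_ ->].
- by move=> [-> _] [z [x [v [v' []]]]].
- by move=> [z [x [v [v' [-> _ _]]]] _] [].
move=> [z [x [v [v' [-> -> r]]]] d] [z2 [x2 [v2 [v2' [[<- <-] -> r2]]]] d2].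
have [Eh Ev] := IH _ _ _ _ r r2; subst h2 v2'.
by have [-> -> ->] := insert_rel_fun d d2.
Qed.

Lemma word_rel_inj h w w2 t : word_rel h w t -> word_rel h w2 t -> w = w2.
Proof.
elim: h w w2 t => [|[k o] h IH] w w2 t /=; first by move=> [-> _] [-> _].
move=> [z [x [v [v' [-> Ez r]]]] d] [z2 [x2 [v2 [v2' [-> Ez2 r2]]]] d2].
have := insert_rel_inj d d2; rewrite Ez Ez2 => -[-> E]; rewrite -E in r2.
by rewrite (IH _ _ _ r r2).
Qed.

(** The bisimulation for [hist w] relates w2 to the image of the reading word. A word determines
    both its history and its partner, so these are the history of w2 and the reading word of its
    tableau. *)
Lemma hist_op_e i w w2 : posw w -> op_e i w = Some w2 ->
  op_e i (revrow (Pdec w)) = Some (revrow (Pdec w2)) /\ hist w2 = hist w.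
Proof.
move=> pw e; have pw2 : posw w2 by rewrite (posw_op_e e).
have [r _ _ _] := word_relP pw; have [r2 _ _ _] := word_relP pw2.
have [_ /(_ i) [he _]] := sim_word_rel r; move: he; rewrite e.
case: (op_e i (revrow _)) => [t|] //= r3.
by have [<- <-] := word_rel_fun r3 r2.
Qed.

Lemma hist_op_f i w w2 : posw w -> op_f i w = Some w2 ->
  op_f i (revrow (Pdec w)) = Some (revrow (Pdec w2)) /\ hist w2 = hist w.
Proof.
move=> pw e; have pw2 : posw w2 by rewrite (posw_op_f e).
have [r _ _ _] := word_relP pw; have [r2 _ _ _] := word_relP pw2.
have [_ /(_ i) [_ he]] := sim_word_rel r; move: he; rewrite e.
case: (op_f i (revrow _)) => [t|] //= r3.
by have [<- <-] := word_rel_fun r3 r2.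
Qed.

Lemma op_e_none i w : posw w -> op_e i w = None -> op_e i (revrow (Pdec w)) = None.
Proof.
move=> pw e; have [r _ _ _] := word_relP pw; have [_ /(_ i) [he _]] := sim_word_rel r.
by move: he; rewrite e; case: (op_e i (revrow _)).
Qed.

Lemma op_f_none i w : posw w -> op_f i w = None -> op_f i (revrow (Pdec w)) = None.
Proof.
move=> pw e; have [r _ _ _] := word_relP pw; have [_ /(_ i) [_ he]] := sim_word_rel r.
by move: he; rewrite e; case: (op_f i (revrow _)).
Qed.

Lemma shape_hist w w2 : posw w -> posw w2 -> hist w2 = hist w -> shape (Pdec w2) = shape (Pdec w).
Proof. by move=> pw pw2 e; have [_ _ -> _] := word_relP pw; have [_ _ -> _] := word_relP pw2; rewrite e. Qed.

Fixpoint hist_tab (h : seq (nat * bool)) : tableau :=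
  if h is ko :: h' then add_box (hist_tab h') ko.1 ((size h').+1, ko.2) else [::].

Fixpoint valid_history (h : seq (nat * bool)) : bool :=
  if h is ko :: h' then (ko.1 <= size (hist_shape h')) && valid_history h' else true.

Lemma size_hist w : size (hist w) = size w.
Proof. by elim: w => //= x w ->. Qed.

Lemma Qdec_hist w : Qdec w = hist_tab (hist w).
Proof. by elim: w => //= x w IH; rewrite Qdec_cons IH size_hist. Qed.

Lemma valid_hist w : posw w -> valid_history (hist w).
Proof.
elim: w => //= x w IH pw; have [_ _ _ h] := @word_relP (x :: w) pw.
by have /andP[_ /IH ->] := pw; rewrite andbT; apply: h.
Qed.

Lemma shape_add T k x : k <= size T -> shape (add_box T k x) = incr_nth (shape T) k.
Proof.
elim: T k => [|r T IH] [|k] //=; first by rewrite /add_box /= size_rcons.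
by move=> h; rewrite -IH.
Qed.

Lemma size_shape T : size (shape T) = size (T : tableau).
Proof. exact: size_map. Qed.

Lemma shape_hist_tab h : valid_history h -> shape (hist_tab h) = hist_shape h.
Proof.
elim: h => //= -[k o] h IH /= /andP[kh /IH e].
by rewrite shape_add ?e // -size_shape e.
Qed.

Lemma sumn_hist_shape h : sumn (hist_shape h) = size h.
Proof.
elim: h => //= -[k o] h <- /=; elim: (hist_shape h) k => [|s sh IH] [|k] //=; last by rewrite IH addnS.
by elim: k => //= k ->.
Qed.

Lemma hist_shape_pos h : valid_history h -> all (ltn 0) (hist_shape h).
Proof.
elim: h => //= -[k o] h IH /= /andP[kh /IH]; elim: (hist_shape h) k kh => [|s sh IHs] [|k] //=.
  by move=> _ /andP[_ ->].
by move=> kh /andP[-> /IHs ->].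
Qed.

Lemma nth_add_box T k x i : nth [::] (add_box T k x) i =
  if i == k then rcons (nth [::] T k) x else nth [::] T i.
Proof. by rewrite /add_box nth_set_nth /=; case: eqP. Qed.

Lemma hist_tab_le h i x : x \in nth [::] (hist_tab h) i -> x.1 <= size h.
Proof.
elim: h i => [|[k o] h IH] i /=; first by rewrite nth_nil.
rewrite nth_add_box; case: ifP => _; last by move/IH => hx; apply: leqW.
by rewrite mem_rcons inE => /orP[/eqP -> //|/IH hx]; apply: leqW.
Qed.

Lemma tab_ext (T T2 : tableau) : all (ltn 0) (shape T) -> all (ltn 0) (shape T2) ->
  (forall i, nth [::] T i = nth [::] T2 i) -> T = T2.
Proof.
elim: T T2 => [|r T IH] [|r2 T2] //=.
- by move=> _ /andP[r0 _] /(_ 0) /= E; rewrite -E in r0.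
- by move=> /andP[r0 _] _ /(_ 0) /= E; rewrite E in r0.
move=> /andP[_ p] /andP[_ p2] E; have /= -> := E 0; congr cons.
by apply: IH => // i; apply: (E i.+1).
Qed.

(** The largest label is the length of the history; it shows the row of the last box and, by its
    prime, the parity. All older labels are smaller, so the last step can be stripped off. *)
Lemma hist_tab_inj h h2 : valid_history h -> valid_history h2 -> hist_tab h = hist_tab h2 -> h = h2.
Proof.
move=> v v2 E; have sz : size h = size h2.
  by rewrite -!sumn_hist_shape -!shape_hist_tab // E.
elim: h h2 sz v v2 E => [|[k o] h IH] [|[k2 o2] h2] // [sz] /= /andP[kh v] /andP[kh2 v2] E.
have nE i : nth [::] (add_box (hist_tab h) k ((size h).+1, o)) i =
            nth [::] (add_box (hist_tab h2) k2 ((size h2).+1, o2)) i by rewrite E.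
have Ek : k = k2.
  apply/eqP/negPn/negP => /negbTE nk; have := nE k; rewrite !nth_add_box eqxx nk => Er.
  have : ((size h).+1, o) \in nth [::] (hist_tab h2) k by rewrite -Er mem_rcons inE eqxx.
  by move/hist_tab_le => /=; rewrite sz ltnn.
subst k2; have := nE k; rewrite !nth_add_box eqxx => /rcons_inj [Er [_ Eo]]; subst o2.
congr cons; apply: IH => //; apply: tab_ext; rewrite ?shape_hist_tab ?hist_shape_pos // => i.
by have := nE i; rewrite !nth_add_box; case: (i =P k) => [-> _|_ ->].
Qed.

Lemma Qdec_eq w w2 : posw w -> posw w2 -> (Qdec w = Qdec w2 <-> hist w = hist w2).
Proof.
move=> pw pw2; rewrite !Qdec_hist; split; last by move=> ->.
by apply: hist_tab_inj; apply: valid_hist.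
Qed.

Lemma PQ_inj w w2 : posw w -> posw w2 -> Pdec w = Pdec w2 -> Qdec w = Qdec w2 -> w = w2.
Proof.
move=> pw pw2 EP /(Qdec_eq pw pw2) EQ.
have [r _ _ _] := word_relP pw; have [r2 _ _ _] := word_relP pw2.
by rewrite EP EQ in r; apply: word_rel_inj r r2.
Qed.

(** * Extremal words *)

Fixpoint ebn (w : seq nat) : option (seq nat) :=
  if w is x :: v then
    if x == 2 then Some (1 :: v)
    else if x == 1 then None else omap (cons x) (ebn v)
  else None.

Inductive nat_conn (n : nat) : seq nat -> seq nat -> Prop :=
| nat_conn_refl w : nat_conn n w w
| nat_conn_e i w v : 0 < i < n -> en i w = Some v -> nat_conn n w v
| nat_conn_b w v : 1 < n -> ebn w = Some v -> nat_conn n w v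
| nat_conn_sym w v : nat_conn n w v -> nat_conn n v w
| nat_conn_trans u w v : nat_conn n u w -> nat_conn n w v -> nat_conn n u v.

Lemma en_noneW i w : en i w = None -> eps i w = 0.
Proof. by move=> e; apply/eqP; rewrite -en_none e. Qed.

Lemma ebn_mult w v : ebn w = Some v ->
  [/\ mult 1 v = (mult 1 w).+1, (mult 2 v).+1 = mult 2 w
    & forall k, 2 < k -> mult k v = mult k w].
Proof.
rewrite /mult; elim: w v => //= x w IH v; case: eqP => [-> [<-]|n2] /=.
  by split=> // k; case: (2 =P k) => [<-//|_]; case: (1 =P k) => [<-//|].
case: eqP => // n1; case: (ebn w) IH => //= u /(_ _ erefl) [h1 h2 h3] [<-] /=.
by split; [lia | lia | move=> k k2; rewrite h3].
Qed.

Lemma ebn_size w v : ebn w = Some v -> size v = size w.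
Proof.
elim: w v => //= x w IH v; case: eqP => [_ [<-]|n2] //=.
by case: eqP => // n1; case: (ebn w) IH => //= u /(_ _ erefl) <- [<-].
Qed.

Lemma nat_conn_size n w v : nat_conn n w v -> size v = size w.
Proof.
elim=> {w v} //.
- by move=> i w v _ /en_size.
- by move=> w v _ /ebn_size.
- by move=> u w v _ e1 _ ->.
Qed.

Lemma nat_conn_mult n w v k : nat_conn n w v -> n < k -> mult k v = mult k w.
Proof.
move=> c nk; elim: c => {w v} //.
- by move=> i w v /andP[_ h] /en_mult [_ _ ->] //; lia.
- by move=> w v h /ebn_mult [_ _ ->] //; lia.
- by move=> u w v _ e1 _ ->.
Qed.

Lemma nat_conn_le n m w v : n <= m -> nat_conn n w v -> nat_conn m w v.
Proof.
move=> nm; elim=> {w v}.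
- exact: nat_conn_refl.
- by move=> i w v h; apply: nat_conn_e; lia.
- by move=> w v h; apply: nat_conn_b; lia.
- by move=> w v _; apply: nat_conn_sym.
- by move=> u w v _ h1 _; apply: nat_conn_trans.
Qed.

(** One functional for two purposes: the sum of squares, and the linear sum that chooses among its
    maximizers. *)
Definition wsum (g : nat -> nat -> nat) n w := \sum_(i < n) g i (mult i.+1 w).

Lemma wsum_pair g n i w : 0 < i < n -> wsum g n w =
  g i.-1 (mult i w) + g i (mult i.+1 w) +
  \sum_(j < n | (j.+1 != i) && (j != i :> nat)) g j (mult j.+1 w).
Proof.
move=> /andP[i0 hin]; have hi1 : i.-1 < n by lia.
rewrite /wsum (bigD1 (Ordinal hi1)) //= (bigD1 (Ordinal hin)) /=; last first.
  by rewrite -val_eqE /=; lia.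
rewrite addnA prednK //; congr (_ + _); apply: eq_bigl => j.
by rewrite -!val_eqE /=; lia.
Qed.

Lemma wsum_change g n i w v : 0 < i < n ->
  (forall k, k != i -> k != i.+1 -> mult k v = mult k w) ->
  wsum g n v + (g i.-1 (mult i w) + g i (mult i.+1 w)) =
  wsum g n w + (g i.-1 (mult i v) + g i (mult i.+1 v)).
Proof.
move=> hi H; rewrite !(wsum_pair _ _ hi).
have -> : \sum_(j < n | (j.+1 != i) && (j != i :> nat)) g j (mult j.+1 v) =
          \sum_(j < n | (j.+1 != i) && (j != i :> nat)) g j (mult j.+1 w).
  by apply: eq_bigr => j /andP[h1 h2]; rewrite H.
lia.
Qed.

Lemma wsum_last g n w : wsum g n.+1 w = wsum g n w + g n (mult n.+1 w).
Proof. by rewrite /wsum big_ord_recr. Qed.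

Definition sq (i c : nat) := c * c.
Definition energy := wsum sq.

Fixpoint e_chain k i w :=
  if k is k'.+1 then (if en i w is Some v then e_chain k' i v else w) else w.

Lemma e_chain_facts k i w : k <= eps i w ->
  [/\ phi i (e_chain k i w) = phi i w + k, mult i (e_chain k i w) = mult i w + k,
      mult i.+1 (e_chain k i w) + k = mult i.+1 w
    & forall l, l != i -> l != i.+1 -> mult l (e_chain k i w) = mult l w].
Proof.
elim: k w => [|k IH] w /=; first by rewrite !addn0.
move=> h; case e: (en i w) => [v|]; last by have := en_noneW e; lia.
have ev := en_eps e; have pv := en_phi e; have [c1 c2 c3] := en_mult e.
have [|h1 h2 h3 h4] := IH v; first lia.
split; try lia; by move=> l l1 l2; rewrite h4 // c3.
Qed.

Lemma e_chain_nat_conn n k i w : 0 < i < n -> nat_conn n w (e_chain k i w).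
Proof.
move=> hi; elim: k w => [|k IH] w /=; first exact: nat_conn_refl.
case e: (en i w) => [v|]; last exact: nat_conn_refl.
by apply: nat_conn_trans (IH v); apply: nat_conn_e e.
Qed.

Lemma e_chain_S k i w : k < eps i w -> exists2 u, u = e_chain k i w & en i u = Some (e_chain k.+1 i w).
Proof.
elim: k w => [|k IH] w /= h.
  exists w => //; case e: (en i w) => [v|] //; have := en_noneW e; lia.
case e: (en i w) => [v|]; last by have := en_noneW e; lia.
have [|u -> eu] := IH v; first by have := en_eps e; lia.
by exists (e_chain k i v).
Qed.

(** By the tensor product rule the first [eps i a - phi i b] steps act on a and all later ones on
    b. *)
Lemma e_chain_cat k i a b : k <= eps i (a ++ b) -> e_chain k i (a ++ b) =
  e_chain (minn k (eps i a - phi i b)) i a ++ e_chain (k - (eps i a - phi i b)) i b.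
Proof.
elim: k a b => [|k IH] a b; first by rewrite min0n sub0n.
rewrite eps_cat => h /=; rewrite en_cat; case: ltnP => hp.
  case e: (en i a) => [a'|] /=; last by have := en_noneW e; lia.
  have ea := en_eps e; rewrite IH; last by rewrite eps_cat; lia.
  have -> : eps i a - phi i b = (eps i a' - phi i b).+1 by lia.
  by rewrite minnSS /= e subSS.
case e: (en i b) => [b'|] /=; last by have := en_noneW e; lia.
have eb' := en_eps e; have pb := en_phi e; rewrite IH; last by rewrite eps_cat; lia.
have -> : eps i a - phi i b' = 0 by lia.
have -> : eps i a - phi i b = 0 by lia.
by rewrite !minn0 !subn0 /= e.
Qed.

(** * Maximal energy and strict lattice words *)

Definition max_energy n w := forall v, nat_conn n w v -> energy n v <= energy n w.
Definition sorted_cnt n w := forall i, 0 < i < n -> mult i w <= mult i.+1 w.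
Definition strict_lattice n w := forall a b, w = a ++ b -> forall i, 0 < i < n ->
  0 < mult i a -> mult i a < mult i.+1 a.

Lemma mult_cat k a b : mult k (a ++ b) = mult k a + mult k b.
Proof. exact: count_cat. Qed.

(** A step f_i moves one unit of weight from i to i+1. Where the weight already weakly increases,
    this raises the sum of squares. *)
Lemma max_energy_phi n w i : max_energy n w -> sorted_cnt n w -> 0 < i < n -> phi i w = 0.
Proof.
move=> mw sw hi; have := sw _ hi; case e: (fn i w) => [v|]; last first.
  by move=> _; apply/eqP; rewrite -fn_none e.
move/fn_en: e => e; have cv : nat_conn n w v by apply: nat_conn_sym; apply: nat_conn_e e.
have [c1 c2 c3] := en_mult e; have := mw _ cv.
have := @wsum_change sq n i v w hi c3; rewrite /energy /sq; nia.
Qed.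

(** [phi] is the largest excess of i over i+1 in a prefix; this is the half saying that it is
    attained. *)
Lemma phi_prefix i v : exists a b, v = a ++ b /\ mult i a = mult i.+1 a + phi i v.
Proof.
rewrite /mult; elim: v => [|x v [a [b [E h]]]] /=; first by exists [::], [::].
case: (x =P i.+1) => [->|n1]; last first.
  exists (x :: a), b; split; first by rewrite E.
  by move: h; rewrite /= (introF eqP n1); case: (x =P i) => _ /=; lia.
have [p0|p0] := posnP (phi i v); first by exists [::], (i.+1 :: v); rewrite p0.
exists (i.+1 :: a), b; split; first by rewrite E.
by move: h; rewrite /= eqSn eqxx; lia.
Qed.

Lemma en_phi_next j w v : en j w = Some v -> phi j.+1 v <= phi j.+1 w.
Proof.
elim: w v => //= x w IH v; case: ifP => [/andP[/eqP -> _] [<-] /=|_].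
  by rewrite eqxx !eqnS (_ : (j == j.+2) = false) //; lia.
case: (en j w) IH => //= u /(_ _ erefl) h [<-] /=.
by case: ifP => _; [lia | case: ifP => _; lia].
Qed.

Lemma e_chain_phi_next k j w : phi j.+1 (e_chain k j w) <= phi j.+1 w.
Proof.
elim: k w => //= k IH w; case e: (en j w) => [v|] //.
exact: leq_trans (IH v) (en_phi_next e).
Qed.

Lemma ebn_prefix p r : phi 1 p = 0 -> 0 < mult 1 p -> exists p', ebn (p ++ r) = Some (p' ++ r).
Proof.
rewrite /mult; elim: p => //= x p IH; case: (x =P 2) => [->|n2]; first by exists (1 :: p).
case: (x =P 1) => // n1 h1 h2; have [|p' ->] := IH h1; first by [].
by exists (x :: p').
Qed.

(** A prefix p that contains a 1 and violates the claim is perfectly matched, so the full string of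
    e_1 leaves p alone and just swaps the multiplicities. But the first 1 or 2 in p is a 2, so [ebn]
    still acts inside p and makes the weight more uneven than the maximum allows. *)
Lemma strict_lattice_base w : max_energy 2 w -> sorted_cnt 2 w -> strict_lattice 2 w.
Proof.
move=> mw sw p v E i /andP[i0 i2] c1; have i1 : i = 1 by lia.
subst i; rewrite ltnNge; apply/negP => c2.
have h1 : 0 < 1 < 2 by [].
have ph := max_energy_phi mw sw h1.
have pp : phi 1 p = 0 by move: ph; rewrite E phi_cat; lia.
have pc := phi_mult 1 p; have ep : eps 1 p = 0 by lia.
set w1 := e_chain (eps 1 w) 1 w.
have cw1 : nat_conn 2 w w1 by apply: e_chain_nat_conn.
have [_ k1 k2 k3] := e_chain_facts (leqnn (eps 1 w)).
have Ew1 : w1 = p ++ e_chain (eps 1 w - (eps 1 p - phi 1 v)) 1 v.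
  by rewrite /w1 {2}E e_chain_cat -?E // ep sub0n minn0.
have [p' eb'] := ebn_prefix (e_chain (eps 1 w - (eps 1 p - phi 1 v)) 1 v) pp c1.
rewrite -Ew1 in eb'; have [e1 e2 e3] := ebn_mult eb'.
have := mw _ (nat_conn_trans cw1 (nat_conn_b _ eb')); have := sw 1 h1; have := phi_mult 1 w.
have : mult 1 w > 0 by rewrite E mult_cat; lia.
rewrite -/w1 in k1 k2; rewrite /energy /wsum !big_ord_recr !big_ord0 /= /sq ph; nia.
Qed.

(** The full string of e_j followed by that of e_(j+1) only permutes the weight, so the resulting w2
    has maximal energy and the induction hypothesis applies to it. A violation at j+1 in a prefix p
    of w becomes a violation at j in a prefix of w2. *)
Lemma strict_lattice_step j w : 0 < j -> (forall u, max_energy j.+1 u -> sorted_cnt j.+1 u -> strict_lattice j.+1 u) ->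
  max_energy j.+2 w -> sorted_cnt j.+2 w -> strict_lattice j.+2 w.
Proof.
move=> j0 IH mw sw.
(* Moves among the letters up to j+1 fix the multiplicity of j+2, so maximality descends. *)
have maxdown u : nat_conn j.+2 w u -> energy j.+2 u = energy j.+2 w -> max_energy j.+1 u.
  move=> cu Eu v cv; have := mw v (nat_conn_trans cu (nat_conn_le (leqnSn _) cv)).
  rewrite -Eu /energy !(wsum_last sq j.+1) (nat_conn_mult cv) //; lia.
have SLw : strict_lattice j.+1 w.
  by apply: IH; [apply: maxdown => //; exact: nat_conn_refl | move=> i hi; apply: sw; lia].
move=> p v E i /andP[i0 hi2] c1.
case: (ltngtP i j.+1) => [hi|hi|Ei]; first by apply: (SLw p v E); lia.
  by lia.
subst i; rewrite ltnNge; apply/negP => c2.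
have hj : 0 < j < j.+2 by lia.
have hi : 0 < j.+1 < j.+2 by lia.
have phj := max_energy_phi mw sw hj; have phi1 := max_energy_phi mw sw hi.
have [pj ppj] : phi j p = 0 /\ phi j v <= eps j p by move: phj; rewrite E phi_cat; lia.
have pi : phi j.+1 p = 0 by move: phi1; rewrite E phi_cat; lia.
have pcj := phi_mult j p; have pci := phi_mult j.+1 p.
(* d counts the letters of p changed by the string of e_j. It is positive: otherwise p, extended by
   a prefix of v with excess [phi j v], would violate the lattice condition at j. *)
set d := eps j p - phi j v.
have d0 : 0 < d.
  rewrite /d subn_gt0 ltnNge; apply/negP => hook_le.
  have [a [b [Ev ca]]] := phi_prefix j v.
  have := SLw (p ++ a) b; rewrite -catA -Ev => /(_ E j); rewrite !mult_cat; lia.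
set w1 := e_chain (eps j w) j w.
have cw1 : nat_conn j.+2 w w1 by apply: e_chain_nat_conn.
have [_ k1 k2 k3] := e_chain_facts (leqnn (eps j w)); rewrite -/w1 in k1 k2 k3.
have Ew1 : exists v1, w1 = e_chain d j p ++ v1.
  exists (e_chain (eps j w - d) j v); rewrite /w1 {2}E e_chain_cat -?E //; congr (e_chain _ _ _ ++ _).
  by rewrite E eps_cat -/d; lia.
case: Ew1 => v1 Ew1.
have dp : d <= eps j p by rewrite /d leq_subr.
(* The last change made in p happens right after a. The earlier d - 1 changes leave d - 1 unpaired j
   in a, so q1, which ends with the last changed letter, has d more letters j than j+1. *)
have [|u Eu eu] := @e_chain_S d.-1 j p; first lia.
rewrite prednK // in eu; have [a [b [Ea Eb ea pb]]] := en_split eu.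
have [f1 _ _ _] := @e_chain_facts d.-1 j p ltac:(lia).
have pa : phi j a = d.-1.
  by move: f1; rewrite -Eu Ea phi_cat /= eqxx ea pb; lia.
have [_ g1 g2 _] := e_chain_facts dp.
have pca := phi_mult j a.
have pi1 : phi j.+1 w1 = 0 by have := e_chain_phi_next (eps j w) j w; rewrite -/w1; lia.
have pip1 : phi j.+1 (e_chain d j p) = 0 by move: pi1; rewrite Ew1 phi_cat; lia.
have [_ _ _ g4] := e_chain_facts dp.
have cj2 : mult j.+2 (e_chain d j p) = mult j.+2 p by apply: g4; lia.
(* p has as many j+1 as j+2, and e_j has removed d letters j+1 from it; as no j+1 is unpaired,
   exactly d letters j+2 are. So the string of e_(j+1) creates at most d letters j+1 in q1, too few
   to exceed the number of j. *)
have epi : eps j.+1 (e_chain d j p) = d by have := phi_mult j.+1 (e_chain d j p); lia.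
set q1 := a ++ [:: j].
have Ew1' : w1 = q1 ++ b ++ v1 by rewrite Ew1 Eb /q1 -!catA.
set w2 := e_chain (eps j.+1 w1) j.+1 w1.
have cw2 : nat_conn j.+2 w w2 by apply: nat_conn_trans cw1 _; apply: e_chain_nat_conn.
have [_ l1 l2 l3] := e_chain_facts (leqnn (eps j.+1 w1)); rewrite -/w2 in l1 l2 l3.
set k := minn (eps j.+1 w1) (eps j.+1 q1 - phi j.+1 (b ++ v1)).
have kd : k <= d.
  have : eps j.+1 q1 - phi j.+1 (b ++ v1) <= eps j.+1 (q1 ++ b).
    by rewrite phi_cat eps_cat; lia.
  rewrite -epi Eb (_ : a ++ j :: b = q1 ++ b); last by rewrite /q1 -catA.
  by rewrite /k; lia.
have [|_ m1 _ m3] := @e_chain_facts k j.+1 q1; first by rewrite /k; lia.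
have Ew2 : exists v2, w2 = e_chain k j.+1 q1 ++ v2.
  by eexists; rewrite /w2 {2}Ew1' e_chain_cat -?Ew1' //.
case: Ew2 => v2 Ew2.
have e_word : eps j w + mult j w = mult j.+1 w by have := phi_mult j w; lia.
have ew1 : eps j.+1 w1 + mult j.+1 w1 = mult j.+2 w1 by have := phi_mult j.+1 w1; lia.
have c12 : mult j.+2 w1 = mult j.+2 w by apply: k3; lia.
have c21 : mult j w2 = mult j w1 by apply: l3; lia.
have P1 : energy j.+2 w1 = energy j.+2 w.
  have := @wsum_change sq j.+2 j w w1 hj k3; rewrite /energy /sq.
  have -> : mult j w1 = mult j.+1 w by lia.
  have -> : mult j.+1 w1 = mult j w by lia.
  lia.
have P2 : energy j.+2 w2 = energy j.+2 w1.
  have := @wsum_change sq j.+2 j.+1 w1 w2 hi l3; rewrite /energy /sq.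
  have -> : mult j.+1 w2 = mult j.+2 w1 by lia.
  have -> : mult j.+2 w2 = mult j.+1 w1 by lia.
  lia.
have SLw2 : strict_lattice j.+1 w2.
  apply: IH; first by apply: maxdown => //; rewrite P2.
  move=> l hl; have sj := sw j hj; have si := sw j.+1 hi.
  case: (ltngtP l j) => [lj|lj|lj]; last 1 first.
  - by subst l; lia.
  - have -> : mult l w2 = mult l w by rewrite l3 ?k3; lia.
    case: (ltngtP l.+1 j) => [lj2|lj2|lj2].
    + by rewrite l3 ?k3 ?sw; lia.
    + by lia.
    + by rewrite lj2; have := sw l ltac:(lia); rewrite lj2; lia.
  - lia.
have cq1 : mult j q1 = (mult j a).+1 by rewrite /q1 mult_cat /mult /= eqxx; lia.
have cq2 : mult j.+1 q1 = mult j.+1 a by rewrite /q1 mult_cat /mult /= eqnS; lia.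
have cq3 : mult j (e_chain k j.+1 q1) = mult j q1 by apply: m3; lia.
by have := SLw2 _ _ Ew2 j ltac:(lia); rewrite cq3 m1; lia.
Qed.

Lemma max_energy_strict_lattice n w : 1 < n -> max_energy n w -> sorted_cnt n w -> strict_lattice n w.
Proof.
case: n => [|[|n]] // _; elim: n w => [|n IH] w; first exact: strict_lattice_base.
exact: strict_lattice_step.
Qed.

(** Move to a larger value as long as there is one; [B - f x] bounds the number of moves. Whether
    one exists is decided classically, [P] being arbitrary. *)
Lemma max_exists (T : Type) (P : T -> Prop) (f : T -> nat) B :
  (exists x, P x) -> (forall x, P x -> f x <= B) ->
  exists2 x, P x & forall y, P y -> f y <= f x.
Proof.
move=> [x0 px0] HB; have [k hook_seq] : exists k, B - f x0 <= k by exists (B - f x0).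
elim: k x0 px0 hook_seq => [|k IH] x px hook_seq.
  by exists x => // y py; have := HB _ px; have := HB _ py; lia.
case: (classic (exists2 y, P y & f x < f y)) => [[y py xy]|H].
  by apply: (IH y py); have := HB _ py; lia.
by exists x => // y py; rewrite leqNgt; apply/negP => h; apply: H; exists y.
Qed.

Lemma wsum_le g n w B : (forall i c, i < n -> c <= size w -> g i c <= B) -> wsum g n w <= n * B.
Proof.
move=> H; rewrite /wsum -[n in n * B]card_ord -sum_nat_const; apply: leq_sum => i _.
by apply: H => //; apply: count_size.
Qed.

Lemma fn_iter n k i w : 0 < i < n -> k <= phi i w -> exists v,
  [/\ nat_conn n w v, mult i v + k = mult i w, mult i.+1 v = mult i.+1 w + k
    & forall l, l != i -> l != i.+1 -> mult l v = mult l w].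
Proof.
move=> hi; elim: k w => [|k IH] w h; first by exists w; rewrite !addn0; split=> //; apply: nat_conn_refl.
case e: (fn i w) => [u|]; last first.
  have /eqP p0 : phi i w == 0 by rewrite -fn_none e.
  by rewrite p0 in h.
have e' := fn_en e; have [c1 c2 c3] := en_mult e'.
have [|v [v1 v2 v3 v4]] := IH u; first by have := en_phi e'; lia.
exists v; split; try lia.
  by apply: nat_conn_trans v1; apply: nat_conn_sym; apply: nat_conn_e e'.
by move=> l l1 l2; rewrite v4 // c3.
Qed.

(* Among the maximizers of the energy, one maximizing the sum of i * mult i has a
   sorted weight. *)
Lemma nat_conn_strict_lattice n w : 1 < n -> exists2 v, nat_conn n w v & strict_lattice n v.
Proof.
move=> n1.
have [||v1 c1 m1] := @max_exists _ (nat_conn n w) (energy n) (n * (size w * size w)).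
- by exists w; apply: nat_conn_refl.
- move=> x cx; apply: wsum_le => i c _; rewrite (nat_conn_size cx) /sq => h; nia.
pose g i c := i * c.
have [||v2 [c2 p2] m2] := @max_exists _ (fun v => nat_conn n w v /\ energy n v = energy n v1) (wsum g n) (n * (n * size w)).
- by exists v1.
- move=> x [cx _]; apply: wsum_le => i c h; rewrite (nat_conn_size cx) /g => h2; nia.
have mv2 : max_energy n v2.
  by move=> u cu; rewrite p2; apply: m1; apply: nat_conn_trans cu.
exists v2 => //; apply: max_energy_strict_lattice => // i hi; rewrite leqNgt; apply/negP => h.
have [|v [d1 d2 d3 d4]] := @fn_iter n (mult i v2 - mult i.+1 v2) i v2 hi.
  by have := phi_mult i v2; lia.
have pv : energy n v = energy n v1.
  have := @wsum_change sq n i v2 v hi d4; rewrite -p2 /energy /sq.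
  have -> : mult i v = mult i.+1 v2 by lia.
  have -> : mult i.+1 v = mult i v2 by lia.
  lia.
have := m2 v (conj (nat_conn_trans c2 d1) pv).
by have := @wsum_change g n i v2 v hi d4; rewrite /g; nia.
Qed.

(** * Longest hook subwords *)

(** A hook word read from right to left. Nothing is required at the cut, so the middle may lie on
    either side, and the empty word is included. *)
Definition hook_seq (S : seq nat) := exists S1 S2, [/\ S = S1 ++ S2, sorted gtn S1 & sorted leq S2].

Lemma hookE S : S != [::] -> hook_word (rev S) <-> hook_seq S.
Proof.
move=> S0; split.
  move/hook_wordP => [p [r [_ dS]]]; have [D [m [U [E _ _ ok]]]] := descents_hookV S0 dS.
  by exists D, (m :: U); move: ok; rewrite hookVE => /and3P[_ h1 h2].
have fin D m U : hookV D m U -> hook_word (rev (D ++ m :: U)).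
  move=> ok; apply/hook_wordP; exists (size D), (size U); rewrite hookV_descents //.
  by split=> //; case: D {ok}.
move=> [S1 [S2 [E h1 h2]]]; subst S; case: S2 h2 S0 => [|m U] h2 S0.
  rewrite cats0 in S0 *; case/lastP: S1 h1 S0 => // D m h1 _.
  by rewrite -cats1; apply: fin; rewrite /hookV h1.
case/lastP: S1 h1 S0 => [|D x] h1 _; first by apply: fin.
case: (leqP x m) => xm.
  by rewrite cat_rcons; apply: fin; rewrite /hookV h1 /= xm.
apply: fin; rewrite /hookV h2 andbT sorted_gtn_rcons h1 andbT all_rcons /= xm /=.
by move: h1; rewrite sorted_gtn_rcons => /andP[h _]; apply: sub_all h => z /=; lia.
Qed.

Lemma subseq_split (S a b : seq nat) y : subseq S (a ++ y :: b) -> exists Sa Sb,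
  [/\ subseq Sa a, subseq Sb b & S = Sa ++ Sb \/ S = Sa ++ y :: Sb].
Proof.
elim: a S => [|x a IH] [|z S] /=.
- by move=> _; exists [::], [::]; split; rewrite ?sub0seq //; left.
- case: eqP => [->|_] h; first by exists [::], S; split=> //; right.
  by exists [::], (z :: S); split=> //; left.
- by move=> _; exists [::], [::]; split; rewrite ?sub0seq //; left.
case: eqP => [->|nx] h; last first.
  have [Sa [Sb [h1 h2 h3]]] := IH _ h; exists Sa, Sb; split=> //.
  exact: subseq_trans h1 (subseq_cons _ _).
have [Sa [Sb [h1 h2 h3]]] := IH _ h; exists (x :: Sa), Sb; split=> //=; first by rewrite eqxx.
by case: h3 => ->; [left | right].
Qed.

(** At most [phi i b] of the letters i used are unpaired. At least r of them have a partner i+1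
    further left, and these partners all precede t. *)
Lemma subseq_pairM i r t b : subseq (nseq (r + phi i b) i ++ t) b -> subseq (nseq r i.+1 ++ t) b.
Proof.
have sx k (u s : seq nat) : subseq (nseq k i ++ u) s -> subseq u s.
  exact: subseq_trans (suffix_subseq _ _).
elim: b r t => [|x b IH] [|r] t; try exact: sx.
  by rewrite addn0.
have ix : (i.+1 == x) = (x == i.+1) by rewrite eq_sym.
have ix' : (i == x) = (x == i) by rewrite eq_sym.
rewrite addSn /= ix ix'; case: (x =P i.+1) => [->|n1].
  rewrite eqSn => h; apply: IH.
  case: (phi i b) h => [|k] /=; rewrite ?addn0 ?addnS //.
  by apply: subseq_trans; apply: subseq_cons.
by case: (x =P i) => [_|_] h; apply: (IH r.+1); move: h; rewrite ?addnS addSn.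
Qed.

Lemma subseq_pairN i t b : phi i b = 0 -> subseq (i :: t) b -> subseq [:: i.+1, i & t] b.
Proof.
elim: b => [|x b IH] //; case: (x =P i.+1) => [->|n1]; first by rewrite /= !eqxx eqnS.
move=> h; rewrite /= [i.+1 == x]eq_sym (introF eqP n1) [i == x]eq_sym.
move: h; rewrite /= (introF eqP n1); case: (x =P i) => //= _; exact: IH.
Qed.

Definition swap_letter i (z : nat) := if z == i then i.+1 else if z == i.+1 then i else z.
(** Reversal combined with the exchange of i and i+1 keeps the bracket matching, so each statement
    on [phi] yields a twin on [eps]. *)
Definition mirror i (w : seq nat) := rev (map (swap_letter i) w).

Lemma swpK i : involutive (swap_letter i).
Proof.
move=> z; rewrite /swap_letter; case: (z =P i) => [->|n1]; first by rewrite eqSn eqxx.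
by case: (z =P i.+1) => [->|n2]; rewrite ?eqxx // (introF eqP n1) (introF eqP n2).
Qed.

Lemma mirK i : involutive (mirror i).
Proof. by move=> w; rewrite /mirror map_rev revK -map_comp map_id_in // => z _; exact: swpK. Qed.

Lemma mirror_phi i a : phi i (mirror i a) = eps i a /\ eps i (mirror i a) = phi i a.
Proof.
rewrite /mirror; elim: a => //= x a [h1 h2].
rewrite rev_cons -cats1 phi_cat eps_cat h1 h2 /= /swap_letter.
case: (x =P i) => [e|n1].
  have -> : (x == i.+1) = false by lia.
  by rewrite eqSn eqxx /=; lia.
case: (x =P i.+1) => [e|n2]; first by rewrite eqxx eqnS /=; case: (phi i a =P 0); lia.
by rewrite (introF eqP n1) (introF eqP n2); lia.
Qed.

Lemma mirror_subseq i s t : subseq s t -> subseq (mirror i s) (mirror i t).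
Proof. by move=> h; rewrite subseq_rev; apply: map_subseq. Qed.

Lemma mirror_cat i s t : mirror i (s ++ t) = mirror i t ++ mirror i s.
Proof. by rewrite /mirror map_cat rev_cat. Qed.

Lemma mirror_nseq i r z : mirror i (nseq r z) = nseq r (swap_letter i z).
Proof. by rewrite /mirror map_nseq rev_nseq. Qed.

Lemma subseq_pairM' i r t a : eps i a = 0 ->
  subseq (t ++ nseq r i.+1) a -> subseq (t ++ nseq r i) a.
Proof.
have [p _] := mirror_phi i a => e /(mirror_subseq i).
rewrite mirror_cat mirror_nseq /swap_letter eqSn eqxx => h.
have := @subseq_pairM i r (mirror i t) (mirror i a); rewrite p e addn0 => /(_ h) /(mirror_subseq i).
by rewrite mirror_cat mirror_nseq !mirK /swap_letter eqSn eqxx.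
Qed.

Lemma subseq_pairN' i t a : eps i a = 0 ->
  subseq (t ++ [:: i.+1]) a -> subseq (t ++ [:: i.+1; i]) a.
Proof.
have [p _] := mirror_phi i a => e /(mirror_subseq i).
have m1 : mirror i [:: i.+1] = [:: i] by rewrite /mirror /= /swap_letter eqSn eqxx.
have m2 : mirror i [:: i.+1; i] = [:: i.+1; i] by rewrite /mirror /= /swap_letter eqSn !eqxx.
rewrite mirror_cat m1 => h.
have := @subseq_pairN i (mirror i t) (mirror i a); rewrite p => /(_ e h) /(mirror_subseq i).
by rewrite -(mirK i (t ++ _)) mirror_cat m2 mirK.
Qed.

Definition hook_le k W := forall S, subseq S W -> hook_seq S -> size S <= k.

Lemma cat_eq_cases (T : eqType) (S1 S2 Sa Sb : seq T) y : S1 ++ S2 = Sa ++ y :: Sb ->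
  (exists t, S1 = Sa ++ y :: t /\ Sb = t ++ S2) \/ (exists t, S2 = t ++ y :: Sb /\ Sa = S1 ++ t).
Proof.
elim: S1 Sa => [|x S1 IH] [|z Sa] /=.
- by move=> ->; right; exists [::].
- by move=> ->; right; exists (z :: Sa).
- by move=> [-> <-]; left; exists S1.
move=> [-> /IH [[t [-> ->]]|[t [-> ->]]]]; first by left; exists t.
by right; exists t.
Qed.

Lemma sorted_gtn_catP A y B : sorted gtn (A ++ y :: B) ->
  [/\ sorted gtn A, all (ltn y) A, all (gtn y) B & sorted gtn B].
Proof.
rewrite (sorted_pairwise gtn_trans) pairwise_cat /= allrel_consr => /and3P[/andP[h1 _] h2 /andP[h3 h4]].
by split; rewrite ?(sorted_pairwise gtn_trans).
Qed.

Lemma sorted_gtn_catI A y B : sorted gtn A -> all (ltn y) A -> all (gtn y) B -> sorted gtn B ->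
  sorted gtn (A ++ y :: B).
Proof.
rewrite !(sorted_pairwise gtn_trans) pairwise_cat /= allrel_consr => h1 h2 h3 h4.
rewrite h1 h3 h4 !andbT; apply/andP; split; first exact: h2.
apply/allrelP => u v /(allP h2) /= h /(allP h3) /=; lia.
Qed.

Lemma sorted_leq_catP A y B : sorted leq (A ++ y :: B) ->
  [/\ sorted leq A, all (geq y) A, all (leq y) B & sorted leq B].
Proof.
rewrite (sorted_pairwise leq_trans) pairwise_cat /= allrel_consr => /and3P[/andP[h1 _] h2 /andP[h3 h4]].
by split; rewrite ?(sorted_pairwise leq_trans).
Qed.

Lemma sorted_leq_catI A y B : sorted leq A -> all (geq y) A -> all (leq y) B -> sorted leq B ->
  sorted leq (A ++ y :: B).
Proof.
rewrite !(sorted_pairwise leq_trans) pairwise_cat /= allrel_consr => h1 h2 h3 h4.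
rewrite h1 h3 h4 !andbT; apply/andP; split; first exact: h2.
apply/allrelP => u v /(allP h2) /= h /(allP h3) /=; lia.
Qed.

Lemma all_sub (p q : pred nat) s : all p s -> (forall z, p z -> q z) -> all q s.
Proof. by move=> h H; apply: sub_all h. Qed.

Lemma subseq_cons_ins (Sa Sb a b : seq nat) y : subseq Sa a -> subseq Sb b ->
  subseq (Sa ++ y :: Sb) (a ++ y :: b).
Proof. by move=> h1 h2; apply: cat_subseq => //=; rewrite eqxx. Qed.

Lemma subseq_cat_skip (Sa Sb a b : seq nat) y : subseq Sa a -> subseq Sb b ->
  subseq (Sa ++ Sb) (a ++ y :: b).
Proof. by move=> h1 h2; apply: cat_subseq => //; apply: subseq_trans h2 (subseq_cons _ _). Qed.

(** Lowering a letter of S in place fails only if an i follows it in the decreasing part or letters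
    i+1 precede it in the increasing part. In the first case that i has a partner i+1 within b,
    which replaces the lowered letter. In the second the preceding i+1 are traded for letters i of a
    matched with them. *)
Lemma hook_seq_down i a b S : eps i a = 0 -> phi i b = 0 -> subseq S (a ++ i.+1 :: b) -> hook_seq S ->
  exists S', [/\ subseq S' (a ++ i :: b), hook_seq S' & size S' = size S].
Proof.
move=> ea pb /subseq_split [Sa [Sb [ha hb [ES|ES]]]] hS.
  by exists S; split=> //; rewrite ES; apply: subseq_cat_skip.
case: (hS) => [S1 [S2 [E s1 s2]]]; have H := E; rewrite ES in H.
move: H => /esym /cat_eq_cases [[T [E1 E2]]|[T [E1 E2]]].
  move: s1; rewrite E1 => /sorted_gtn_catP [g1 g2 g3 g4].
  case: T E1 E2 g3 g4 => [|t T] E1 E2 g3 g4.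
    exists (Sa ++ i :: Sb); split; [exact: subseq_cons_ins| |by rewrite ES !size_cat].
    exists (Sa ++ [:: i]), S2; rewrite E2 -catA; split=> //.
    by apply: sorted_gtn_catI => //; apply: all_sub g2 _ => z /=; lia.
  have [ti|nti] := eqVneq t i.
    exists S; split=> //; rewrite ES; apply: subseq_cat_skip => //.
    by rewrite E2 ti in hb *; apply: subseq_pairN.
  have tlt : t < i by move: g3 => /= /andP[]; lia.
  exists (Sa ++ i :: Sb); split; [exact: subseq_cons_ins| |by rewrite ES !size_cat].
  exists (Sa ++ i :: t :: T), S2; rewrite -catA E2; split=> //.
  apply: sorted_gtn_catI => //; first by apply: all_sub g2 _ => z /=; lia.
  apply/allP => z; rewrite inE => /orP[/eqP -> //|zT].
  have : all (gtn t) T by apply: (order_path_min gtn_trans g4).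
  by move=> /allP /(_ _ zT) /=; lia.
move: s2; rewrite E1 => /sorted_leq_catP [g1 g2 g3 g4].
have [T0 [r [ET T0i]]] : exists T0 r, T = T0 ++ nseq r i.+1 /\ all (geq i) T0.
  elim/last_ind: T {E1 E2} g1 g2 => [|T t IH] g1 g2; first by exists [::], 0.
  move: g2; rewrite all_rcons => /andP[ti g2].
  have g1' : sorted leq T by move: g1; rewrite -cats1 sorted_leq_cat => /and3P[].
  have [tt|nt] := eqVneq t i.+1.
    have [T0 [r [-> h]]] := IH g1' g2; exists T0, r.+1; split=> //.
    by rewrite -cats1 tt -catA -(addn1 r) nseqD.
  exists (rcons T t), 0; rewrite cats0; split=> //; rewrite all_rcons.
  have ti' : t <= i by move: ti => /=; lia.
  apply/andP; split; first exact: ti'.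
  move: g1; rewrite -cats1 sorted_leq_cat => /and3P[/allrelP h _ _].
  by apply/allP => z /h /(_ (mem_head _ _)) /=; lia.
have ha' : subseq ((S1 ++ T0) ++ nseq r i) a.
  by apply: subseq_pairM' => //; rewrite -catA -ET -E2.
exists (((S1 ++ T0) ++ nseq r i) ++ i :: Sb); split; first exact: subseq_cons_ins.
  exists S1, (T0 ++ nseq r i ++ i :: Sb); split=> //; first by rewrite -!catA.
  rewrite catA; apply: sorted_leq_catI => //.
  - move: g1; rewrite ET !sorted_leq_cat => /and3P[_ -> _] /=.
    apply/andP; split; last first.
      by rewrite (sorted_pairwise leq_trans); elim: (r) => //= k ->; rewrite andbT; apply/allP => z /nseqP [-> _].
    by apply/allrelP => u v /(allP T0i) h /nseqP [-> _].
  - rewrite all_cat T0i /=; apply/allP => z /nseqP [-> _]; exact: leqnn.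
  - by apply: all_sub g3 _ => z /=; lia.
by rewrite ES E2 ET !size_cat /= !size_nseq !addnA.
Qed.

(** The obstacles sit on the other sides: an i+1 just before the letter in the decreasing part,
    letters i just after it in the increasing part. *)
Lemma hook_seq_up i a b S : eps i a = 0 -> phi i b = 0 -> subseq S (a ++ i :: b) -> hook_seq S ->
  exists S', [/\ subseq S' (a ++ i.+1 :: b), hook_seq S' & size S' = size S].
Proof.
move=> ea pb /subseq_split [Sa [Sb [ha hb [ES|ES]]]] hS.
  by exists S; split=> //; rewrite ES; apply: subseq_cat_skip.
case: (hS) => [S1 [S2 [E s1 s2]]]; have H := E; rewrite ES in H.
move: H => /esym /cat_eq_cases [[T [E1 E2]]|[T [E1 E2]]].
  move: s1; rewrite E1 => /sorted_gtn_catP [g1 g2 g3 g4].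
  case: (boolP (i.+1 \in Sa)) => hi.
    have [Sa' ESa] : exists Sa', Sa = Sa' ++ [:: i.+1].
      clear - g1 g2 hi; case/lastP: Sa g1 g2 hi => // A z; rewrite sorted_gtn_rcons.
      move=> /andP[h1 h2]; rewrite all_rcons mem_rcons inE => /andP[/= zi h3].
      case/orP => [/eqP <-|/(allP h1) /=]; last lia.
      by exists A; rewrite cats1.
    exists S; split=> //; rewrite ES -[Sa ++ i :: Sb]cat_rcons.
    apply: subseq_cat_skip => //; rewrite ESa -cats1 -catA.
    by apply: subseq_pairN' => //; rewrite -ESa.
  exists (Sa ++ i.+1 :: Sb); split; [exact: subseq_cons_ins| |by rewrite ES !size_cat].
  exists (Sa ++ i.+1 :: T), S2; rewrite -catA /= -E2; split=> //.
  apply: sorted_gtn_catI => //.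
    apply/allP => z zS; have := allP g2 _ zS => /=.
    by have : z != i.+1; [apply: contraNneq hi => <- | lia].
  by apply: all_sub g3 _ => z /=; lia.
move: s2; rewrite E1 => /sorted_leq_catP [g1 g2 g3 g4].
have [T1 [r [ET T1i]]] : exists T1 r, Sb = nseq r i ++ T1 /\ all (leq i.+1) T1.
  elim: Sb {E1 ES hb} g3 g4 => [|t T' IH] g3 g4; first by exists [::], 0.
  move: g3 => /= /andP[ti g3].
  have [tt|nt] := eqVneq t i.
    have [T0 [r [-> h]]] := IH g3 (path_sorted g4); exists T0, r.+1; split=> //.
    by rewrite tt.
  exists (t :: T'), 0; split=> //=.
  have tt : i < t by lia.
  rewrite tt /=; apply: all_sub (order_path_min leq_trans g4) _ => z; lia.
have hb' : subseq (nseq r i.+1 ++ T1) b.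
  by apply: subseq_pairM; rewrite pb addn0 -ET.
exists (Sa ++ i.+1 :: nseq r i.+1 ++ T1); split; first exact: subseq_cons_ins.
  exists S1, (T ++ i.+1 :: nseq r i.+1 ++ T1); split=> //; first by rewrite E2 -!catA.
  apply: sorted_leq_catI => //.
  - by apply: all_sub g2 _ => z /=; lia.
  - rewrite all_cat T1i andbT; apply/allP => z /nseqP [-> _]; exact: leqnn.
  - move: g4; rewrite ET !sorted_leq_cat => /and3P[_ _ ->] /=; rewrite andbT.
    apply/andP; split; last first.
      by rewrite (sorted_pairwise leq_trans); elim: (r) => //= k ->; rewrite andbT; apply/allP => z /nseqP [-> _].
    by apply/allrelP => u v /nseqP [-> _] /(allP T1i).
by rewrite ES ET !size_cat /= !size_cat !size_nseq.
Qed.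

Lemma ebn_split w v : ebn w = Some v -> exists a b,
  [/\ w = a ++ 2 :: b, v = a ++ 1 :: b & all (fun z => (z != 1) && (z != 2)) a].
Proof.
elim: w v => //= x w IH v; case: (x =P 2) => [-> [<-]|n2]; first by exists [::], w.
case: (x =P 1) => // n1; case: (ebn w) IH => //= u /(_ _ erefl) [a [b [-> -> h]]] [<-].
by exists (x :: a), b; rewrite /= h (introF eqP n1) (introF eqP n2).
Qed.

(** Letters of S before the 2 are at least 3. In the decreasing part only a single 1 can follow the
    2, and it can be moved to the increasing part; in the increasing part the 2 comes first. *)
Lemma hook_seq_down1 a b S : all (leq 3) a -> all (ltn 0) b -> subseq S (a ++ 2 :: b) -> hook_seq S ->
  exists S', [/\ subseq S' (a ++ 1 :: b), hook_seq S' & size S' = size S].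
Proof.
move=> a3 b0 /subseq_split [Sa [Sb [ha hb [ES|ES]]]] hS.
  by exists S; split=> //; rewrite ES; apply: subseq_cat_skip.
case: (hS) => [S1 [S2 [E s1 s2]]]; have H := E; rewrite ES in H.
have Sa3 : all (leq 3) Sa by apply/allP => z /(mem_subseq ha) /(allP a3).
have Sb0 : all (ltn 0) Sb by apply/allP => z /(mem_subseq hb) /(allP b0).
move: H => /esym /cat_eq_cases [[T [E1 E2]]|[T [E1 E2]]].
  move: s1; rewrite E1 => /sorted_gtn_catP [g1 g2 g3 g4].
  exists (Sa ++ 1 :: Sb); split; [exact: subseq_cons_ins| |by rewrite ES !size_cat].
  exists (Sa ++ [:: 1]), Sb; rewrite -catA; split=> //.
    by apply: sorted_gtn_catI => //; apply: all_sub Sa3 _ => z /=; lia.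
  rewrite E2; case: T E1 E2 g3 g4 => [|t [|t2 T]] //= E1 E2 g3 g4.
    have t1 : t = 1 by move: Sb0 g3; rewrite E2 /= => /andP[h _]; rewrite andbT; lia.
    rewrite t1; rewrite path_sortedE ?s2 ?andbT; last exact: leq_trans.
    by move: Sb0; rewrite E2 /= => /andP[_ h]; exact: h.
  move: Sb0 g3 g4; rewrite E2 /= => /and3P[h1 h2 _] /and3P[h3 h4 _] /andP[h5 _]; lia.
move: s2; rewrite E1 => /sorted_leq_catP [g1 g2 g3 g4].
have T0 : T = [::].
  case: T E1 E2 g1 g2 => //= t T E1 E2 g1 /andP[h _].
  by have : t \in Sa; [rewrite E2 mem_cat inE eqxx orbT | move/(allP Sa3) => /=; lia].
exists (Sa ++ 1 :: Sb); split; [exact: subseq_cons_ins| |by rewrite ES !size_cat].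
rewrite T0 cats0 in E2; exists S1, (1 :: Sb); rewrite E2; split=> //.
by rewrite /= path_sortedE ?g4 ?andbT //; exact: leq_trans.
Qed.

Lemma hook_seq_up1 a b S : all (leq 3) a -> all (ltn 0) b -> subseq S (a ++ 1 :: b) -> hook_seq S ->
  exists S', [/\ subseq S' (a ++ 2 :: b), hook_seq S' & size S' = size S].
Proof.
move=> a3 b0 /subseq_split [Sa [Sb [ha hb [ES|ES]]]] hS.
  by exists S; split=> //; rewrite ES; apply: subseq_cat_skip.
case: (hS) => [S1 [S2 [E s1 s2]]]; have H := E; rewrite ES in H.
have Sa3 : all (leq 3) Sa by apply/allP => z /(mem_subseq ha) /(allP a3).
have Sb0 : all (ltn 0) Sb by apply/allP => z /(mem_subseq hb) /(allP b0).
exists (Sa ++ 2 :: Sb); split; [exact: subseq_cons_ins| |by rewrite ES !size_cat].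
move: H => /esym /cat_eq_cases [[T [E1 E2]]|[T [E1 E2]]].
  move: s1; rewrite E1 => /sorted_gtn_catP [g1 g2 g3 g4].
  have T0 : T = [::].
    by case: T E1 E2 g3 g4 => //= t T E1 E2 /andP[h _] _; move: Sb0; rewrite E2 /= => /andP[]; lia.
  rewrite T0 /= in E2; exists (Sa ++ [:: 2]), S2; rewrite E2 -catA; split=> //.
  by apply: sorted_gtn_catI.
move: s2; rewrite E1 => /sorted_leq_catP [g1 g2 g3 g4].
have T0 : T = [::].
  case: T E1 E2 g1 g2 => //= t T E1 E2 g1 /andP[h _].
  by have : t \in Sa; [rewrite E2 mem_cat inE eqxx orbT | move/(allP Sa3) => /=; lia].
rewrite T0 cats0 in E2; exists (Sa ++ [:: 2]), Sb; rewrite -catA; split=> //.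
by apply: sorted_gtn_catI => //; rewrite E2.
Qed.

Lemma hook_le_trans k W W' : (forall S, subseq S W' -> hook_seq S -> exists S', [/\ subseq S' W, hook_seq S' & size S' = size S]) ->
  hook_le k W -> hook_le k W'.
Proof. by move=> H h S sS hS; have [S' [h1 h2 <-]] := H S sS hS; apply: h. Qed.

Lemma hook_le_en k i w v : en i w = Some v -> hook_le k w <-> hook_le k v.
Proof.
move=> /en_split [a [b [-> -> h1 h2]]]; split; apply: hook_le_trans => S.
  exact: hook_seq_up.
exact: hook_seq_down.
Qed.

Lemma hook_le_ebn k w v : all (ltn 0) w -> ebn w = Some v -> hook_le k w <-> hook_le k v.
Proof.
move=> pw /ebn_split [a [b [Ew -> h1]]]; move: pw; rewrite Ew all_cat /= => /andP[pa pb].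
have a3 : all (leq 3) a.
  by apply/allP => z za; have := allP h1 _ za; have := allP pa _ za; rewrite /=; lia.
split; apply: hook_le_trans => S.
  exact: hook_seq_up1.
exact: hook_seq_down1.
Qed.

(** * Decomposition tableaux through reversed rows *)

Lemma nth_letter (v : word) k : nth letter0 v k = (nth 0 (unzip1 v) k, nth false (unzip2 v) k).
Proof. by elim: v k => [|[a b] v IH] [|k] //=; rewrite -?IH ?nth_nil. Qed.

Lemma is_hookw_row r : is_hookw (rev r) <-> hook_word (ceil_row r) /\ primes_in_middle r.
Proof.
split.
  move=> /hookwP [D [m [U [mu [E ok]]]]].
  have Er : r = rev (hookw D m U mu) by rewrite -E revK.
  have Ec : ceil_row r = rev (D ++ m :: U) by rewrite Er ceil_rev unzip1_hookw.
  rewrite Ec; split; first exact: hookV_hook.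
  move=> k; rewrite Ec (middle_rev ok) /letter_at.
  have [hook_seq|hook_seq] := leqP (size r) k; first by rewrite nth_default.
  have sr : size r = (size D + size U).+1 by rewrite Er size_rev size_hookw.
  rewrite Er nth_rev ?size_hookw; last by rewrite -sr.
  rewrite nth_hookw /= => /andP[_ /eqP]; lia.
move=> [h1 h2]; set W := unzip1 (rev r).
have Ec : ceil_row r = rev W by rewrite /W -ceil_rev revK.
move: h1; rewrite Ec => /hook_wordP [p [q [W0 dW]]].
have [D [m [U [E sD sU ok]]]] := descents_hookV W0 dW.
have mid : middle (ceil_row r) = size U by rewrite Ec E (middle_rev ok).
have sr : size r = (size D + size U).+1.
  by have := congr1 size E; rewrite /W size_map size_rev size_cat /= => ->; rewrite addnS.
have -> : rev r = hookw D m U (nth false (unzip2 (rev r)) (size D)); last exact: hookw_ok.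
apply: (@eq_from_nth _ letter0); first by rewrite size_rev size_hookw.
move=> k; rewrite size_rev => hook_seq; rewrite nth_hookw nth_letter -/W E; congr pair.
have [->|nk] := eqVneq k (size D); first by rewrite andbT.
rewrite andbF; apply/negbTE/negP => hb.
have : k = size D.
  have : (letter_at r (size r - k.+1)).2.
    rewrite /letter_at -(revK r) nth_rev ?size_rev; last lia.
    have -> : size r - (size r - k.+1).+1 = k by lia.
    by rewrite nth_letter.
  by move/h2; rewrite mid sr; lia.
by move/eqP: nk.
Qed.

Lemma hook_le_dec k (a b : word) :
  (forall s, subseq s (ceil_row b ++ ceil_row a) -> hook_word s -> size s <= k) <->
  hook_le k (unzip1 (rev a ++ rev b)).
Proof.
have E : unzip1 (rev a ++ rev b) = rev (ceil_row b ++ ceil_row a).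
  by rewrite unzip1_cat !unzip1_rev rev_cat.
rewrite E; split=> H S sS hS.
  case: S sS hS => // x S sS hS.
  rewrite -(size_rev (x :: S)); apply: H; last exact/hookE.
  by rewrite -subseq_rev revK.
rewrite -(size_rev S); apply: H; first by rewrite subseq_rev.
have S0 : rev S != [::] by move: hS; case/lastP: S {sS} => // S x _; rewrite rev_rcons.
by apply/(hookE S0); rewrite revK.
Qed.

(* The third condition of decomposition_tableau, on reversed rows. *)
Definition adj_hooks (T : tableau) := forall i, i.+1 < size T ->
  hook_le (size (nth [::] T i)) (unzip1 (rev (nth [::] T i) ++ rev (nth [::] T i.+1))).

Definition dec_tab n (T : tableau) :=
  [/\ forall r, r \in T -> is_hookw (rev r), all (all (in_alphabet n)) T & adj_hooks T].

Lemma DecTabPlusE n la T : DecTabPlus n la T <-> shape T = la /\ dec_tab n T.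
Proof.
have szc i : size (nth [::] [seq ceil_row r | r <- T] i) = size (nth [::] T i).
  have [hi|hi] := ltnP i (size T); first by rewrite (nth_map [::]) // size_map.
  by rewrite !nth_default ?size_map.
have nthc i : i < size T -> nth [::] [seq ceil_row r | r <- T] i = ceil_row (nth [::] T i).
  by move=> hi; rewrite (nth_map [::]).
split.
  move=> [sh [[h1 h2 h3] h4] h5]; split=> //; split=> //.
    move=> r rT; apply/is_hookw_row; split; last exact: h4.
    by move/allP: h2; apply; apply: map_f.
  move=> i hi; apply/hook_le_dec => s; rewrite -!nthc //; last by apply: ltnW.
  move=> h h'; rewrite -szc; apply: h3 => //; by rewrite size_map.
move=> [sh [h1 h2 h3]]; split=> //; split; last by move=> r /h1 /is_hookw_row [].
split.
- apply/allP => c /mapP [r rT ->]; apply/allP => z /mapP [x xr ->].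
  by move/allP: h2 => /(_ _ rT) /allP /(_ _ xr) /andP[].
- by apply/allP => c /mapP [r rT ->]; have /is_hookw_row [] := h1 _ rT.
move=> i; rewrite size_map => hi s h h'; rewrite szc.
have := h3 _ hi => /hook_le_dec; apply=> //.
by rewrite -!nthc //; apply: ltnW.
Qed.

(** Equality is included so that the trace of an operator on a factor of the word is again such a
    step. *)
Definition nat_step (w v : seq nat) :=
  w = v \/ (exists2 i, 0 < i & en i w = Some v) \/ ebn w = Some v.

Lemma e_bar_ebn y z : e_bar y = Some z -> ebn (unzip1 y) = Some (unzip1 z).
Proof.
elim: y z => //= x y IH z; case: ifP => [_ [<-] /=|_]; first by rewrite set1_unzip1.
by case: ifP => // _; case: (e_bar y) IH => //= u /(_ _ erefl) -> [<-].
Qed.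

Lemma nat_step_e i y z : op_e i y = Some z -> nat_step (unzip1 y) (unzip1 z).
Proof.
case: i => [|[|i]] /=.
- by move/e_bar_ebn => h; right; right.
- by rewrite /e0; case: (first1 y) => [[]|] // [<-]; left; rewrite set1_unzip1.
by move/e_word_unzip => [h _]; right; left; exists i.+1.
Qed.

Lemma ebn_cat a b v : ebn (a ++ b) = Some v -> exists a' b',
  [/\ v = a' ++ b', size a' = size a & (a' = a /\ ebn b = Some b') \/ (ebn a = Some a' /\ b' = b)].
Proof.
elim: a v => [|x a IH] v /=; first by move=> h; exists [::], v; split=> //; left.
case: ifP => [_ [<-]|_]; first by exists (1 :: a), b; split=> //; right.
case: ifP => // _; case: (ebn (a ++ b)) IH => //= u /(_ _ erefl) [a' [b' [-> s h]]] [<-].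
exists (x :: a'), b'; split=> //=; first by rewrite s.
by case: h => [[-> ->]|[-> ->]]; [left | right].
Qed.

Lemma nat_step_size w v : nat_step w v -> size v = size w.
Proof. by case=> [->|[[i _ /en_size]|/ebn_size]]. Qed.

Lemma nat_step_cat a b v : nat_step (a ++ b) v -> exists a' b',
  [/\ v = a' ++ b', size a' = size a, nat_step a a' & nat_step b b'].
Proof.
case=> [<-|[[i i0]|]].
- by exists a, b; split=> //; left.
- rewrite en_cat; case: ifP => _.
    case e: (en i a) => [u|] //= [<-]; exists u, b; split=> //; first exact: en_size e.
      by right; left; exists i.
    by left.
  case e: (en i b) => [u|] //= [<-]; exists a, u; split=> //; first by left.
  by right; left; exists i.
move/ebn_cat => [a' [b' [-> s h]]]; exists a', b'; split=> //.
  by case: h => [[-> _]|[h _]]; [left | right; right].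
by case: h => [[_ h]|[_ ->]]; [right; right | left].
Qed.

(** An operator changes one factor of a concatenation, by the same operator, and fixes the other.
    For the window of two adjacent rows this carries the bound on hook subwords along the
    crystal. *)
Lemma nat_step_hook_win w v s t : nat_step w v -> nat_step (take s (drop t w)) (take s (drop t v)).
Proof.
have aux k (x y : seq nat) : nat_step x y -> nat_step (take k x) (take k y) /\ nat_step (drop k x) (drop k y).
  move=> h; have sy := nat_step_size h.
  move: h; rewrite -{1}(cat_take_drop k x) => /nat_step_cat [a' [b' [E sa ha hb]]].
  have Ea : take k y = a'.
    rewrite E; have [hook_seq|hook_seq] := leqP k (size x); first by rewrite take_size_cat // sa size_takel.
    have b0 : b' = [::].
      by have := nat_step_size hb; rewrite drop_oversize ?(ltnW hook_seq) // => /size0nil.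
    by rewrite b0 cats0 take_oversize // sa take_oversize ltnW.
  have Eb : drop k y = b'.
    by move: E; rewrite -{1}(cat_take_drop k y) Ea => /eqP; rewrite eqseq_cat // => /andP[_ /eqP].
  by rewrite Ea Eb.
by move=> h; have [_ h2] := aux t _ _ h; have [] := aux s _ _ h2.
Qed.

Lemma hook_le_nat_step k w v : all (ltn 0) w -> nat_step w v -> hook_le k w <-> hook_le k v.
Proof.
move=> pw [->//|[[i i0 e]|e]]; first exact: hook_le_en e.
exact: hook_le_ebn e.
Qed.

Lemma revrow_tab sh w : size w = sumn sh -> revrow (tableau_of_revrow sh w) = w.
Proof.
move=> s; rewrite /revrow /tableau_of_revrow -map_comp map_id_in; first by rewrite reshapeKr // s.
by move=> r _; rewrite /= revK.
Qed.

Lemma shape_tab sh w : size w = sumn sh -> shape (tableau_of_revrow sh w) = sh.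
Proof.
move=> s; rewrite /tableau_of_revrow /shape -map_comp.
rewrite (@eq_map _ _ _ size); last by move=> r; rewrite /= size_rev.
by rewrite -/(shape _) reshapeKl // s.
Qed.

Lemma tab_revrow T : tableau_of_revrow (shape T) (revrow T) = T.
Proof.
rewrite /tableau_of_revrow /revrow.
have -> : shape T = shape [seq rev r | r <- T].
  by rewrite /shape -map_comp; apply: eq_map => r; rewrite /= size_rev.
by rewrite flattenK -map_comp map_id_in // => r _; rewrite /= revK.
Qed.

Lemma size_revrow T : size (revrow T) = sumn (shape T).
Proof. by elim: T => //= r T IH; rewrite revrow_cons size_cat size_rev IH. Qed.

Lemma tab_win2 T i : i.+1 < size T ->
  rev (nth [::] T i) ++ rev (nth [::] T i.+1) =
  take (nth 0 (shape T) i + nth 0 (shape T) i.+1) (drop (sumn (take i (shape T))) (revrow T)).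
Proof.
elim: T i => [|r T IH] [|i] //= hi; rewrite revrow_cons; last first.
  by rewrite IH // drop_cat size_rev ltnNge leq_addr /= addKn.
case: T {IH} hi => //= r2 T _; rewrite revrow_cons drop0 catA take_size_cat //.
by rewrite size_cat !size_rev.
Qed.

Lemma adj_hooks_step T T2 : shape T2 = shape T -> posw (revrow T) ->
  nat_step (unzip1 (revrow T)) (unzip1 (revrow T2)) -> adj_hooks T <-> adj_hooks T2.
Proof.
move=> sh pw st.
have sT : size T2 = size T by rewrite -(size_map size) -/(shape _) sh size_map.
have sn i : size (nth [::] T2 i) = size (nth [::] T i).
  have [hi|hi] := ltnP i (size T); last by rewrite !nth_default // sT.
  rewrite -(nth_map _ 0 size) ?sT // -/(shape T2) sh /shape (nth_map [::]) //.
have key i : i.+1 < size T ->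
  hook_le (size (nth [::] T i)) (unzip1 (rev (nth [::] T i) ++ rev (nth [::] T i.+1))) <->
  hook_le (size (nth [::] T2 i)) (unzip1 (rev (nth [::] T2 i) ++ rev (nth [::] T2 i.+1))).
  move=> hi; rewrite sn !tab_win2 ?sT // sh /unzip1 !map_take !map_drop -!/(unzip1 _).
  apply: hook_le_nat_step; last exact: nat_step_hook_win.
  rewrite posw_unzip1 in pw; apply/allP => z /mem_take /mem_drop; exact: (allP pw).
by split=> H i hi; apply/key; rewrite ?sT // -?sT //; apply: H; rewrite ?sT // -?sT.
Qed.

Lemma tab_split T i : i < size T -> exists A C,
  revrow T = A ++ rev (nth [::] T i) ++ C /\ size A = sumn (take i (shape T)).
Proof.
elim: T i => //= r T IH [|i] /= hi; first by exists [::], (revrow T).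
have [A [C [E sA]]] := IH i hi; exists (rev r ++ A), C.
by rewrite revrow_cons E size_cat size_rev sA -catA.
Qed.

Lemma is_hookw_step T T2 : shape T2 = shape T -> posw (revrow T) -> (forall r, r \in T -> is_hookw (rev r)) ->
  (exists i, op_e i (revrow T) = Some (revrow T2) \/ op_f i (revrow T) = Some (revrow T2)) ->
  forall r, r \in T2 -> is_hookw (rev r).
Proof.
move=> sh pw H [i h] r /(nthP [::]) [j hj <-].
have sT : size T2 = size T by rewrite -(size_map size) -/(shape _) sh size_map.
have [A2 [C2 [E2 sA2]]] := tab_split hj; rewrite sT in hj; rewrite sh in sA2.
have [A [C [E sA]]] := tab_split hj.
have okj : is_hookw (rev (nth [::] T j)) by apply/H/mem_nth.
have sn : size (nth [::] T2 j) = size (nth [::] T j).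
  by rewrite -(nth_map _ 0 size) ?sT // -/(shape T2) sh /shape (nth_map [::]).
have pj : posw (rev (nth [::] T j)) by move: pw; rewrite E !posw_cat => /and3P[].
have : hook_win 0 A (rev (nth [::] T j)) C (revrow T2).
  by rewrite E in h; case: h => h; [apply: hook_win_e h | apply: hook_win_f h].
move=> [a' [v' [c' [E' sa sv ov]]]].
move: E'; rewrite E2 => /cat_inj; rewrite sA2 sa sA => /(_ erefl) [_] /cat_inj.
by rewrite sv !size_rev sn => /(_ erefl) [->].
Qed.

Lemma unzip1_alph n (w : word) : all (in_alphabet n) w = all (fun a => 0 < a <= n) (unzip1 w).
Proof. by rewrite all_map. Qed.

Lemma en_alph n i w v : 0 < i < n -> en i w = Some v ->
  all (fun a => 0 < a <= n) v = all (fun a => 0 < a <= n) w.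
Proof.
move=> hi; elim: w v => //= x w IH v; case: ifP => [/andP[/eqP -> _] [<-] /=|_].
  by congr andb; lia.
by case: (en i w) IH => //= u /(_ _ erefl) <- [<-].
Qed.

Lemma set1_alph n b w : all (in_alphabet n) (set1 b w) = all (in_alphabet n) w.
Proof. by rewrite !unzip1_alph set1_unzip1. Qed.

Lemma e_bar_alph n y z : 1 < n -> e_bar y = Some z -> all (in_alphabet n) z = all (in_alphabet n) y.
Proof.
move=> n1; elim: y z => //= x y IH z; case: ifP => [/eqP e [<-] /=|_].
  by rewrite set1_alph /in_alphabet /= e n1 (ltnW n1).
by case: ifP => // _; case: (e_bar y) IH => //= u /(_ _ erefl) <- [<-].
Qed.

Lemma e_alph n i y z : 1 < n -> q_plus_index n i -> op_e i y = Some z ->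
  all (in_alphabet n) z = all (in_alphabet n) y.
Proof.
move=> n1; case: i => [|[|i]] /= hi; first exact: e_bar_alph.
  by rewrite /e0; case: (first1 y) => [[]|] // [<-]; rewrite set1_alph.
by move=> /e_word_unzip [e1 _]; rewrite !unzip1_alph; apply: en_alph e1.
Qed.

Lemma f_alph n i y z : 1 < n -> q_plus_index n i -> op_f i y = Some z ->
  all (in_alphabet n) z = all (in_alphabet n) y.
Proof. by move=> n1 hi /op_ef /(e_alph n1 hi) ->. Qed.

Lemma alph_revrow n T : all (all (in_alphabet n)) T = all (in_alphabet n) (revrow T).
Proof. by elim: T => //= r T IH; rewrite revrow_cons all_cat all_rev IH. Qed.

Lemma alph_pos n w : all (in_alphabet n) w -> posw w.
Proof. by apply: sub_all => z /andP[]. Qed.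

Lemma dec_tab_pos n T : dec_tab n T -> posw (revrow T).
Proof. by move=> [_ h _]; rewrite alph_revrow in h; apply: alph_pos h. Qed.

Lemma dec_tab_step n i T T2 : 1 < n -> q_plus_index n i -> shape T2 = shape T ->
  op_e i (revrow T) = Some (revrow T2) \/ op_f i (revrow T) = Some (revrow T2) ->
  dec_tab n T -> dec_tab n T2.
Proof.
move=> n1 hi sh h dT; have pT := dec_tab_pos dT; case: dT => h1 h2 h3; split.
- by apply: (is_hookw_step sh pT h1); exists i.
- rewrite alph_revrow; rewrite alph_revrow in h2.
  by case: h => h; [rewrite (e_alph n1 hi h) | rewrite (f_alph n1 hi h)].
case: h => h; first exact: (adj_hooks_step sh pT (nat_step_e h)).1.
have pT2 : posw (revrow T2) by rewrite (posw_op_f h).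
by move/op_ef: h => /nat_step_e h; apply: (adj_hooks_step (esym sh) pT2 h).2.
Qed.

Lemma first1_unprimed w b : all unprimed w -> first1 w = Some b -> b = false.
Proof. by elim: w => //= -[a c] w IH /= /andP[/negbTE /= -> h]; case: ifP => _ [] //; apply: IH. Qed.

Lemma set1_unprimed w : all unprimed w -> all unprimed (set1 false w).
Proof. by elim: w => //= x w IH /andP[h1 h2]; case: ifP => _ /=; rewrite ?h1 ?h2 ?IH. Qed.

Lemma unzip2_unprimed (w : word) : all unprimed w = all negb (unzip2 w).
Proof. by rewrite all_map. Qed.

Lemma odflt_unprimed w : all unprimed w -> odflt false (first1 w) = false.
Proof. by move=> h; case e: (first1 w) => [b|] //=; apply: first1_unprimed e. Qed.

Lemma e_unprimed n i y z : q_index n i -> op_e i y = Some z -> all unprimed y -> all unprimed z.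
Proof.
case: i => [|[|i]] //= hi; last by move=> /e_word_unzip [_ e2]; rewrite !unzip2_unprimed e2.
elim: y z => //= -[a [|]] y IH z; first by move=> _ /=.
case: ifP => [_ [<-] /= h |_]; first by rewrite /= /unprimed /= odflt_unprimed //= set1_unprimed.
by case: ifP => // _; case: (e_bar y) IH => //= u /(_ _ erefl) h [<-] /= /h ->.
Qed.

Lemma f_unprimed n i y z : q_index n i -> op_f i y = Some z -> all unprimed y -> all unprimed z.
Proof.
case: i => [|[|i]] //= hi; last by move=> /e_word_f_word /e_word_unzip [_ e2]; rewrite !unzip2_unprimed e2.
elim: y z => //= -[a [|]] y IH z; first by move=> _ /=.
case: ifP => [_ [<-] /= h |_]; first by rewrite /= /unprimed /= odflt_unprimed //= set1_unprimed.
by case: ifP => // _; case: (f_bar y) IH => //= u /(_ _ erefl) h [<-] /= /h ->.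
Qed.

(** * Rows of strict lattice words *)

Lemma mult_all k (p : seq nat) : k \notin p -> mult k p = 0.
Proof. by move=> h; apply/count_memPn. Qed.

(** Earlier letters exceed N. A first letter x < N would occur without any x+1, and a second letter
    z < N would meet at most one z+1, so the row begins with N, or N N. Then D is empty, and a
    weakly increasing row with letters at most N is constant. *)
Lemma strict_lattice_row n N p D m U rest : strict_lattice n (p ++ (D ++ m :: U) ++ rest) -> N <= n ->
  all (ltn N) p -> hookV D m U -> all (fun z => 0 < z <= N) (D ++ m :: U) ->
  D ++ m :: U = nseq (size D + size U).+1 N /\ (N < n -> (size D + size U).+1 < mult N.+1 p).
Proof.
move=> sl Nn pN ok; set v := D ++ m :: U => vN.
have sv : size v = (size D + size U).+1 by rewrite /v size_cat /= addnS.
have c0 z : z <= N -> mult z p = 0.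
  by move=> zN; apply: mult_all; apply/negP => /(allP pN) /=; lia.
have pre a b z : v = a ++ b -> 0 < z < n -> 0 < mult z (p ++ a) -> mult z (p ++ a) < mult z.+1 (p ++ a).
  by move=> E hz; apply: (sl (p ++ a) (b ++ rest)) => //; rewrite -/v E -!catA.
have Ev : v = nseq (size v) N.
  have h1 : exists v', v = N :: v'.
    case Ev: v sv => [|x v'] // _; exists v'; congr cons.
    have /andP[x0 xN] : 0 < x <= N by have := vN; rewrite Ev /= => /andP[].
    have := pre [:: x] v' x Ev; rewrite !mult_cat (c0 x xN) /mult /= eqxx (ltn_eqF (ltnSn x)).
    have [->//|nx] := eqVneq x N; have xN' : x < N by rewrite ltn_neqAle nx.
    by rewrite x0 (leq_trans xN' Nn) => /(_ isT) /(_ isT); rewrite -!/(mult _ _) c0.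
  case: h1 => v' Ev.
  have h2 : forall z v'', v' = z :: v'' -> z = N.
    move=> z v'' Ev'; have /andP[x0 xN] : 0 < z <= N by have := vN; rewrite Ev Ev' /= => /and3P[].
    have [->//|nx] := eqVneq z N.
    have E2 : v = [:: N; z] ++ v'' by rewrite Ev Ev'.
    have := pre [:: N; z] v'' z E2; rewrite !mult_cat (c0 z xN) /mult /= eqxx.
    have zN : z < N by rewrite ltn_neqAle nx.
    rewrite (eq_sym N z) (negbTE nx) (ltn_eqF (ltnSn z)) x0 (leq_trans zN Nn) => /(_ isT) /(_ isT).
    by rewrite -!/(mult _ _) !c0 //; case: (N == z.+1).
  have D0 : D = [::].
    move: ok (Ev : D ++ m :: U = N :: v') h2; clear; case: D => // d D ok /= [dN Ev] h2.
    have [y [w [E yd]]] : exists y w, D ++ m :: U = y :: w /\ y < d.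
      move: ok; rewrite hookV_cons => /andP[hd _].
      by case: D {Ev} hd => [|y D] /= hd; [exists m, U | exists y, (D ++ m :: U)].
    by move: yd; rewrite (h2 y w) -?Ev // dN ltnn.
  subst D; have mN : m = N by case: Ev.
  apply/all_pred1P/allP => z zv /=.
  have := hookV_U ok; move: vN zv; rewrite /v /= => /andP[_ /allP aN] + /allP aU; rewrite inE => /orP[/eqP -> |zU].
    by rewrite mN.
  by have := aN _ zU; have := aU _ zU; rewrite mN /=; lia.
split; first by rewrite -sv.
have cv k : mult k v = (N == k) * (size v) by rewrite Ev /mult count_nseq size_nseq.
have N0 : 0 < N by move: vN; rewrite Ev sv /= => /andP[/andP[]]; lia.
move=> Nn'; have := pre v [::] N; rewrite cats0 !(mult_cat _ p v) !cv eqxx (_ : (N == N.+1) = false); last lia.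
by rewrite c0 // sv; move=> /(_ erefl); lia.
Qed.

(** * Connectedness of the fibres of Q *)

Fixpoint weak_bound N (VS : seq (seq nat)) : Prop :=
  if VS is v :: VS' then
    all (fun z => 0 < z <= N) v /\ (v = nseq (size v) N -> weak_bound N.-1 VS')
  else True.

Fixpoint lowrows N (la : seq nat) : seq (seq nat) :=
  if la is l :: la' then nseq l N :: lowrows N.-1 la' else [::].

(** The lattice condition at the end of a row of letters N compares its length with the number of
    N+1 so far, which is the length of the row before: the shape is strict. The bound stays positive
    on every row, which limits their number. *)
Lemma strict_lattice_low n N p VS : strict_lattice n (p ++ flatten VS) -> N <= n -> all (ltn N) p ->
  (forall v, v \in VS -> exists D m U, v = D ++ m :: U /\ hookV D m U) -> weak_bound N VS ->
  [/\ VS = lowrows N (shape VS), sorted gtn (shape VS), size VS <= N, all (ltn 0) (shape VS)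
    & (N < n -> VS != [::] -> head 0 (shape VS) < mult N.+1 p)].
Proof.
elim: VS N p => [|v VS IH] N p sl Nn pN ok b //=.
have [D [m [U [Ev okv]]]] := ok v (mem_head _ _).
move: b => /= [vN b].
move: sl; rewrite /= => sl.
have [||Ev2 hc] := @strict_lattice_row n N p D m U (flatten VS) _ Nn pN okv; rewrite -?Ev //.
have sv : size v = (size D + size U).+1 by rewrite Ev size_cat /= addnS.
rewrite -Ev -sv in Ev2 hc.
have N0 : 0 < N by move: vN; rewrite Ev2 sv /= => /andP[/andP[]]; lia.
have [||||g1 g2 g3 g4 g5] := IH N.-1 (p ++ v) _ _ _ _ (b Ev2).
- by rewrite -catA.
- lia.
- rewrite all_cat; apply/andP; split; first by apply: sub_all pN => z /=; lia.
  by rewrite Ev2; apply/allP => z /nseqP [-> _] /=; lia.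
- by move=> u uV; apply: ok; rewrite inE uV orbT.
split=> //.
- by rewrite -g1 -Ev2.
- case: VS {IH sl ok b} g1 g2 g3 g4 g5 => //= u VS g1 g2 g3 g4 g5; rewrite g2 andbT.
  have := g5 ltac:(lia) isT; rewrite prednK // mult_cat {1}Ev2 /mult count_nseq /= eqxx mul1n.
  have -> : count (pred1 N) p = 0 by apply: mult_all; apply/negP => /(allP pN) /=; lia.
  by [].
- lia.
- by rewrite sv.
- by move=> h _; apply: hc.
Qed.

Definition word_step (I : pred crystal_index) (y z : word) := exists2 i, I i & op_f i y = Some z.
Definition word_conn I := clos_refl_sym_trans word (word_step I).

Lemma word_conn_sub (I J : pred crystal_index) y z : subpred I J -> word_conn I y z -> word_conn J y z.
Proof.
move=> IJ; elim=> {y z}; [|exact: rst_refl|by move=> ????; apply: rst_sym|].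
  by move=> y z [i /IJ Ji h]; apply: rst_step; exists i.
by move=> x y z _ h1 _ h2; apply: rst_trans h1 h2.
Qed.

Lemma q_sub n : subpred (q_index n) (q_plus_index n).
Proof. by case=> //= k /andP[]. Qed.

Lemma word_conn_inv (I : pred crystal_index) (P : word -> Prop) y z :
  (forall y z i, I i -> op_f i y = Some z -> P y <-> P z) -> word_conn I y z -> P y <-> P z.
Proof.
move=> H; elim=> {y z}; [by move=> y z [i]; apply: H|by []|by move=> y z _ ->|].
by move=> x y z _ -> _ ->.
Qed.

Lemma word_conn_e (I : pred crystal_index) i y z : I i -> op_e i y = Some z -> word_conn I y z.
Proof. by move=> Ii /op_ef h; apply/rst_sym/rst_step; exists i. Qed.

Lemma hist_word_conn n (I : pred crystal_index) w w2 : 1 < n -> subpred I (q_plus_index n) ->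
  all (in_alphabet n) w -> word_conn I w w2 ->
  [/\ all (in_alphabet n) w2, hist w2 = hist w & dec_tab n (Pdec w) <-> dec_tab n (Pdec w2)].
Proof.
move=> n1 sI aw c.
pose P y := [/\ all (in_alphabet n) y, hist y = hist w & dec_tab n (Pdec w) <-> dec_tab n (Pdec y)].
suff : P w <-> P w2 by case=> h _; apply: h.
apply: word_conn_inv c => y z i Ii e.
have ealph := f_alph n1 (sI _ Ii) e.
split=> -[h1 h2 h3].
  have py := alph_pos h1; have [eP eh] := hist_op_f py e; split; rewrite ?ealph ?eh //.
  have sh := shape_hist py (alph_pos (etrans ealph h1)) eh.
  split=> [/h3|] d; first by apply: (dec_tab_step n1 (sI _ Ii) sh _ d); right.
  by apply/h3/(dec_tab_step n1 (sI _ Ii) (esym sh) _ d); left; apply/op_ef.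
have h1' : all (in_alphabet n) y by rewrite -ealph.
have py := alph_pos h1'; have [eP eh] := hist_op_f py e; split; rewrite -?eh //.
have sh := shape_hist py (alph_pos h1) eh.
split=> [/h3|] d; first by apply: (dec_tab_step n1 (sI _ Ii) (esym sh) _ d); left; apply/op_ef.
by apply/h3/(dec_tab_step n1 (sI _ Ii) sh _ d); right.
Qed.

(** Commutation of [Pdec] with the operators lifts a path from the reading word of the tableau to w.
    Both directions are proved together because the closure is symmetric. *)
Lemma word_conn_lift n I t u w : 1 < n -> subpred I (q_plus_index n) -> word_conn I t u ->
  all (in_alphabet n) w -> revrow (Pdec w) = t ->
  exists2 w2, word_conn I w w2 & revrow (Pdec w2) = u.
Proof.
move=> n1 sI c aw e; suff : forall w, all (in_alphabet n) w ->
  (revrow (Pdec w) = t -> exists2 w2, word_conn I w w2 & revrow (Pdec w2) = u) /\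
  (revrow (Pdec w) = u -> exists2 w2, word_conn I w w2 & revrow (Pdec w2) = t).
  by move/(_ w aw) => [h _]; apply: h.
move=> {w aw e}; elim: c => {t u}.
- move=> t u [i Ii e] w aw; have pw := alph_pos aw; split=> Ew.
    case Ef: (op_f i w) => [w2|]; last by move: (op_f_none pw Ef); rewrite Ew e.
    have [e2 _] := hist_op_f pw Ef; exists w2; first by apply: rst_step; exists i.
    by move: e2; rewrite Ew e => -[].
  move/op_ef: e => e; case Ef: (op_e i w) => [w2|]; last by move: (op_e_none pw Ef); rewrite Ew e.
  have [e2 _] := hist_op_e pw Ef; exists w2; first exact: word_conn_e Ef.
  by move: e2; rewrite Ew e => -[].
- by move=> t w _; split=> <-; exists w => //; apply: rst_refl.
- by move=> t u _ IH w /IH [].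
move=> s t u _ IH1 _ IH2 w aw; split.
  move=> /(IH1 w aw).1 [w2 c2 e2]; have [aw2 _ _] := hist_word_conn n1 sI aw c2.
  have [w3 c3 e3] := (IH2 w2 aw2).1 e2.
  by exists w3 => //; apply: rst_trans c2 c3.
move=> /(IH2 w aw).2 [w2 c2 e2]; have [aw2 _ _] := hist_word_conn n1 sI aw c2.
have [w3 c3 e3] := (IH1 w2 aw2).2 e2.
by exists w3 => //; apply: rst_trans c2 c3.
Qed.

(** Whether an operator of index bar 1 or i > 0 applies, and how it changes the letters, is
    independent of primes, so a path of unprimed sequences lifts for every choice of bits. *)
Lemma nat_conn_word_conn n u v y : 1 < n -> nat_conn n u v -> unzip1 y = u ->
  exists2 z, word_conn (q_index n) y z & unzip1 z = v.
Proof.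
move=> n1 c e; suff : forall y,
  (unzip1 y = u -> exists2 z, word_conn (q_index n) y z & unzip1 z = v) /\
  (unzip1 y = v -> exists2 z, word_conn (q_index n) y z & unzip1 z = u).
  by move/(_ y) => [h _]; apply: h.
move=> {y e}; elim: c => {u v}.
- by move=> u y; split=> e; exists y => //; apply: rst_refl.
- move=> i w v hi e y; have i0 : i = i.-1.+1 by lia.
  split=> E.
    have sz : size v = size (unzip2 y) by rewrite (en_size e) -E !size_map.
    have Ez : unzip1 (zip v (unzip2 y)) = v by rewrite unzip1_zip // sz.
    exists (zip v (unzip2 y)) => //; apply: (@word_conn_e _ (Idx i)); first exact: hi.
    by rewrite i0 /= -i0; apply: e_word_intro; rewrite ?Ez ?unzip2_zip ?E ?sz.
  have sz : size w = size (unzip2 y) by rewrite -(en_size e) -E !size_map.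
  have Ez : unzip1 (zip w (unzip2 y)) = w by rewrite unzip1_zip // sz.
  exists (zip w (unzip2 y)) => //; apply: rst_sym; apply: (@word_conn_e _ (Idx i)); first exact: hi.
  by rewrite i0 /= -i0; apply: e_word_intro; rewrite ?Ez ?unzip2_zip ?E ?sz.
- move=> w v _ e y; split=> E.
    have : e_bar y != None.
      rewrite e_bar_none negbK; move/ebn_split: e => [a [b [Ew _ pa]]].
      move: E; rewrite Ew => E; clear Ew; elim: y a pa E => [|x y IH] [|z a] //=.
        by move=> _ [-> _].
      by move=> /andP[/andP[z1 z2] pa] [-> Ey]; rewrite (negbTE z1) (negbTE z2) (IH a).
    case Ez: (e_bar y) => [z|] // _; exists z; first exact: (@word_conn_e _ Bar1).
    by move/e_bar_ebn: Ez; rewrite E e => -[].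
  have : f_bar y != None.
    rewrite f_bar_none negbK; move/ebn_split: e => [a [b [_ Ev pa]]].
    move: E; rewrite Ev => E; clear Ev; elim: y a pa E => [|x y IH] [|z a] //=.
      by move=> _ [-> _].
    by move=> /andP[/andP[z1 z2] pa] [-> Ey]; rewrite (negbTE z1) (negbTE z2) (IH a).
  case Ez: (f_bar y) => [z|] // _; exists z; first by apply: rst_step; exists Bar1.
  move/e_bar_f_bar/e_bar_ebn: Ez => Ez; move/ebn_split: e => [a [b [-> Ev pa]]].
  move/ebn_split: Ez => [a2 [b2 [-> E2 pa2]]]; move: E; rewrite E2 Ev; clear - pa pa2.
  elim: a a2 pa pa2 => [|x a IH] [|x2 a2] //=.
  - by move=> _ _ [->].
  - by move=> _ /andP[/andP[h _] _] [e]; rewrite e in h.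
  - by move=> /andP[/andP[h _] _] _ [e]; rewrite -e in h.
  by move=> /andP[_ h] /andP[_ h2] [-> /(IH _ h h2) ->].
- by move=> w v _ IH y; have [h1 h2] := IH y; split.
move=> u w v _ IH1 _ IH2 y; split.
  by move=> /(IH1 y).1 [z c1 /(IH2 z).1 [z2 c2 e2]]; exists z2 => //; apply: rst_trans c1 c2.
by move=> /(IH2 y).2 [z c1 /(IH1 z).2 [z2 c2 e2]]; exists z2 => //; apply: rst_trans c1 c2.
Qed.

Lemma phi_lt i (w : seq nat) : all (gtn i) w -> phi i w = 0.
Proof.
elim: w => //= x w IH /andP[xi /IH ->].
by rewrite (ltn_eqF (leqW xi)) (ltn_eqF xi).
Qed.

Lemma phi_nseq i l k w : phi i (nseq l k ++ w) =
  if k == i then l + phi i w else if k == i.+1 then phi i w - l else phi i w.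
Proof.
elim: l => /= [|l ->]; first by case: ifP => //; case: ifP; rewrite ?subn0.
case: (k =P i) => [->|]; first by rewrite eqnS.
by move=> _; case: ifP => [->|->] //; rewrite subnS.
Qed.

Lemma lowrows_lt i N la : N <= i -> 0 < i -> all (gtn i) (flatten (lowrows N.-1 la)).
Proof.
elim: la N => //= l la IH N Ni i0; rewrite all_cat; apply/andP; split.
  by apply/allP => z /nseqP [-> _] /=; lia.
by apply: IH => //; lia.
Qed.

(** Letters i fill one row, and the row of i+1 before it is at least as long, so every i is
    matched. *)
Lemma phi_low N l la i : 0 < i < N -> head 0 la <= l -> sorted gtn la ->
  phi i (nseq l N ++ flatten (lowrows N.-1 la)) = 0.
Proof.
elim: la N l => [|l2 la IH] N l hi hl sla.
  by rewrite phi_nseq /= (gtn_eqF (proj2 (andP hi))) if_same.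
have h2 : head 0 la <= l2 by move: sla; case: (la) => //= l3 la3 /andP[/ltnW].
rewrite phi_nseq (gtn_eqF (proj2 (andP hi))); case: (N =P i.+1) => [EN|nN] /=.
  rewrite EN /= phi_nseq eqxx phi_lt ?addn0; last by apply: lowrows_lt => //; lia.
  by apply/eqP; rewrite subn_eq0.
by apply: IH => //; [lia | apply: path_sorted sla].
Qed.

(* A letter at the end of the relevant strings is lowered to 1 by e_(k-1), ..., e_1,
   toggled there by e_0 or f_0, and raised again. *)
Lemma word_conn_toggle n p k b s : 0 < k <= n -> all (ltn k) (unzip1 p) ->
  (forall i, 0 < i < k -> phi i (unzip1 s) = 0) ->
  word_conn (q_plus_index n) (p ++ (k, b) :: s) (p ++ (k, ~~ b) :: s).
Proof.
elim: k => // k IH /andP[_ kn] pk ps.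
case: k IH kn pk ps => [|k] IH kn pk ps.
  have f1 c : first1 (p ++ (1, c) :: s) = Some c.
    by clear IH; rewrite first1_cat /=; elim: p pk => //= x p IHp /andP[h /IHp]; rewrite (gtn_eqF h).
  have s1 c d : set1 c (p ++ (1, d) :: s) = p ++ (1, c) :: s.
    by clear IH f1; elim: p pk => //= x p IHp /andP[h /IHp ->]; rewrite (gtn_eqF h).
  case: (b); last by apply: rst_step; exists (Idx 0); rewrite //= /f0 f1 s1.
  by apply: (@word_conn_e _ (Idx 0)); rewrite //= /e0 f1 s1.
have low c : word_conn (q_plus_index n) (p ++ (k.+2, c) :: s) (p ++ (k.+1, c) :: s).
  apply: (@word_conn_e _ (Idx k.+1)); first exact: kn.
  have p0 : phi k.+1 (unzip1 s) = 0 by apply: ps; rewrite ltnS leqnn.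
  clear IH; rewrite /=; elim: p pk {ps} => [|x p IHp] /=; first by rewrite e_word_cons /= eqxx p0.
  by move=> /andP[h /IHp e]; rewrite e_word_cons e /= (gtn_eqF h).
apply: rst_trans (low b) _; apply: rst_trans (rst_sym _ _ _ _ (low (~~ b))).
apply: IH; first exact: ltnW.
  by apply: sub_all pk => z /=; apply: ltnW.
by move=> i /andP[h1 h2]; apply: ps; rewrite h1 ltnW.
Qed.

Lemma is_hookw_nseq v l N : is_hookw v -> unzip1 v = nseq l N -> exists b, v = (N, b) :: noprime (nseq l.-1 N).
Proof.
move=> /hookwP [D [m [U [mu [-> ok]]]]]; rewrite unzip1_hookw => E.
have aN z : z \in D ++ m :: U -> z = N by rewrite E => /nseqP [].
have D0 : D = [::].
  case: D ok aN {E} => // d D ok aN; have hd : head m D < d by move: ok; rewrite hookV_cons => /andP[].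
  move: hd; rewrite (aN d) ?mem_head //; case: D {ok} aN => [|y D] aN /=.
    by rewrite (aN m) ?ltnn // !inE eqxx orbT.
  by rewrite (aN y) ?ltnn // !inE eqxx orbT.
move: E; rewrite D0 /hookw /= => -E; exists mu; case: l E => //= l [-> ->] //.
Qed.

(** p collects the rows already cleared of primes; its letters exceed those of the remaining rows,
    as toggling requires. *)
Lemma word_conn_low n N p (VS : seq word) : N <= n -> all (ltn N) (unzip1 p) ->
  (forall v, v \in VS -> is_hookw v) -> map unzip1 VS = lowrows N (shape VS) ->
  sorted gtn (shape VS) -> size VS <= N ->
  word_conn (q_plus_index n) (p ++ flatten VS) (p ++ noprime (flatten (lowrows N (shape VS)))).
Proof.
elim: VS N p => [|v VS IH] N p Nn pN ok E sl sz /=; first exact: rst_refl.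
move: E => /= [Ev EVS]; have [b Eb] := is_hookw_nseq (ok v (mem_head _ _)) Ev.
have N0 : 0 < N by apply: leq_trans sz.
have sv : size v = (size v).-1.+1 by rewrite Eb.
have Es : noprime (nseq (size v) N) = (N, false) :: noprime (nseq (size v).-1 N) by rewrite sv.
have st : word_conn (q_plus_index n) (p ++ v ++ flatten VS) (p ++ noprime (nseq (size v) N) ++ flatten VS).
  rewrite Es {1}Eb /=; case: b Eb => Eb; last exact: rst_refl.
  apply: word_conn_toggle => //; first by rewrite N0.
  move=> i hi; rewrite unzip1_cat unzip1_noprime.
  have -> : unzip1 (flatten VS) = flatten (lowrows N.-1 (shape VS)).
    by rewrite -EVS /unzip1 map_flatten.
  apply: phi_low => //; last exact: path_sorted sl.
  by move: sl => /=; case: (shape VS) => //= l la /andP[]; lia.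
apply: rst_trans st _; rewrite noprime_cat !catA; apply: IH => //.
- by lia.
- rewrite unzip1_cat unzip1_noprime all_cat; apply/andP; split.
    by apply: sub_all pN => z /=; lia.
  by apply/allP => z /nseqP [-> _] /=; lia.
- by move=> u uV; apply: ok; rewrite inE uV orbT.
- exact: path_sorted sl.
- by move: sz => /=; lia.
Qed.

(** Two letters k followed by a k-1 do not fit in a hook. So S lies in the first block or has at
    most one k, and [b.+1 <= a]. *)
Lemma hook_le_two k a b : 0 < k -> b < a -> hook_le a (nseq a k ++ nseq b k.-1).
Proof.
move=> k0 ba S sS [S1 [S2 [ES h1 h2]]].
have [S3 [S4 [s3 s4 E]]] : exists S3 S4, [/\ subseq S3 (nseq a k), subseq S4 (nseq b k.-1) & S = S3 ++ S4].
  have := sS => /subseqP [m sm Em].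
  exists (mask (take a m) (nseq a k)), (mask (drop a m) (nseq b k.-1)).
  split; try exact: mask_subseq.
  rewrite Em -{1}(cat_take_drop a m) mask_cat // size_takel ?size_nseq //.
  by rewrite sm size_cat !size_nseq leq_addr.
have l3 := size_subseq s3; have l4 := size_subseq s4; rewrite !size_nseq in l3 l4.
have e3 : S3 = nseq (size S3) k.
  by apply/all_pred1P/allP => z /(mem_subseq s3) /nseqP [-> _] /=.
have e4 : S4 = nseq (size S4) k.-1.
  by apply/all_pred1P/allP => z /(mem_subseq s4) /nseqP [-> _] /=.
rewrite E size_cat; case: (size S4) e4 l4 => [|d] e4 l4; first by rewrite addn0.
case: (size S3) e3 l3 => [|[|c]] e3 l3; try lia.
exfalso; have kk : k.-1 < k by lia.
have := ES; rewrite E e3 e4 /=; case: S1 h1 {ES} => [|x [|y S1]] h1 /=.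
- move=> Ek; move: h2; rewrite -Ek (_ : _ :: _ = (k :: k :: nseq c k) ++ k.-1 :: nseq d k.-1) //.
  by move/sorted_leq_catP => [_ /= /andP[h _] _ _]; rewrite leqNgt kk in h.
- move=> [_ Ek]; move: h2; rewrite -Ek (_ : _ :: _ = (k :: nseq c k) ++ k.-1 :: nseq d k.-1) //.
  by move/sorted_leq_catP => [_ /= /andP[h _] _ _]; rewrite leqNgt kk in h.
by move=> [Ex Ey _]; move: h1; rewrite -Ex -Ey /= ltnn.
Qed.

(** * Letters, weights and bounds preserved by insertion *)

Definition conserving (R : word -> word -> Prop) := forall y y', R y y' ->
  perm_eq (unzip1 y) (unzip1 y') /\ (all unprimed y -> all unprimed y').

Lemma conserving_comp R S : conserving R -> conserving S -> conserving (comp_rel R S).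
Proof.
move=> hR hS y y' [z /hR [p1 u1] /hS [p2 u2]]; split; first exact: perm_trans p1 p2.
by move/u1/u2.
Qed.

Lemma conserving_cons R : conserving R -> conserving (cons_rel R).
Proof.
move=> hR _ _ [x [v [v' [-> -> /hR [p u]]]]]; split; first by rewrite /= perm_cons.
by move=> /= /andP[-> /u].
Qed.

Lemma conserving_skip_rel k R : conserving R -> conserving (skip_rel k R).
Proof. by move=> h; elim: k => //= k; apply: conserving_cons. Qed.

Lemma unprimed_hookw D m U mu : all unprimed (hookw D m U mu) = ~~ mu.
Proof.
have pU s : all unprimed (noprime s) by rewrite all_map; apply/allP.
by rewrite /hookw all_cat /= !pU andbT.
Qed.

Lemma unprimed_cat D m U mu rest :
  all unprimed (hookw D m U mu ++ rest) = ~~ mu && all unprimed rest.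
Proof. by rewrite all_cat unprimed_hookw. Qed.

Lemma unprimed_cons x (v : word) : all unprimed (x :: v) = ~~ x.2 && all unprimed v.
Proof. by []. Qed.

Lemma conserving_append_rel s o : conserving (append_rel s o).
Proof.
move=> y y' [].
- by move=> x al rest _ _ _ -> ->.
- move=> x al m U mu rest _ _ _ _ _ -> ->; split; first by rewrite unzip1_cons_hookw unzip1_hookw_cat.
  by rewrite unprimed_cons !unprimed_cat => /and3P[-> _ ->].
move=> x al D m U mu rest _ _ _ _ -> ->; split; first by rewrite unzip1_cons_hookw unzip1_hookw_cat.
by rewrite unprimed_cons !unprimed_cat => /andP[].
Qed.

Lemma conserving_bump_rel s : conserving (bump_rel s).
Proof.
move=> y y' [x al A b C M c N mu rest ok _ _ -> ->]; split.
  rewrite unzip1_bump_in // unzip1_bump_out //; apply/permP => p.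
  by do 4! rewrite /= ?count_cat; rewrite /=; lia.
rewrite /bump_in unprimed_cons unprimed_cat => /and3P[al0 mu0 ur].
rewrite /bump_out; case: M ok => [|m M] ok.
  by rewrite unprimed_cat unprimed_cons al0 mu0.
by case: ifP => _; rewrite unprimed_cat unprimed_cons al0 mu0.
Qed.

Lemma conserving_insert_rel sh k o : conserving (insert_rel sh k o).
Proof.
elim: sh k => [|s sh IH] [|k] /=; try exact: conserving_append_rel; first by [].
by apply: conserving_comp; [exact: conserving_bump_rel | apply: conserving_skip_rel].
Qed.

Lemma conserving_word_rel h : conserving (word_rel h).
Proof.
elim: h => [|[k o] h IH] /=; first by move=> y y' [-> ->].
by apply: conserving_comp; [apply: conserving_cons | apply: conserving_insert_rel].
Qed.

Lemma perm_revrow (T : tableau) : perm_eq (flatten T) (revrow T).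
Proof.
elim: T => //= r T IH; rewrite revrow_cons; apply: perm_cat IH.
by rewrite perm_sym; apply/permPl/perm_rev.
Qed.

Lemma Pdec_wt n w : posw w -> tab_wt n (Pdec w) = word_wt n w.
Proof.
move=> pw; have [r _ _ _] := word_relP pw; have [p _] := conserving_word_rel r.
apply/ffunP => i; rewrite !ffunE (permP (perm_revrow _)).
have E (v : word) : count (fun x : letter => x.1 == i.+1) v = count (pred1 i.+1) (unzip1 v).
  by rewrite count_map.
by rewrite !E (permP p).
Qed.

Lemma Pdec_unprimed w : posw w -> all unprimed w -> all (all unprimed) (Pdec w).
Proof.
move=> pw uw; have [r _ _ _] := word_relP pw; have [_ /(_ uw)] := conserving_word_rel r.
rewrite -!(perm_all _ (perm_revrow _)); elim: (Pdec w) => //= row T IH.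
by rewrite all_cat => /andP[-> /IH].
Qed.

Lemma Pdec_alph n w : all (in_alphabet n) w -> all (all (in_alphabet n)) (Pdec w).
Proof.
move=> aw; have [r _ _ _] := word_relP (alph_pos aw); have [p _] := conserving_word_rel r.
by rewrite alph_revrow unzip1_alph -(perm_all _ p) -unzip1_alph.
Qed.

Lemma Pdec_row_bound n w : all (in_alphabet n) w -> row_bound n (Pdec w).
Proof.
elim: w => //= x w IH /andP[/andP[x0 xn] aw].
have [_ ok _ _] := word_relP (alph_pos aw).
case E: (dec_insert x (Pdec w)) => [[T' k] o].
have [_ _ _ h] := dec_insert_rel ok x0 E.
by rewrite Pdec_cons E; apply: h xn (IH aw).
Qed.

Definition rwords (T : tableau) : seq word := [seq rev r | r <- T].

Lemma shape_rwords T : shape (rwords T) = shape T.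
Proof. by rewrite /shape -map_comp; apply: eq_map => r; rewrite /= size_rev. Qed.

Lemma shape_unzip1 (VS : seq word) : shape (map unzip1 VS) = shape VS.
Proof. by rewrite /shape -map_comp; apply: eq_map => r; rewrite /= size_map. Qed.

Lemma row_bound_weak_bound n T : all (all (in_alphabet n)) T -> forall N, row_bound N T -> weak_bound N (map unzip1 (rwords T)).
Proof.
elim: T => //= r T IH /andP[ar /IH {}IH] N /andP[rN rT]; split; last by move=> _; apply: IH.
apply/allP => z; rewrite unzip1_rev mem_rev => zr.
have := allP rN _ zr => /= ->; rewrite andbT.
by move: ar; rewrite unzip1_alph => /allP /(_ _ zr) /andP[].
Qed.

Lemma adj_hooks_low n T : all (all (in_alphabet n)) T -> sorted gtn (shape T) -> all (ltn 0) (shape T) ->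
  forall N, map unzip1 (rwords T) = lowrows N (shape T) -> adj_hooks T.
Proof.
elim: T => [|r T IH]; first by move=> _ _ _ N _ i.
move=> /= /andP[ar aT] sl /andP[r0 p0] N [Er ET] [|i] /=; last first.
  by rewrite ltnS => hi; apply: (IH aT (path_sorted sl) p0 N.-1 ET).
case: T aT sl ET {IH p0} => // r2 T aT sl /= [Er2 _] _.
rewrite unzip1_cat Er Er2; apply: hook_le_two; last by move: sl => /= /andP[].
have : N \in unzip1 (rev r) by rewrite Er mem_nseq r0 eqxx.
by rewrite unzip1_rev mem_rev; move: ar; rewrite unzip1_alph => /allP h /h /andP[].
Qed.

(** The extremal word is found for the reading word of the tableau and its path is lifted to w.
    Since shape and [dec_tab] are constant along the path, this also shows that [Pdec w] is a
    decomposition tableau. *)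
Lemma to_low n w : 1 < n -> all (in_alphabet n) w -> exists2 w2, word_conn (q_index n) w w2 &
  [/\ map unzip1 (rwords (Pdec w2)) = lowrows n (shape (Pdec w)), sorted gtn (shape (Pdec w)),
      size (shape (Pdec w)) <= n, all (ltn 0) (shape (Pdec w)) & dec_tab n (Pdec w)].
Proof.
move=> n1 aw; have [v cv sv] := nat_conn_strict_lattice (unzip1 (revrow (Pdec w))) n1.
have [t ct Et] := nat_conn_word_conn n1 cv (erefl _).
have [w2 c2 E2] := word_conn_lift n1 (@q_sub n) ct aw (erefl _).
have [aw2 h2 d2] := hist_word_conn n1 (@q_sub n) aw c2.
have sh := shape_hist (alph_pos aw) (alph_pos aw2) h2.
have [_ [ok _] _ _] := word_relP (alph_pos aw2); have al := Pdec_alph aw2.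
have sl2 : strict_lattice n ([::] ++ flatten (map unzip1 (rwords (Pdec w2)))).
  by rewrite /= -map_flatten -/(revrow _) E2 -/(unzip1 _) Et.
have [||||g1 g2 g3 g4 _] := @strict_lattice_low n n [::] _ sl2.
- by [].
- by [].
- move=> u /mapP [u' /mapP [r rT ->] ->]; have [D [m [U [mu [-> okv]]]]] := hookwP (ok _ rT).
  by exists D, m, U; rewrite unzip1_hookw.
- exact: row_bound_weak_bound al _ (Pdec_row_bound aw2).
rewrite shape_unzip1 shape_rwords in g1 g2 g4; rewrite -sh.
exists w2 => //; split=> //.
  by rewrite size_map; move: g3; rewrite !size_map.
by apply/d2; split=> //; apply: adj_hooks_low al g2 g4 _ g1.
Qed.

Lemma same_Q_word_conn n w w' : 1 < n -> all (in_alphabet n) w -> all (in_alphabet n) w' ->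
  hist w = hist w' -> word_conn (q_plus_index n) w w'.
Proof.
move=> n1 aw aw' eh.
have sI : subpred (q_plus_index n) (q_plus_index n) by [].
have plain u : all (in_alphabet n) u -> exists2 u2, word_conn (q_plus_index n) u u2 &
    revrow (Pdec u2) = noprime (flatten (lowrows n (shape (Pdec u)))).
  move=> au; have [u1 c1 [g1 g2 g3 g4 _]] := to_low n1 au.
  have [au1 h1 _] := hist_word_conn n1 (@q_sub n) au c1.
  have sh := shape_hist (alph_pos au) (alph_pos au1) h1.
  have [_ [ok _] _ _] := word_relP (alph_pos au1).
  have c : word_conn (q_plus_index n) (revrow (Pdec u1)) (noprime (flatten (lowrows n (shape (Pdec u))))).
    rewrite -sh -shape_rwords; apply: (@word_conn_low n n [::] (rwords (Pdec u1))) => //.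
    - by move=> v /mapP [r rT ->]; apply: ok.
    - by rewrite shape_rwords sh.
    - by rewrite shape_rwords sh.
    by move: g3; rewrite -sh !size_map.
  have [u2 c2 E2] := word_conn_lift n1 sI c au1 (erefl _).
  by exists u2 => //; apply: rst_trans (word_conn_sub (@q_sub n) c1) c2.
have [u c1 E1] := plain w aw; have [u' c2 E2] := plain w' aw'.
have [au h1 _] := hist_word_conn n1 sI aw c1; have [au' h2 _] := hist_word_conn n1 sI aw' c2.
(* Both ends have the extremal tableau, which depends only on the shape, and the same history;
   reversibility identifies them. *)
suff E : u = u' by apply: rst_trans c1 _; rewrite E; apply: rst_sym.
have [r _ _ _] := word_relP (alph_pos au); have [r' _ _ _] := word_relP (alph_pos au').
have sh : shape (Pdec w) = shape (Pdec w') by apply: shape_hist; rewrite ?(alph_pos aw) ?(alph_pos aw').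
by rewrite h1 E1 sh -E2 eh -h2 in r; apply: word_rel_inj r r'.
Qed.

(** Operators of index other than 0 keep words unprimed, so the extremal tableau is reached without
    primes and e_0 is avoided. *)
Lemma same_Q_word_conn_unprimed n w w' : 1 < n -> all (in_alphabet n) w -> all (in_alphabet n) w' ->
  all unprimed w -> all unprimed w' -> hist w = hist w' -> word_conn (q_index n) w w'.
Proof.
move=> n1 aw aw' uw uw' eh.
have plain u : all (in_alphabet n) u -> all unprimed u -> exists2 u2, word_conn (q_index n) u u2 &
    revrow (Pdec u2) = noprime (flatten (lowrows n (shape (Pdec u)))).
  move=> au uu; have [u1 c1 [g1 _ _ _ _]] := to_low n1 au.
  have [au1 h1 _] := hist_word_conn n1 (@q_sub n) au c1; exists u1 => //.
  have uu1 : all unprimed u1.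
    suff [h _] : all unprimed u <-> all unprimed u1 by apply: h.
    apply: (@word_conn_inv _ (all unprimed) _ _ _ c1) => y z i Ii e; split; first exact: f_unprimed Ii e.
    by move/op_ef: e; apply: e_unprimed Ii.
  have [r _ _ _] := word_relP (alph_pos au1); have [_ /(_ uu1) ur] := conserving_word_rel r.
  rewrite -g1 -map_flatten -/(unzip1 _); apply: word_ext; first by rewrite unzip1_noprime.
  rewrite unzip2_noprime size_map -(size_map snd); apply/all_pred1P; move: ur; rewrite unzip2_unprimed.
  by apply: sub_all => -[].
have [u c1 E1] := plain w aw uw; have [u' c2 E2] := plain w' aw' uw'.
have [au h1 _] := hist_word_conn n1 (@q_sub n) aw c1; have [au' h2 _] := hist_word_conn n1 (@q_sub n) aw' c2.
suff E : u = u' by apply: rst_trans c1 _; rewrite E; apply: rst_sym.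
have [r _ _ _] := word_relP (alph_pos au); have [r' _ _ _] := word_relP (alph_pos au').
have sh : shape (Pdec w) = shape (Pdec w') by apply: shape_hist; rewrite ?(alph_pos aw) ?(alph_pos aw').
by rewrite h1 E1 sh -E2 eh -h2 in r; apply: word_rel_inj r r'.
Qed.

(** * The quasi-isomorphism *)

(** The part common to both types. Commutation lifts edges of the target forwards through f and
    backwards through e, which gives surjectivity onto a component; constancy of q on components
    gives injectivity. *)
Lemma quasi_isomorphism_fibres n I (B C : crystal n I) (T : Type)
    (phi : carrier B -> carrier C) (q : carrier B -> T) :
  (forall b : carrier B, elt b -> elt (phi b)) ->
  (forall (b : carrier B) i c, elt b -> I i -> crystal_e i b = Some c -> elt c) ->
  (forall (b : carrier B) i c, elt b -> I i -> crystal_f i b = Some c -> elt c) ->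
  (forall i (b c : carrier B), crystal_e i b = Some c -> crystal_f i c = Some b) ->
  (forall i (b c : carrier C), crystal_f i b = Some c -> crystal_e i c = Some b) ->
  (forall i (b : carrier B), I i -> elt b -> crystal_e i (phi b) = omap phi (crystal_e i b) /\
                               crystal_f i (phi b) = omap phi (crystal_f i b)) ->
  (forall i (b c : carrier B), I i -> elt b -> crystal_f i b = Some c -> q c = q b) ->
  (forall b c : carrier B, elt b -> elt c -> phi b = phi c -> q b = q c -> b = c) ->
  (forall b : carrier B, elt b -> wt (phi b) = wt b) ->
  (forall b c : carrier B, elt b -> elt c -> q b = q c ->
     clos_refl_sym_trans _ (@crystal_edge n I B) b c) ->
  quasi_isomorphism B C phi /\ forall S, full_subcrystal B S <-> level_set B q S.
Proof.
move=> Hphi He Hf Hef Hfe Hcomm Hq Hinj Hwt Hcon.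
have inv (b c : carrier B) : clos_refl_sym_trans _ (@crystal_edge n I B) b c -> (elt b <-> elt c) /\ q b = q c.
  elim=> {b c} //.
  - by move=> b c [e_bar ec [i Ii h]]; split=> //; rewrite (Hq i b c).
  - by move=> b c _ [h ->]; split=> //; split=> /h.
  - by move=> a b c _ [h ->] _ [h2 ->]; split=> //; split=> [/h/h2|/h2/h].
have push b c : clos_refl_sym_trans _ (@crystal_edge n I B) b c ->
    clos_refl_sym_trans _ (@crystal_edge n I C) (phi b) (phi c).
  elim=> {b c}.
  - move=> b c [e_bar ec [i Ii h]]; apply: rst_step; split; try exact: Hphi.
    by exists i => //; rewrite (Hcomm i b Ii e_bar).2 h.
  - by move=> b; apply: rst_refl.
  - by move=> b c _; apply: rst_sym.
  - by move=> a b c _ h1 _ h2; apply: rst_trans h1 h2.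
have lift s t : clos_refl_sym_trans _ (@crystal_edge n I C) s t -> forall b : carrier B, elt b ->
   (phi b = s -> exists2 c, clos_refl_sym_trans _ (@crystal_edge n I B) b c & phi c = t) /\
   (phi b = t -> exists2 c, clos_refl_sym_trans _ (@crystal_edge n I B) b c & phi c = s).
  elim=> {s t}.
  - move=> s t [es et [i Ii h]] b e_bar; split=> E.
      move: h; rewrite -E (Hcomm i b Ii e_bar).2; case Ef: (crystal_f i b) => [c|] //= [<-].
      exists c => //; apply: rst_step; split=> //; first exact: Hf Ef.
      by exists i.
    move/Hfe: h; rewrite -E (Hcomm i b Ii e_bar).1; case Ef: (crystal_e i b) => [c|] //= [<-].
    exists c => //; apply/rst_sym/rst_step; split=> //; first exact: He Ef.
    by exists i => //; apply: Hef.
  - by move=> s b e_bar; split=> E; exists b => //; apply: rst_refl.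
  - by move=> s t _ IH b /IH [].
  move=> s t u _ IH1 _ IH2 b e_bar; split.
    move=> /(IH1 b e_bar).1 [c bc Ec]; have ec : elt c by apply: (inv _ _ bc).1.1.
    have [d cd Ed] := (IH2 c ec).1 Ec; exists d => //; apply: rst_trans bc cd.
  move=> /(IH2 b e_bar).2 [c bc Ec]; have ec : elt c by apply: (inv _ _ bc).1.1.
  have [d cd Ed] := (IH1 c ec).2 Ec; exists d => //; apply: rst_trans bc cd.
have compE b c : elt b -> clos_refl_sym_trans _ (@crystal_edge n I B) b c <-> elt c /\ q c = q b.
  move=> e_bar; split; first by move=> /inv [h ->]; split=> //; apply/h.
  by move=> [ec h]; apply: Hcon.
split; last first.
  by move=> S; split=> -[b e_bar h]; exists b => // c; rewrite h compE.
split=> // S [b e_bar hS].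
exists (clos_refl_sym_trans _ (@crystal_edge n I C) (phi b)); first by exists (phi b) => //; apply: Hphi.
have eS c : S c -> elt c /\ q c = q b by rewrite hS compE.
split.
- by move=> c /hS /push.
- by move=> c d /eS [ec qc] /eS [ed qd] E; apply: Hinj => //; rewrite qc qd.
- by move=> s /lift /(_ b e_bar) [/(_ erefl) [c bc E] _]; exists c => //; apply/hS.
- by move=> c /eS [ec _]; apply: Hwt.
- by move=> i c Ii /eS [ec _]; apply: Hcomm.
Qed.

Lemma tab_eE i T T2 : tab_e i T = Some T2 <->
  op_e i (revrow T) = Some (revrow T2) /\ shape T2 = shape T.
Proof.
rewrite /tab_e word_eE; split=> [|[-> <-]]; last by rewrite /= tab_revrow.
case e: (op_e i _) => [z|] //= [<-].
have sz : size z = sumn (shape T) by rewrite (e_size e) size_revrow.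
by rewrite revrow_tab ?shape_tab.
Qed.

Lemma tab_fE i T T2 : tab_f i T = Some T2 <->
  op_f i (revrow T) = Some (revrow T2) /\ shape T2 = shape T.
Proof.
rewrite /tab_f word_fE; split=> [|[-> <-]]; last by rewrite /= tab_revrow.
case e: (op_f i _) => [z|] //= [<-].
have sz : size z = sumn (shape T) by rewrite (f_size e) size_revrow.
by rewrite revrow_tab ?shape_tab.
Qed.

Lemma Pdec_e i w : posw w -> tab_e i (Pdec w) = omap Pdec (word_e i w).
Proof.
move=> pw; rewrite word_eE; case e: (op_e i w) => [w2|] /=.
  have [h1 h2] := hist_op_e pw e; apply/tab_eE; split=> //.
  by apply: shape_hist => //; rewrite (posw_op_e e).
by rewrite /tab_e word_eE (op_e_none pw e).
Qed.

Lemma Pdec_f i w : posw w -> tab_f i (Pdec w) = omap Pdec (word_f i w).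
Proof.
move=> pw; rewrite word_fE; case e: (op_f i w) => [w2|] /=.
  have [h1 h2] := hist_op_f pw e; apply/tab_fE; split=> //.
  by apply: shape_hist => //; rewrite (posw_op_f e).
by rewrite /tab_f word_fE (op_f_none pw e).
Qed.

Lemma Pdec_union n m w : 1 < n -> words n m w ->
  union_over_shapes n m (DecTabPlus n) (Pdec w).
Proof.
move=> n1 [sw aw]; have [w2 _ [_ h1 h2 h3 h4]] := to_low n1 aw.
exists (shape (Pdec w)); split=> //; first by rewrite /strict_partition h1 h3.
  have [_ _ -> _] := word_relP (alph_pos aw); by rewrite sumn_hist_shape size_hist.
exact/DecTabPlusE.
Qed.

Lemma words_e n m i w v : 1 < n -> q_plus_index n i -> words n m w -> word_e i w = Some v -> words n m v.
Proof.
move=> n1 hi [sw aw]; rewrite word_eE => e; split; first by rewrite (e_size e).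
by rewrite (e_alph n1 hi e).
Qed.

Lemma words_f n m i w v : 1 < n -> q_plus_index n i -> words n m w -> word_f i w = Some v -> words n m v.
Proof.
move=> n1 hi [sw aw]; rewrite word_fE => e; split; first by rewrite (f_size e).
by rewrite (f_alph n1 hi e).
Qed.

Lemma word_ef i w v : word_e i w = Some v -> word_f i v = Some w.
Proof. by rewrite word_eE word_fE => /op_ef. Qed.

Lemma tab_fe i T T2 : tab_f i T = Some T2 -> tab_e i T2 = Some T.
Proof. by move/tab_fE => [h1 h2]; apply/tab_eE; split=> //; apply/op_ef. Qed.

Lemma Qdec_f i w v : posw w -> word_f i w = Some v -> Qdec v = Qdec w.
Proof.
move=> pw; rewrite word_fE => e; have [_ h] := hist_op_f pw e.
by apply/Qdec_eq; rewrite ?(posw_op_f e).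
Qed.

Lemma word_conn_edges n (I : pred crystal_index) (E : word -> Prop) (wt : word -> {ffun 'I_n -> nat}) y z :
  (forall i y z, I i -> op_f i y = Some z -> E y <-> E z) -> word_conn I y z -> E y ->
  clos_refl_sym_trans _ (@crystal_edge n I (Crystal E wt word_e word_f)) y z.
Proof.
move=> H c; have [] // : (E y <-> E z) /\
  (E y -> clos_refl_sym_trans _ (@crystal_edge n I (Crystal E wt word_e word_f)) y z).
elim: c => {y z}.
- move=> y z [i Ii e]; have Eyz := H _ _ _ Ii e; split=> // hy; apply: rst_step; split=> //=.
    exact/Eyz.
  by exists i => //; rewrite word_fE.
- by move=> y; split=> // _; apply: rst_refl.
- by move=> y z _ [e h]; split=> [|/e/h]; [rewrite e | apply: rst_sym].
move=> x y z _ [e h] _ [e2 h2]; split=> [|hx]; first by rewrite e.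
by apply: rst_trans (h hx) (h2 _); apply/e.
Qed.

Theorem mainTheorem3 (n m : nat) (hn : 2 <= n) :
  [/\ quasi_isomorphism (word_crystal n m) (DecTab_crystal n m) Pdec,
      quasi_isomorphism (word_crystal_plus n m) (DecTab_crystal_plus n m) Pdec,
      forall S : word -> Prop,
        full_subcrystal (word_crystal n m) S <->
        level_set (word_crystal n m) Qdec S
    & forall S : word -> Prop,
        full_subcrystal (word_crystal_plus n m) S <->
        level_set (word_crystal_plus n m) Qdec S].
Proof.
have [h1 h2] : quasi_isomorphism (word_crystal n m) (DecTab_crystal n m) Pdec /\
    forall S, full_subcrystal (word_crystal n m) S <-> level_set (word_crystal n m) Qdec S.
  have pw w : words n m w /\ all unprimed w -> posw w by move=> [[_ /alph_pos]].
  apply: quasi_isomorphism_fibres => /=.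
  - move=> w hw; have [la [g1 g2 g3 g4]] := Pdec_union hn hw.1; exists la; split=> //; split=> //.
    exact: Pdec_unprimed (pw _ hw) hw.2.
  - move=> w i v [hw uw] Ii e; split; first exact: words_e hn (q_sub Ii) hw e.
    by move: e; rewrite word_eE => /(e_unprimed Ii) ->.
  - move=> w i v [hw uw] Ii e; split; first exact: words_f hn (q_sub Ii) hw e.
    by move: e; rewrite word_fE => /(f_unprimed Ii) ->.
  - exact: word_ef.
  - exact: tab_fe.
  - by move=> i w _ /pw h; split; [apply: Pdec_e | apply: Pdec_f].
  - by move=> i w v _ /pw; apply: Qdec_f.
  - by move=> w v /pw h /pw h'; apply: PQ_inj.
  - by move=> w /pw; apply: Pdec_wt.
  - move=> w v hw hv /(Qdec_eq (pw _ hw) (pw _ hv)) e; case: hw hv => [[sw aw] uw] [[sv av] uv].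
    apply: (word_conn_edges (E := fun y => words n m y /\ all unprimed y) (word_wt n) _ (same_Q_word_conn_unprimed hn aw av uw uv e)) => //.
    move=> i y z Ii e'; split=> -[hy uy]; split.
    + by apply: words_f hn (q_sub Ii) hy _; rewrite word_fE; apply: e'.
    + exact: f_unprimed Ii e' uy.
    + by apply: words_e hn (q_sub Ii) hy _; rewrite word_eE; exact/op_ef.
    + by apply: e_unprimed Ii _ uy; exact/op_ef.
have [h3 h4] : quasi_isomorphism (word_crystal_plus n m) (DecTab_crystal_plus n m) Pdec /\
    forall S, full_subcrystal (word_crystal_plus n m) S <-> level_set (word_crystal_plus n m) Qdec S.
  have pw w : words n m w -> posw w by move=> [_ /alph_pos].
  apply: quasi_isomorphism_fibres => /=.
  - by move=> w hw; apply: Pdec_union.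
  - by move=> w i v hw Ii; apply: words_e.
  - by move=> w i v hw Ii; apply: words_f.
  - exact: word_ef.
  - exact: tab_fe.
  - by move=> i w _ /pw h; split; [apply: Pdec_e | apply: Pdec_f].
  - by move=> i w v _ /pw; apply: Qdec_f.
  - by move=> w v /pw h /pw h'; apply: PQ_inj.
  - by move=> w /pw; apply: Pdec_wt.
  - move=> w v hw hv /(Qdec_eq (pw _ hw) (pw _ hv)) e.
    apply: (word_conn_edges (E := words n m) (word_wt n) _ (same_Q_word_conn hn hw.2 hv.2 e) hw) => i y z Ii e'; split=> hy.
      by apply: words_f hn Ii hy _; rewrite word_fE; apply: e'.
    by apply: words_e hn Ii hy _; rewrite word_eE; exact/op_ef.
by split.
Qed.
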